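(* There is no sequence $\langle T_n\mid n<\omega\rangle$ of $\Sigma^{\boldsymbol{\alpha}}_1$-sound, $\Pi^{\boldsymbol{\alpha}}_1$-definable extensions of $\mathsf{KP}_1+\mathsf{Exists}(\boldsymbol{\alpha})$ such that for each $n<\omega$, $T_n\vdash \mathsf{RFN}_{\Sigma^{\boldsymbol{\alpha}}_1}(T_{n+1})$.
   Context: All theories are in the language $\{\in\}$ of set theory. $\Delta_0$-formulas are the formulas with only bounded quantifiers; $\Sigma_1$-formulas are those of the form $\exists x\,\psi$ with $\psi\in\Delta_0$, and $\Pi_1$-formulas those of the form $\forall x\,\psi$ with $\psi\in\Delta_0$ (free variables allowed). $\mathsf{KP}_1$ is the theory with axioms Extensionality, Union, Pairing, Infinity, $\Delta_0$-Separation, $\Sigma_1$-Collection ($\forall x\in a\,\exists y\,\phi(x,y)\to\exists b\,\forall x\in a\,\exists y\in b\,\phi(x,y)$ for $\phi\in\Sigma_1$, parameters allowed), and $\in$-induction ($\forall x[\forall y\in x\,\phi(y)\to\phi(x)]\to\forall x\,\phi(x)$) for $\phi\in\Sigma_1\cup\Pi_1$. $\mathsf{KP}$ is the same with $\in$-induction for all formulas. An ordinal $\xi$ is admissible if $L_\xi\models\mathsf{KP}$. A representation is a $\Sigma_1$-formula $R(x)$ such that $\mathsf{KP}_1\vdash\forall x\forall y(R(x)\wedge R(y)\to x=y)$. A boldface letter $\boldsymbol{\alpha}$ denotes a representation, with formula $R^{\boldsymbol{\alpha}}$; it represents the ordinal $\alpha$ if $R^{\boldsymbol{\alpha}}$ defines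 $\alpha$ over $L$. $\varphi(\boldsymbol{\alpha})$ abbreviates $\forall x(R^{\boldsymbol{\alpha}}(x)\to\varphi(x))$, and $\mathsf{Exists}(\boldsymbol{\alpha})$ abbreviates $\exists x R^{\boldsymbol{\alpha}}(x)$. A representation $\boldsymbol{\alpha}$ is $\mathsf{KP}_1$-provably admissible if $\mathsf{KP}_1\vdash\forall\xi[R^{\boldsymbol{\alpha}}(\xi)\to\xi\text{ is admissible}]$. Standing assumptions: $\boldsymbol{\alpha}$ is a fixed $\mathsf{KP}_1$-provably admissible representation, the metatheory satisfies $V=L$ and $\mathsf{Exists}(\boldsymbol{\alpha})$, and $\alpha$ is the represented ordinal. $F^z$ is obtained from $F$ by restricting all unrestricted quantifiers to $z$. A formula is $\Sigma^{\boldsymbol{\alpha}}_1$ ($\Pi^{\boldsymbol{\alpha}}_1$) if it is of the form $F^{L_{\boldsymbol{\alpha}}}$ with $F$ a $\Sigma_1$ ($\Pi_1$) formula. $T$ is $\Sigma^{\boldsymbol{\alpha}}_1$-sound if for every $\Sigma_1$ sentence $\varphi$, $T\vdash\varphi^{L_{\boldsymbol{\alpha}}}$ implies $L_\alpha\models\varphi$. $T$ is $\Pi^{\boldsymbol{\alpha}}_1$-definable if the set of codes of its axioms is defined by a $\Pi^{\boldsymbol{\alpha}}_1$ formula; the formalized provability predicate $\mathsf{Pr}_T$ is built from such a defining formula. $\mathsf{RFN}_{\Sigma^{\boldsymbol{\alpha}}_1}(T)$ is the sentence $$\forall\varphi\in\Delta_0\Big(\mathsf{Pr}_T\big(\exists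 x\in L_{\boldsymbol{\alpha}}\;\varphi(x)\big)\to L_{\boldsymbol{\alpha}}\models_{\Sigma_1}\exists x\,\varphi(x)\Big),$$ where the quantifier ranges over codes of $\Delta_0$-formulas $\varphi(x)$ and $\models_{\Sigma_1}$ is the formalized truth predicate for $\Sigma_1$ sentences. *)

(* Defs.v *)
From Stdlib Require Import Arith Bool.

(** * Formulas of the language {∈}, with named variables *)

Inductive form : Type :=
| Mem (x y : nat)
| Eql (x y : nat)
| Not (p : form)
| Imp (p q : form)
| All (x : nat) (p : form).

(** The connectives are overloaded over three interpretations, with
    variables in [A] and formulas in [F]:
    - [form], the formulas themselves;
    - [pre], formulas awaiting a supply of fresh bound variables;
    - [term], Gödel codes of formulas, as sets definable in the language {∈}.
    Axiom schemes are written once and used both in the metatheory and,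
    as sets of codes, inside set theory.  [nm k] is the variable number [k];
    [emb p] is the formula [p] itself. *)
Class Syntax (A F : Type) : Type := {
  mem : A -> A -> F;
  eql : A -> A -> F;
  neg : F -> F;
  imp : F -> F -> F;
  all : A -> F -> F;
  nm : nat -> A;
  emb : form -> F }.

Declare Scope fm_scope.
Delimit Scope fm_scope with fm.
Open Scope fm_scope.

Definition conj_ {A F} {S : Syntax A F} (p q : F) : F := neg (imp p (neg q)).
Definition disj_ {A F} {S : Syntax A F} (p q : F) : F := imp (neg p) q.
Definition iff_ {A F} {S : Syntax A F} (p q : F) : F :=
  conj_ (imp p q) (imp q p).
Definition ex {A F} {S : Syntax A F} (x : A) (p : F) : F := neg (all x (neg p)).
Definition allIn {A F} {S : Syntax A F} (x y : A) (p : F) : F :=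
  all x (imp (mem x y) p).
Definition exIn {A F} {S : Syntax A F} (x y : A) (p : F) : F :=
  neg (allIn x y (neg p)).

Notation "x ∈ y" := (mem x y) (at level 70, no associativity) : fm_scope.
Notation "x ≐ y" := (eql x y) (at level 70, no associativity) : fm_scope.
Notation "∼ p" := (neg p) (at level 75, right associativity) : fm_scope.
Notation "p ⩓ q" := (conj_ p q) (at level 80, right associativity) : fm_scope.
Notation "p ⩔ q" := (disj_ p q) (at level 85, right associativity) : fm_scope.
Notation "p ⇒ q" := (imp p q) (at level 95, right associativity) : fm_scope.
Notation "p ⇔ q" := (iff_ p q) (at level 95, no associativity) : fm_scope.

#[export] Instance form_syntax : Syntax nat form := {
  mem := Mem; eql := Eql; neg := Not; imp := Imp; all := All;
  nm := fun k => k; emb := fun p => p }.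

(** ** Variables, renaming and relativization *)

Fixpoint occurs (v : nat) (p : form) : bool :=
  match p with
  | Mem x y | Eql x y => (x =? v) || (y =? v)
  | Not p => occurs v p
  | Imp p q => occurs v p || occurs v q
  | All x p => (x =? v) || occurs v p
  end.

Fixpoint free (v : nat) (p : form) : bool :=
  match p with
  | Mem x y | Eql x y => (x =? v) || (y =? v)
  | Not p => free v p
  | Imp p q => free v p || free v q
  | All x p => negb (x =? v) && free v p
  end.

Definition sentence (p : form) : Prop := forall v, free v p = false.

(** A formula "φ(x)" is a formula whose only free variable is number 0. *)
Definition unary (p : form) : Prop := forall v, free v p = true -> v = 0.

(** A variable such that neither it nor any larger one occurs in [p]. *)
Fixpoint fresh (p : form) : nat :=
  match p with
  | Mem x y | Eql x y => S (Nat.max x y)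
  | Not p => fresh p
  | Imp p q => Nat.max (fresh p) (fresh q)
  | All x p => Nat.max (S x) (fresh p)
  end.

Fixpoint rename (f : nat -> nat) (p : form) : form :=
  match p with
  | Mem x y => Mem (f x) (f y)
  | Eql x y => Eql (f x) (f y)
  | Not p => Not (rename f p)
  | Imp p q => Imp (rename f p) (rename f q)
  | All x p => All (f x) (rename f p)
  end.

Definition swap (a b x : nat) : nat :=
  if x =? a then b else if x =? b then a else x.

(** For unary [p], [p @ y] is "φ(y)".  Transposing 0 and [y] in all variables,
    the bound ones included, yields an α-variant without capture. *)
Notation "p @ y" := (rename (swap 0 y) p)
  (at level 60, no associativity) : fm_scope.

(** F^z: quantifiers that are already bounded are left alone.
    To be used only when [z] does not occur in the formula. *)
Fixpoint rel (z : nat) (p : form) : form :=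
  match p with
  | Mem _ _ | Eql _ _ => p
  | Not p => Not (rel z p)
  | Imp p q => Imp (rel z p) (rel z q)
  | All x ((Imp (Mem x' y) q) as b) =>
      if (x' =? x) && negb (y =? x)
      then All x (Imp (Mem x' y) (rel z q))
      else All x (Imp (Mem x z) (rel z b))
  | All x b => All x (Imp (Mem x z) (rel z b))
  end.

Inductive Delta0 : form -> Prop :=
| D0_mem x y : Delta0 (x ∈ y)
| D0_eql x y : Delta0 (x ≐ y)
| D0_neg p : Delta0 p -> Delta0 (∼ p)
| D0_imp p q : Delta0 p -> Delta0 q -> Delta0 (p ⇒ q)
| D0_ball x y p : x <> y -> Delta0 p -> Delta0 (allIn x y p).

Definition Sigma1 (p : form) : Prop :=
  exists (x : nat) (q : form), Delta0 q /\ p = ex x q.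
Definition Pi1 (p : form) : Prop :=
  exists (x : nat) (q : form), Delta0 q /\ p = all x q.

(** ** Defining formulas with automatically chosen bound variables

    A [pre] gets a number [d] such that all variables in use are below [d]. *)

Definition pre : Type := nat -> form.

#[export] Instance pre_syntax : Syntax nat pre := {
  mem := fun x y _ => Mem x y;
  eql := fun x y _ => Eql x y;
  neg := fun p d => Not (p d);
  imp := fun p q d => Imp (p d) (q d);
  all := fun x p d => All x (p d);
  nm := fun k => k;
  emb := fun p _ => p }.

Definition bind (f : nat -> pre) : pre := fun d => All d (f d (S d)).

Notation "∀' x , p" := (bind (fun x : nat => (p : pre)))
  (at level 200, x name, right associativity) : fm_scope.
Notation "∃' x , p" := (neg (bind (fun x : nat => (neg (p : pre) : pre))) : pre)
  (at level 200, x name, right associativity) : fm_scope.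
Notation "∀' x ∈ y , p" :=
  (bind (fun x : nat => ((x ∈ y) ⇒ (p : pre) : pre)))
  (at level 200, x name, y at level 69, right associativity) : fm_scope.
Notation "∃' x ∈ y , p" :=
  (neg (bind (fun x : nat => ((x ∈ y) ⇒ neg (p : pre) : pre))) : pre)
  (at level 200, x name, y at level 69, right associativity) : fm_scope.

(** * Basic set-theoretic notions as formulas *)

Definition isEmpty (x : nat) : pre := ∀' y, ∼ (y ∈ x).
Definition isSucc (x y : nat) : pre := ∀' z, z ∈ y ⇔ z ∈ x ⩔ z ≐ x.
Definition isUPair (x y u : nat) : pre := ∀' z, z ∈ u ⇔ z ≐ x ⩔ z ≐ y.
(** [p] is the Kuratowski pair ⟨x,y⟩. *)
Definition isPair (x y p : nat) : pre :=
  ∃' u, ∃' v, isUPair x x u ⩓ isUPair x y v ⩓ isUPair u v p.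

Definition isTrans (x : nat) : pre := ∀' y ∈ x, ∀' z ∈ y, z ∈ x.
Definition isOrd (x : nat) : pre := isTrans x ⩓ ∀' y ∈ x, isTrans y.
Definition isNat (n : nat) : pre :=
  isOrd n ⩓
  ∀' m, (m ∈ n ⩔ m ≐ n) ⇒ isEmpty m ⩔ ∃' k ∈ n, isSucc k m.

Definition app (f x y : nat) : pre := ∃' p ∈ f, isPair x y p.
Definition isFun (f a : nat) : pre :=
  (∀' p ∈ f, ∃' x ∈ a, ∃' y, isPair x y p) ⩓
  (∀' x ∈ a, ∃' y, app f x y) ⩓
  (∀' x ∈ a, ∀' y, ∀' z, app f x y ⇒ app f x z ⇒ y ≐ z).

(** The inductive predicate given by [step]: there is a finite sequence
    containing [c], each entry of which arises from earlier ones by [step]. *)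
Definition built (step : (nat -> pre) -> nat -> pre) (c : nat) : pre :=
  ∃' n, ∃' s, isNat n ⩓ isFun s n ⩓
    (∀' i ∈ n, ∀' e, app s i e ⇒ step (fun e' => ∃' j ∈ i, app s j e') e) ⩓
    ∃' m ∈ n, app s m c.

(** * Gödel codes

    A [term] is a definable set [t]; [c ≗ t] is the formula "c = t". *)

Definition term : Type := nat -> pre.
Definition is_ (c : nat) (t : term) : pre := t c.
Notation "c ≗ t" := (is_ c t) (at level 70, no associativity) : fm_scope.

Definition tvar (x : nat) : term := fun c => c ≐ x.
Fixpoint tnum (k : nat) : term := fun c =>
  match k with
  | 0 => isEmpty c
  | S k => ∃' x, x ≗ tnum k ⩓ isSucc x c
  end.
Definition tpair (s t : term) : term := fun c =>
  ∃' x, ∃' y, x ≗ s ⩓ y ≗ t ⩓ isPair x y c.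

Definition cMem (s t : term) : term := tpair (tnum 0) (tpair s t).
Definition cEql (s t : term) : term := tpair (tnum 1) (tpair s t).
Definition cNot (s : term) : term := tpair (tnum 2) s.
Definition cImp (s t : term) : term := tpair (tnum 3) (tpair s t).
Definition cAll (s t : term) : term := tpair (tnum 4) (tpair s t).

(** ⌜p⌝ *)
Fixpoint quote (p : form) : term :=
  match p with
  | Mem x y => cMem (tnum x) (tnum y)
  | Eql x y => cEql (tnum x) (tnum y)
  | Not p => cNot (quote p)
  | Imp p q => cImp (quote p) (quote q)
  | All x p => cAll (tnum x) (quote p)
  end.

#[export] Instance term_syntax : Syntax term term := {
  mem := cMem; eql := cEql; neg := cNot; imp := cImp; all := cAll;
  nm := tnum; emb := quote }.

(** ** Formalized syntax *)

(** [c] codes a formula all of whose variables, free or bound, satisfy [A]. *)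
Definition isFormIn (A : nat -> pre) (c : nat) : pre :=
  built (fun earlier e =>
    (∃' x, ∃' y, A x ⩓ A y ⩓
       (e ≗ (tvar x ∈ tvar y) ⩔ e ≗ (tvar x ≐ tvar y))) ⩔
    (∃' p, earlier p ⩓ e ≗ (∼ tvar p)) ⩔
    (∃' p, ∃' q, earlier p ⩓ earlier q ⩓ e ≗ (tvar p ⇒ tvar q)) ⩔
    (∃' x, ∃' p, A x ⩓ earlier p ⩓ e ≗ all (tvar x) (tvar p))) c.
Definition isForm : nat -> pre := isFormIn isNat.
(** [c] codes a formula in which the variable [x] does not occur. *)
Definition isFormWithout (x c : nat) : pre :=
  isFormIn (fun y => isNat y ⩓ ∼ (y ≐ x)) c.
Definition isFormWithoutNum (k c : nat) : pre :=
  ∃' x, x ≗ tnum k ⩓ isFormWithout x c.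

Definition isDelta0 (c : nat) : pre :=
  built (fun earlier e =>
    (∃' x, ∃' y, isNat x ⩓ isNat y ⩓
       (e ≗ (tvar x ∈ tvar y) ⩔ e ≗ (tvar x ≐ tvar y))) ⩔
    (∃' p, earlier p ⩓ e ≗ (∼ tvar p)) ⩔
    (∃' p, ∃' q, earlier p ⩓ earlier q ⩓ e ≗ (tvar p ⇒ tvar q)) ⩔
    (∃' x, ∃' y, ∃' p, isNat x ⩓ isNat y ⩓ ∼ (x ≐ y) ⩓ earlier p ⩓
       e ≗ allIn (tvar x) (tvar y) (tvar p))) c.
Definition isSigma1 (c : nat) : pre :=
  ∃' x, ∃' p, isNat x ⩓ isDelta0 p ⩓ c ≗ ex (tvar x) (tvar p).

Definition earlierPair (earlier : nat -> pre) (x y : nat) : pre :=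
  ∃' e, earlier e ⩓ isPair x y e.

(** All free variables of (the formula coded by) [c] are in [s]; the inductive
    predicate is one of pairs ⟨c,s⟩. *)
Definition freeIn (c s : nat) : pre :=
  ∃' cs, isPair c s cs ⩓ built (fun earlier e =>
    ∃' p, ∃' t, isPair p t e ⩓
      ((∃' x ∈ t, ∃' y ∈ t,
          p ≗ (tvar x ∈ tvar y) ⩔ p ≗ (tvar x ≐ tvar y)) ⩔
       (∃' q, earlierPair earlier q t ⩓ p ≗ (∼ tvar q)) ⩔
       (∃' q, ∃' r, earlierPair earlier q t ⩓ earlierPair earlier r t ⩓
          p ≗ (tvar q ⇒ tvar r)) ⩔
       (∃' x, ∃' q, ∃' t', isNat x ⩓ (∀' y, y ∈ t' ⇔ y ∈ t ⩔ y ≐ x) ⩓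
          earlierPair earlier q t' ⩓ p ≗ all (tvar x) (tvar q)))) cs.
Definition isUnary (c : nat) : pre := ∃' s, s ≗ tnum 1 ⩓ freeIn c s.

(** ** Satisfaction in sets *)

(** [A] is the set of assignments n → z. *)
Definition isAssignments (n z A : nat) : pre :=
  ∀' a, a ∈ A ⇔ isFun a n ⩓ ∀' i ∈ n, ∀' u, app a i u ⇒ u ∈ z.

(** The functions [a] and [b] on [n] agree except possibly at [x]. *)
Definition agreeOff (n x a b : nat) : pre :=
  ∀' i ∈ n, ∼ (i ≐ x) ⇒ ∃' u, app a i u ⩓ app b i u.

(** [c] is a formula with variables below [n], [A] is the set of assignments
    n → z, and X = { a ∈ A : (z,∈) ⊨ c[a] }. *)
Definition evaluates (z n A c X : nat) : pre :=
  isNat n ⩓ isAssignments n z A ⩓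
  ∃' cX, isPair c X cX ⩓ built (fun earlier e =>
    ∃' p, ∃' Y, isPair p Y e ⩓
      ((∃' x ∈ n, ∃' y ∈ n, p ≗ (tvar x ∈ tvar y) ⩓
          ∀' a, a ∈ Y ⇔
            a ∈ A ⩓ ∃' u, ∃' v, app a x u ⩓ app a y v ⩓ u ∈ v) ⩔
       (∃' x ∈ n, ∃' y ∈ n, p ≗ (tvar x ≐ tvar y) ⩓
          ∀' a, a ∈ Y ⇔
            a ∈ A ⩓ ∃' u, ∃' v, app a x u ⩓ app a y v ⩓ u ≐ v) ⩔
       (∃' q, ∃' Z, earlierPair earlier q Z ⩓ p ≗ (∼ tvar q) ⩓
          ∀' a, a ∈ Y ⇔ a ∈ A ⩓ ∼ (a ∈ Z)) ⩔
       (∃' q, ∃' Z, ∃' r, ∃' W,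
          earlierPair earlier q Z ⩓ earlierPair earlier r W ⩓
          p ≗ (tvar q ⇒ tvar r) ⩓
          ∀' a, a ∈ Y ⇔ a ∈ A ⩓ (a ∈ Z ⇒ a ∈ W)) ⩔
       (∃' x ∈ n, ∃' q, ∃' Z, earlierPair earlier q Z ⩓
          p ≗ all (tvar x) (tvar q) ⩓
          ∀' a, a ∈ Y ⇔
            a ∈ A ⩓ ∀' b ∈ A, agreeOff n x a b ⇒ b ∈ Z))) cX.

(** z ⊨ c; free variables of [c] are read as universally quantified. *)
Definition models (z c : nat) : pre :=
  (∃' x, x ∈ z) ⩓
  ∃' n, ∃' A, ∃' X, evaluates z n A c X ⩓ ∀' a ∈ A, a ∈ X.

(** ** The constructible hierarchy *)

(** [D] is the set of subsets of [z] definable over (z,∈) with parameters: the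
    parameters are the values of [a] at the variables other than 0.  Values of
    [a] outside [z] are allowed, which only yields the empty set, so that the
    empty set is obtained for z = ∅ as well. *)
Definition isDef (z D : nat) : pre :=
  ∀' y, y ∈ D ⇔
    ∃' n, ∃' A, ∃' c, ∃' X, ∃' a, evaluates z n A c X ⩓ isFun a n ⩓
      ∃' o, isEmpty o ⩓
        ∀' u, u ∈ y ⇔ ∃' b ∈ X, app b o u ⩓ agreeOff n o a b.

(** [xi] is an ordinal and z = L_xi; here L_η is the union of the Def(L_ζ)
    for ζ < η. *)
Definition isL (xi z : nat) : pre :=
  isOrd xi ⩓ ∃' f, ∃' e, isSucc xi e ⩓ isFun f e ⩓
    (∀' eta ∈ e, ∀' w, app f eta w ⇒
       ∀' u, u ∈ w ⇔
         ∃' zeta ∈ eta, ∃' v, ∃' D, app f zeta v ⩓ isDef v D ⩓ u ∈ D) ⩓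
    app f xi z.

(** * Axioms of set theory *)

Definition ax_ext : form :=
  (∀' x, ∀' y, (∀' z, z ∈ x ⇔ z ∈ y) ⇒ x ≐ y) 0.
Definition ax_union : form :=
  (∀' x, ∃' y, ∀' z, z ∈ y ⇔ ∃' w ∈ x, z ∈ w) 0.
Definition ax_pairing : form :=
  (∀' x, ∀' y, ∃' z, ∀' w, w ∈ z ⇔ w ≐ x ⩔ w ≐ y) 0.
Definition ax_infinity : form :=
  (∃' w, (∃' x ∈ w, isEmpty x) ⩓ ∀' x ∈ w, ∃' y ∈ w, isSucc x y) 0.
Definition ax_power : form :=
  (∀' x, ∃' y, ∀' z, (∀' w ∈ z, w ∈ x) ⇒ z ∈ y) 0.

Section Schemes.
  Context {A F : Type} {S : Syntax A F}.

  (** Separation for φ(x), x = 0, in the set 1; 2 must not occur in φ. *)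
  Definition ax_sep (p : F) : F :=
    ex (nm 2) (all (nm 0) (nm 0 ∈ nm 2 ⇔ nm 0 ∈ nm 1 ⩓ p)).

  (** Collection for φ(x,y), x = 0, y = 1, on the set 2; 3 must not occur
      in φ. *)
  Definition ax_coll (p : F) : F :=
    allIn (nm 0) (nm 2) (ex (nm 1) p) ⇒
    ex (nm 3) (allIn (nm 0) (nm 2) (exIn (nm 1) (nm 3) p)).

  (** ∈-induction for φ(x), x = 0; 1 must not occur in φ, and φ(1) is written
      ∀0 (0 = 1 → φ). *)
  Definition ax_ind (p : F) : F :=
    all (nm 0)
      (allIn (nm 1) (nm 0) (all (nm 0) (nm 0 ≐ nm 1 ⇒ p)) ⇒ p) ⇒
    all (nm 0) p.
End Schemes.

(** Axioms may have free variables (the parameters of the schemes); the rule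
    of generalization makes them universally quantified. *)
Definition theory : Type := form -> Prop.

Inductive KP1 : theory :=
| KP1_ext : KP1 ax_ext
| KP1_union : KP1 ax_union
| KP1_pairing : KP1 ax_pairing
| KP1_infinity : KP1 ax_infinity
| KP1_sep p : Delta0 p -> occurs 2 p = false -> KP1 (ax_sep p)
| KP1_coll p : Sigma1 p -> occurs 3 p = false -> KP1 (ax_coll p)
| KP1_foundation p : Sigma1 p \/ Pi1 p -> occurs 1 p = false -> KP1 (ax_ind p).

Inductive ZF : theory :=
| ZF_ext : ZF ax_ext
| ZF_union : ZF ax_union
| ZF_pairing : ZF ax_pairing
| ZF_infinity : ZF ax_infinity
| ZF_power : ZF ax_power
| ZF_sep p : occurs 2 p = false -> ZF (ax_sep p)
| ZF_coll p : occurs 3 p = false -> ZF (ax_coll p)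
| ZF_foundation p : occurs 1 p = false -> ZF (ax_ind p).

Definition V_eq_L : form := (∀' x, ∃' xi, ∃' z, isL xi z ⩓ x ∈ z) 0.

(** [c] codes an axiom of KP (full ∈-induction). *)
Definition isKP (c : nat) : pre :=
  c ≗ quote ax_ext ⩔ c ≗ quote ax_union ⩔
  c ≗ quote ax_pairing ⩔ c ≗ quote ax_infinity ⩔
  (∃' p, isDelta0 p ⩓ isFormWithoutNum 2 p ⩓ c ≗ ax_sep (tvar p)) ⩔
  (∃' p, isSigma1 p ⩓ isFormWithoutNum 3 p ⩓ c ≗ ax_coll (tvar p)) ⩔
  (∃' p, isFormWithoutNum 1 p ⩓ c ≗ ax_ind (tvar p)).

Definition isAdmissible (xi : nat) : pre :=
  ∃' z, isL xi z ⩓ ∀' c, isKP c ⇒ models z c.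

(** * Provability

    Tarski's complete substitution-free calculus for first-order logic with
    equality (A. Tarski, "A simplified formalization of predicate logic with
    identity", 1965). *)

Section LogicalAxioms.
  Context {A F : Type} {S : Syntax A F}.
  Definition lax_k (p q : F) : F := p ⇒ q ⇒ p.
  Definition lax_s (p q r : F) : F := (p ⇒ q ⇒ r) ⇒ (p ⇒ q) ⇒ p ⇒ r.
  Definition lax_contra (p q : F) : F := (∼ p ⇒ ∼ q) ⇒ q ⇒ p.
  Definition lax_dist (x : A) (p q : F) : F :=
    all x (p ⇒ q) ⇒ all x p ⇒ all x q.
  Definition lax_inst (x : A) (p : F) : F := all x p ⇒ p.
  Definition lax_vac (x : A) (p : F) : F := p ⇒ all x p.
  Definition lax_exists (x y : A) : F := ex x (x ≐ y).
  Definition lax_eq (x y z : A) : F := x ≐ y ⇒ x ≐ z ⇒ y ≐ z.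
  Definition lax_meml (x y z : A) : F := x ≐ y ⇒ x ∈ z ⇒ y ∈ z.
  Definition lax_memr (x y z : A) : F := x ≐ y ⇒ z ∈ x ⇒ z ∈ y.
End LogicalAxioms.

Inductive Proves (T : theory) : form -> Prop :=
| Pv_ax p : T p -> Proves T p
| Pv_k p q : Proves T (lax_k p q)
| Pv_s p q r : Proves T (lax_s p q r)
| Pv_contra p q : Proves T (lax_contra p q)
| Pv_dist x p q : Proves T (lax_dist x p q)
| Pv_inst x p : Proves T (lax_inst x p)
| Pv_vac x p : occurs x p = false -> Proves T (lax_vac x p)
| Pv_exists x y : Proves T (lax_exists x y)
| Pv_eq x y z : Proves T (lax_eq x y z)
| Pv_meml x y z : Proves T (lax_meml x y z)
| Pv_memr x y z : Proves T (lax_memr x y z)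
| Pv_mp p q : Proves T (p ⇒ q) -> Proves T p -> Proves T q
| Pv_gen x p : Proves T p -> Proves T (all x p).

Definition extends (T U : theory) : Prop :=
  forall p, Proves U p -> Proves T p.

Definition isLogicalAxiom (e : nat) : pre :=
  (∃' p, ∃' q, isForm p ⩓ isForm q ⩓
     (e ≗ lax_k (tvar p) (tvar q) ⩔ e ≗ lax_contra (tvar p) (tvar q))) ⩔
  (∃' p, ∃' q, ∃' r, isForm p ⩓ isForm q ⩓ isForm r ⩓
     e ≗ lax_s (tvar p) (tvar q) (tvar r)) ⩔
  (∃' x, ∃' p, ∃' q, isNat x ⩓ isForm p ⩓ isForm q ⩓
     e ≗ lax_dist (tvar x) (tvar p) (tvar q)) ⩔
  (∃' x, ∃' p, isNat x ⩓ isForm p ⩓ e ≗ lax_inst (tvar x) (tvar p)) ⩔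
  (∃' x, ∃' p, isNat x ⩓ isFormWithout x p ⩓
     e ≗ lax_vac (tvar x) (tvar p)) ⩔
  (∃' x, ∃' y, isNat x ⩓ isNat y ⩓ e ≗ lax_exists (tvar x) (tvar y)) ⩔
  (∃' x, ∃' y, ∃' z, isNat x ⩓ isNat y ⩓ isNat z ⩓
     (e ≗ lax_eq (tvar x) (tvar y) (tvar z) ⩔
      e ≗ lax_meml (tvar x) (tvar y) (tvar z) ⩔
      e ≗ lax_memr (tvar x) (tvar y) (tvar z))).

(** Pr_T(c), where [ax] defines the set of codes of axioms of T. *)
Definition Pr (ax : nat -> pre) (c : nat) : pre :=
  built (fun earlier e =>
    isLogicalAxiom e ⩔
    ax e ⩔
    (∃' p, ∃' q, earlier p ⩓ earlier q ⩓ q ≗ (tvar p ⇒ tvar e)) ⩔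
    (∃' x, ∃' p, isNat x ⩓ earlier p ⩓ e ≗ all (tvar x) (tvar p))) c.

(** * Structures for the language {∈} *)

Record structure : Type := { dom :> Type; ein : dom -> dom -> Prop }.
Arguments ein {s} _ _.

Definition upd {X : Type} (rho : nat -> X) (x : nat) (a : X) : nat -> X :=
  fun y => if y =? x then a else rho y.

Fixpoint sat (M : structure) (rho : nat -> M) (p : form) : Prop :=
  match p with
  | Mem x y => ein (rho x) (rho y)
  | Eql x y => rho x = rho y
  | Not p => ~ sat M rho p
  | Imp p q => sat M rho p -> sat M rho q
  | All x p => forall a : M, sat M (upd rho x a) p
  end.

Definition valid (M : structure) (p : form) : Prop := forall rho, sat M rho p.

(** [sat1 M p a] is M ⊨ p(a) for unary [p]. *)
Definition sat1 (M : structure) (p : form) (a : M) : Prop :=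
  sat M (fun _ => a) p.

(** The set [l] of [M], as a structure. *)
Definition set_structure (M : structure) (l : M) : structure :=
  {| dom := {x : M | ein x l};
     ein := fun x y => ein (proj1_sig x) (proj1_sig y) |}.

Definition is_L_level (M : structure) (xi l : M) : Prop :=
  sat M (upd (fun _ => xi) 1 l) (isL 0 1 2).

Definition codes (M : structure) (p : form) (c : M) : Prop :=
  sat1 M (quote p 0 1) c.

(** The universe of the metatheory: a well-founded model of ZF + V=L. *)
Definition constructible_universe (V : structure) : Prop :=
  well_founded (@ein V) /\ (forall p, ZF p -> valid V p) /\ valid V V_eq_L.

(** * Representations

    [R] is the Σ₁-formula R^α(x), with x = 0. *)

Definition representation (R : form) : Prop :=
  Sigma1 R /\ unary R /\
  Proves KP1 (all 0 (all 1 (R @ 0 ⩓ R @ 1 ⇒ 0 ≐ 1))).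

Definition provably_admissible (R : form) : Prop :=
  Proves KP1 (all 0 (R @ 0 ⇒ isAdmissible 0 1)).

Definition represents (V : structure) (R : form) (alpha : V) : Prop :=
  forall x : V, sat1 V R x <-> x = alpha.

Definition Exists_ (R : form) : form := ex 0 R.

Inductive KP1_Exists (R : form) : theory :=
| KP1E_KP1 p : KP1 p -> KP1_Exists R p
| KP1E_Exists : KP1_Exists R (Exists_ R).

(** ∀ξ∀z (R(ξ) ∧ z = L_ξ → p): the formula "p(L_α)", where [z] is the name
    that L_α has in [p] and [xi] is not free in [p]. *)
Definition at_L {A F} {S : Syntax A F} (R : form) (xi z : nat) (p : F) : F :=
  all (nm xi) (all (nm z)
    (emb (R @ xi ⩓ isL xi z (1 + Nat.max xi z)) ⇒ p)).

(** F^{L_α} *)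
Definition rel_L (R F : form) : form :=
  let z := fresh F in at_L R (1 + z) z (rel z F).

(** Σ₁^α-soundness, given the actual set [L_alpha]. *)
Definition Sigma1_sound (V : structure) (R : form) (L_alpha : V)
    (T : theory) : Prop :=
  forall p, Sigma1 p -> sentence p ->
    Proves T (rel_L R p) -> valid (set_structure V L_alpha) p.

(** The Π₁-formula [tau] is such that tau^{L_α} defines the set of codes of
    axioms of [T]. *)
Definition Pi1_defines (V : structure) (R tau : form) (T : theory) : Prop :=
  Pi1 tau /\ unary tau /\
  forall c : V, sat1 V (rel_L R tau) c <-> exists p, T p /\ codes V p c.

(** RFN_{Σ₁^α}(T), for T given by the definition tau^{L_α} of its axioms.
    The quantified Δ₀-formulas [p] are those with x = 0, and the code [c]
    of "∃x∈L_α p(x)" uses the names 1 and 2 for α and L_α; Σ₁-truth in L_α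
    is satisfaction in the set L_α. *)
Definition RFN (R tau : form) : form :=
  (∀' p, isDelta0 p ⩓ isUnary p ⇒
     (∃' c, c ≗ at_L R 1 2 (exIn (nm 0) (nm 2) (tvar p)) ⩓
        Pr (fun e => emb (rel_L R tau @ e)) c) ⇒
     ∀' xi, ∀' z, emb (R @ xi) ⩓ isL xi z ⇒
       ∃' c, c ≗ ex (nm 0) (tvar p) ⩓ models z c) 0.

(* Main.v *)
From Stdlib Require Import Arith Bool Lia List Classical ClassicalEpsilon
  FunctionalExtensionality PropExtensionality ProofIrrelevance.
From Stdlib Require Cantor.
Require Import Defs.
Import ListNotations.

(** Call a set [w ∈ L_α] a bound of [T n] if every Σ₁^α-sentence
    provable in [T n] has a witness in [w].  Inside a model of [T n], reflection
    says that each Σ₁^α-theorem of [T (S n)] is true in L_α; as L_α is admissible,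
    Σ₁-collection over the (codes of) theorems gives a set in L_α bounding all
    of them.  Hence [T n] proves the Σ₁^α-sentence "some [u ∈ L_α] satisfies
    [c]", with [c] a Δ₀-formula whose true instances are bounds of [T (S n)].
    So any bound of [T n] contains a bound of [T (S n)], and soundness of [T 0]
    starts an infinite ∈-descent.

    The axioms of [T (S n)] are Π₁ over L_α; in [c] the universal quantifier of
    their definition is restricted to the bound itself, which makes [c] Δ₀, and
    the bound is chosen to contain counterexamples for the finite sets of codes
    not consisting of axioms.  Truth of a Δ₀-formula, possibly with a
    nonstandard code, is expressed by a set of evidence: a satisfaction relation
    along a building sequence of the formula.  What a theory proves is
    determined semantically, through the completeness theorem. *)

(** * Satisfaction relativized to a class *)

(** The descent takes the place of Gödel's second theorem: no sentence is diagonalized, and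
    well-foundedness is used only for the ∈-relation of the universe V. A model of [T n] supplied by
    completeness may be ill-founded, with nonstandard formulas and proofs, and is only known to
    satisfy Σ₁- and Π₁-induction. Hence every induction inside a model concerns a property with a
    Δ₀-matrix, certified by [D0], and satisfaction of nonstandard formulas is compared along
    building sequences instead of by recursion on formulas. Provability is tested inside a
    transitive set [h] closed under adjunction, from a set [a] of axioms that is an element of [h].
    Such a test is Δ₀, persists upwards to the universe, where reflection speaks, and succeeds for
    actual proofs, which lie in any such [h]. Restricting the quantifier in the definition of the
    axioms to the bound weakens the condition of being an axiom. In V this is harmless: an actual
    axiom has no counterexample in L_α, hence none in a bound. *)

Lemma upd_same {X} (rho : nat -> X) x a : upd rho x a x = a.
Proof. unfold upd. now rewrite Nat.eqb_refl. Qed.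

Lemma upd_other {X} (rho : nat -> X) x a y : y <> x -> upd rho x a y = rho y.
Proof. unfold upd. intros H. now apply Nat.eqb_neq in H as ->. Qed.

(** Keeping the carrier [M] fixed and varying only the range of the quantifiers gives one notion for
    truth in [M], truth in a set of [M] and truth of relativized formulas. *)
Fixpoint holds {M : structure} (D : M -> Prop) (rho : nat -> M) (p : form)
    : Prop :=
  match p with
  | Mem x y => ein (rho x) (rho y)
  | Eql x y => rho x = rho y
  | Not p => ~ holds D rho p
  | Imp p q => holds D rho p -> holds D rho q
  | All x p => forall a, D a -> holds D (upd rho x a) p
  end.

Definition Univ {M : structure} : M -> Prop := fun _ => True.

Lemma sat_holds (M : structure) rho p : sat M rho p <-> holds Univ rho p.
Proof.
  revert rho. induction p; intros rho; simpl; try tauto.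
  - now rewrite IHp.
  - now rewrite IHp1, IHp2.
  - unfold Univ. split; intros H a; [intros _|]; apply IHp; auto.
Qed.

Lemma holds_ext {M : structure} (D : M -> Prop) p rho sigma :
  (forall v, free v p = true -> rho v = sigma v) ->
  (holds D rho p <-> holds D sigma p).
Proof.
  revert rho sigma. induction p; intros rho sigma H; simpl in *.
  - rewrite (H x), (H y); rewrite ?Nat.eqb_refl, ?orb_true_r; tauto.
  - rewrite (H x), (H y); rewrite ?Nat.eqb_refl, ?orb_true_r; tauto.
  - now rewrite (IHp rho sigma).
  - rewrite (IHp1 rho sigma), (IHp2 rho sigma); try tauto;
      intros v Hv; apply H; rewrite Hv, ?orb_true_r; easy.
  - assert (E : forall a, holds D (upd rho x a) p <-> holds D (upd sigma x a) p).
    { intros a. apply IHp. intros v Hv. unfold upd.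
      destruct (v =? x) eqn:E; auto. apply H. rewrite Hv, Nat.eqb_sym, E. easy. }
    split; intros K a Ha; apply E; auto.
Qed.

Lemma free_occurs v p : free v p = true -> occurs v p = true.
Proof.
  induction p; simpl; auto.
  - rewrite !orb_true_iff. tauto.
  - rewrite andb_true_iff, orb_true_iff. tauto.
Qed.

Lemma occurs_fresh p v : fresh p <= v -> occurs v p = false.
Proof.
  induction p; cbn -[Nat.max]; intros H; auto.
  1,2: apply orb_false_iff; rewrite !Nat.eqb_neq; lia.
  - rewrite IHp1, IHp2; auto; lia.
  - rewrite IHp by lia. rewrite orb_false_r, Nat.eqb_neq. lia.
Qed.

Lemma free_fresh p v : free v p = true -> v < fresh p.
Proof.
  intros H. destruct (le_lt_dec (fresh p) v); auto.
  apply free_occurs in H. rewrite occurs_fresh in H; easy.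
Qed.

(** * Renaming of variables *)

Definition inj_on (f : nat -> nat) (p : form) : Prop :=
  forall x y, occurs x p = true -> occurs y p = true -> f x = f y -> x = y.

(** [rename] changes bound variables as well, so injectivity on all occurring variables, not only on
    the free ones, is what rules out capture. *)
Lemma holds_rename {M : structure} (D : M -> Prop) f p rho :
  inj_on f p ->
  (holds D rho (rename f p) <-> holds D (fun v => rho (f v)) p).
Proof.
  revert rho. unfold inj_on. induction p; intros rho H; simpl in *; try tauto.
  - now rewrite IHp.
  - rewrite IHp1, IHp2; try tauto; intros a b Ha Hb; apply H;
      rewrite ?Ha, ?Hb, ?orb_true_r; easy.
  - assert (E : forall a, holds D (upd rho (f x) a) (rename f p) <->
       holds D (upd (fun v => rho (f v)) x a) p).
    { intros a. rewrite IHp.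
      - apply holds_ext. intros v Hv. apply free_occurs in Hv. unfold upd.
        destruct (f v =? f x) eqn:E.
        + apply Nat.eqb_eq, H in E; rewrite ?Hv, ?orb_true_r, ?Nat.eqb_refl; auto.
          subst. now rewrite Nat.eqb_refl.
        + destruct (v =? x) eqn:E'; auto. apply Nat.eqb_eq in E'. subst.
          now rewrite Nat.eqb_refl in E.
      - intros a' b Ha Hb. apply H; rewrite ?Ha, ?Hb, ?orb_true_r; easy. }
    split; intros K a Ha; apply E; auto.
Qed.

Lemma inj_on_inj f p : (forall x y, f x = f y -> x = y) -> inj_on f p.
Proof. unfold inj_on; auto. Qed.

Lemma swap_inj a b x y : swap a b x = swap a b y -> x = y.
Proof.
  unfold swap. destruct (x =? a) eqn:E1, (y =? a) eqn:E2;
    try destruct (x =? b) eqn:E3; try destruct (y =? b) eqn:E4;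
    rewrite ?Nat.eqb_eq, ?Nat.eqb_neq in *; lia.
Qed.

Lemma holds_at {M : structure} (D : M -> Prop) p y rho :
  unary p -> (holds D rho (p @ y) <-> holds D (fun _ => rho y) p).
Proof.
  intros H. rewrite holds_rename by (apply inj_on_inj; intros; eapply swap_inj; eauto).
  apply holds_ext. intros v Hv. apply H in Hv. subst. reflexivity.
Qed.

Lemma holds_unary {M : structure} (D : M -> Prop) p rho x :
  unary p -> rho 0 = x -> (holds D rho p <-> holds D (fun _ => x) p).
Proof. intros H <-. apply holds_ext. intros v Hv. now apply H in Hv as ->. Qed.

Lemma occurs_rename_false f p v :
  (forall x, f x <> v) -> occurs v (rename f p) = false.
Proof.
  intros H. induction p; simpl; auto; rewrite ?IHp, ?IHp1, ?IHp2, ?orb_false_iff, ?Nat.eqb_neq; auto.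
Qed.

Lemma free_rename f p v : inj_on f p ->
  free v (rename f p) = true -> exists x, v = f x /\ free x p = true.
Proof.
  unfold inj_on. induction p; simpl; intros Hi H.
  1,2: apply orb_true_iff in H as [H|H]; apply Nat.eqb_eq in H; subst;
    eexists; (split; [reflexivity|]); rewrite Nat.eqb_refl, ?orb_true_r; easy.
  - auto.
  - apply orb_true_iff in H as [H|H].
    + destruct IHp1 as (x & -> & Hx); auto.
      { intros a b Ha Hb. apply Hi; rewrite ?Ha, ?Hb, ?orb_true_r; easy. }
      exists x. now rewrite Hx.
    + destruct IHp2 as (x & -> & Hx); auto.
      { intros a b Ha Hb. apply Hi; rewrite ?Ha, ?Hb, ?orb_true_r; easy. }
      exists x. now rewrite Hx, orb_true_r.
  - apply andb_true_iff in H as [H1 H2].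
    destruct IHp as (y & -> & Hx); auto.
    { intros a b Ha Hb. apply Hi; rewrite ?Ha, ?Hb, ?orb_true_r; easy. }
    exists y. split; auto. rewrite Hx, andb_true_r. apply negb_true_iff.
    apply negb_true_iff in H1. apply Nat.eqb_neq. intros ->.
    now rewrite Nat.eqb_refl in H1.
Qed.

Lemma Delta0_rename f p : (forall x y, f x = f y -> x = y) ->
  Delta0 p -> Delta0 (rename f p).
Proof.
  intros Hf. induction 1; simpl; constructor; auto.
Qed.

Lemma holds_set_structure (M : structure) (l : M) rho p :
  sat (set_structure M l) rho p <->
  holds (fun x => ein x l) (fun v => proj1_sig (rho v)) p.
Proof.
  revert rho. induction p; intros rho; simpl; try tauto.
  - split; [now intros ->|]. intros E.
    destruct (rho x) as [a Ha], (rho y) as [b Hb]. simpl in E. subst.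
    f_equal. apply proof_irrelevance.
  - now rewrite IHp.
  - now rewrite IHp1, IHp2.
  - assert (E : forall a : set_structure M l,
      (fun v => proj1_sig (upd rho x a v)) =
      upd (fun v => proj1_sig (rho v)) x (proj1_sig a)).
    { intros a. apply functional_extensionality. intros v. unfold upd.
      now destruct (v =? x). }
    split.
    + intros H a Ha. specialize (H (exist _ a Ha)). apply IHp in H.
      now rewrite E in H.
    + intros H a. apply IHp. rewrite E. apply H. apply (proj2_sig a).
Qed.

(** * Absoluteness of Δ₀-formulas and relativization *)

Definition transitive_class {M : structure} (D : M -> Prop) : Prop :=
  forall x y : M, D x -> ein y x -> D y.

Lemma Delta0_absolute {M : structure} (D : M -> Prop) p :
  transitive_class D -> Delta0 p -> forall rho,
  (forall v, free v p = true -> D (rho v)) ->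
  (holds D rho p <-> holds Univ rho p).
Proof.
  intros HD. induction 1; intros rho Hr; simpl in *; try tauto.
  - rewrite IHDelta0; auto. tauto.
  - rewrite IHDelta0_1, IHDelta0_2; try tauto;
      intros v Hv; apply Hr; rewrite Hv, ?orb_true_r; auto.
  - assert (Dy : D (rho y)).
    { apply Hr. replace (x =? y) with false. { now rewrite Nat.eqb_refl, orb_true_r. }
      symmetry. now apply Nat.eqb_neq. }
    assert (E : forall a, ein a (rho y) ->
      (holds D (upd rho x a) p <-> holds Univ (upd rho x a) p)).
    { intros a Ha. apply IHDelta0. intros v Hv. unfold upd.
      destruct (v =? x) eqn:Ev. { now apply HD with (rho y). }
      apply Hr. rewrite Nat.eqb_sym, Ev, Hv, orb_true_r. easy. }
    split; intros K a Ha.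
    + rewrite upd_same, upd_other by auto. intros Hay. apply E; auto.
      specialize (K a (HD _ _ Dy Hay)). rewrite upd_same, upd_other in K; auto.
    + rewrite upd_same, upd_other by auto. intros Hay. apply E; auto.
      specialize (K a I). rewrite upd_same, upd_other in K; auto.
Qed.

Lemma rel_Delta0 z p : occurs z p = false -> Delta0 (rel z p).
Proof.
  induction p; intros H; simpl in *; try (constructor; auto; fail).
  - apply orb_false_iff in H as [H1 H2]. constructor; auto.
  - apply orb_false_iff in H as [H1 H2]. apply Nat.eqb_neq in H1.
    assert (G : Delta0 (All x (Imp (Mem x z) (rel z p)))).
    { apply (D0_ball x z); auto. }
    destruct p; auto. destruct p1; auto.
    destruct (_ && _) eqn:E; auto.
    apply andb_true_iff in E as [E1 E2]. apply Nat.eqb_eq in E1.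
    apply negb_true_iff, Nat.eqb_neq in E2. subst x0.
    apply (D0_ball x y); auto. specialize (IHp H2). simpl in IHp.
    now inversion IHp.
Qed.

(** Transitivity serves the quantifiers that [rel] leaves alone: their bound is an element of the
    value of [z], so everything they range over lies in that value too. *)
Lemma holds_rel {M : structure} (z : nat) (p : form) (rho : nat -> M) :
  occurs z p = false ->
  transitive_class (fun x => ein x (rho z)) ->
  (forall v, free v p = true -> ein (rho v) (rho z)) ->
  (holds Univ rho (rel z p) <-> holds (fun x => ein x (rho z)) rho p).
Proof.
  revert rho. induction p; intros rho Hz HD Hr; simpl in *; try tauto.
  - rewrite IHp; auto. tauto.
  - apply orb_false_iff in Hz as [H1 H2].
    rewrite IHp1, IHp2; auto; try tauto;
      intros v Hv; apply Hr; rewrite Hv, ?orb_true_r; auto.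
  - apply orb_false_iff in Hz as [H1 H2]. apply Nat.eqb_neq in H1.
    assert (IH : forall a, ein a (rho z) ->
       (holds Univ (upd rho x a) (rel z p) <-> holds (fun x => ein x (rho z)) (upd rho x a) p)).
    { intros a Ha. specialize (IHp (upd rho x a)).
      rewrite upd_other in IHp by auto. apply IHp; auto.
      intros v Hv. unfold upd. destruct (v =? x) eqn:E; auto.
      apply Hr. rewrite Nat.eqb_sym, E, Hv. easy. }
    assert (G : holds Univ rho (All x (Imp (Mem x z) (rel z p))) <->
       (forall a, ein a (rho z) -> holds (fun x => ein x (rho z)) (upd rho x a) p)).
    { simpl. unfold Univ. split; intros K a Ha.
      - apply IH; auto. apply K; auto. rewrite upd_same, upd_other; auto.
      - intros Ka. rewrite upd_same, upd_other in Ka by auto. apply IH; auto. }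
    destruct p; auto. destruct p1; auto.
    destruct (_ && _) eqn:E; auto.
    apply andb_true_iff in E as [E1 E2]. apply Nat.eqb_eq in E1.
    apply negb_true_iff, Nat.eqb_neq in E2. subst x0. clear G.
    assert (Hy : ein (rho y) (rho z)).
    { apply Hr. simpl. rewrite Nat.eqb_refl, orb_true_r.
      rewrite andb_true_r. apply negb_true_iff, Nat.eqb_neq. auto. }
    simpl in *. unfold Univ in *.
    split; intros K a Ha.
    + intros Hay. apply IH; auto.
    + intros Hay.
      assert (Ha' : ein a (rho z)).
      { rewrite upd_same, upd_other in Hay by auto. eapply HD; eauto. }
      now apply (IH a Ha'); auto.
Qed.

(** * Soundness and completeness of the calculus *)

Lemma Proves_sound (T : theory) (M : structure) :
  (forall p, T p -> valid M p) -> forall p, Proves T p -> valid M p.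
Proof.
  intros HT p H. induction H; intros rho; simpl; try tauto; auto.
  - now apply HT.
  - intros K. specialize (K (rho x)).
    rewrite sat_holds in *. eapply holds_ext; [|apply K].
    intros v _. unfold upd. destruct (v =? x) eqn:E; auto. now apply Nat.eqb_eq in E as ->.
  - intros K a. rewrite sat_holds in *. eapply holds_ext; [|apply K].
    intros v Hv. apply upd_other. intros ->. apply free_occurs in Hv. congruence.
  - intros K. destruct (Nat.eq_dec y x) as [->|N].
    + apply (K (rho x)). now rewrite !upd_same.
    + apply (K (rho y)). now rewrite upd_same, upd_other.
  - congruence.
  - intros <-. auto.
  - intros <-. auto.
  - apply IHProves1, IHProves2.
Qed.

Section Completeness.
Context (T : theory).

(** Moving the head hypothesis into the formula makes the deduction theorem a conversion:
    [Der (a :: G) p] unfolds to the same thing as [Der G (Imp a p)]. Many proofs below use this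
    through [change]. *)
Fixpoint chain (G : list form) (p : form) : form :=
  match G with [] => p | a :: G => chain G (Imp a p) end.

(** Derivability from the hypotheses [G], on whose variables the rule of
    generalization must not be used. *)
Definition Der (G : list form) (p : form) : Prop := Proves T (chain G p).

Lemma Der_K G p : Proves T p -> Der G p.
Proof.
  unfold Der. revert p. induction G; simpl; intros p H; auto.
  apply IHG. eapply Pv_mp; [apply Pv_k|exact H].
Qed.

Lemma Der_mp G p q : Der G (Imp p q) -> Der G p -> Der G q.
Proof.
  revert p q. induction G as [|a G IH]; simpl; intros p q H1 H2.
  - eapply Pv_mp; eauto.
  - apply (IH (Imp a p)); auto. apply (IH (Imp a (Imp p q))); auto.
    apply Der_K, Pv_s.
Qed.

Lemma Der_id G p : Der G (Imp p p).
Proof.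
  apply Der_K. apply (Pv_mp T (Imp p (Imp p p))); [|apply Pv_k].
  apply (Pv_mp T (Imp p (Imp (Imp p p) p))); [|apply Pv_k]. apply Pv_s.
Qed.

Lemma Der_hyp G p : In p G -> Der G p.
Proof.
  induction G as [|a G IH]; simpl; [easy|]. intros [->|H].
  - apply (Der_id G).
  - apply (Der_mp G p); [apply Der_K, Pv_k|auto].
Qed.

Lemma Der_incl G H p : Der G p -> incl G H -> Der H p.
Proof.
  revert p. induction G as [|a G IH]; intros p K I.
  - now apply Der_K.
  - apply (Der_mp H a); [apply (IH (Imp a p))|apply Der_hyp]; auto.
    + intros x Hx; apply I; now right.
    + apply I; now left.
Qed.

Lemma Der_explode G p q : Der G p -> Der G (Not p) -> Der G q.
Proof.
  intros H1 H2. apply (Der_mp G p); auto.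
  apply (Der_mp G (Imp (Not q) (Not p))); [apply Der_K, Pv_contra|].
  apply (Der_mp G (Not p)); auto. apply Der_K, Pv_k.
Qed.

Lemma Der_contra G p q : Der (Not p :: G) q -> Der (Not p :: G) (Not q) -> Der G p.
Proof.
  intros H1 H2.
  assert (H : Der G (Imp (Not p) (Not (Imp p p)))).
  { apply (Der_explode (Not p :: G) q); auto. }
  apply (Der_mp G (Imp p p)); [|apply Der_id].
  apply (Der_mp G (Imp (Not p) (Not (Imp p p)))); auto.
  apply Der_K, Pv_contra.
Qed.

Lemma Der_neg G p q : Der (p :: G) q -> Der (p :: G) (Not q) -> Der G (Not p).
Proof.
  intros H1 H2.
  assert (H : Der (Not (Not p) :: G) p).
  { apply (Der_contra _ p (Not p)); apply Der_hyp; simpl; auto. }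
  assert (I : incl G (Not (Not p) :: G)) by (intros x; simpl; auto).
  apply (Der_contra _ _ q); (eapply Der_mp; [eapply Der_incl|]; eauto).
Qed.

Lemma Der_gen G x p : (forall q, In q G -> occurs x q = false) ->
  Der G p -> Der G (All x p).
Proof.
  revert p. induction G as [|a G IH]; intros p Hx H.
  - now apply Pv_gen.
  - apply IH in H; [|intros; apply Hx; now right]. clear IH.
    apply (Der_mp _ (All x a)).
    + apply (Der_mp _ (All x (Imp a p))); [apply Der_K, Pv_dist|].
      apply (Der_incl G); auto. intros y; simpl; auto.
    + apply (Der_mp _ a); [|apply Der_hyp; now left].
      apply Der_K, Pv_vac, Hx; now left.
Qed.

(** Reflexivity is not among the axioms. Some z equals x by [lax_exists], and [lax_eq] applied to z
    = x twice gives x = x. *)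
Lemma Der_refl G x : Der G (Eql x x).
Proof.
  apply Der_K. change (Der [] (Eql x x)).
  apply (Der_contra _ _ (All (S x) (Not (Eql (S x) x)))).
  - apply Der_gen.
    + intros q [<-|[]]. cbn -[Nat.eqb]. rewrite orb_diag. apply Nat.eqb_neq; lia.
    + apply (Der_neg _ _ (Eql x x)); [|apply Der_hyp; simpl; auto].
      apply (Der_mp _ (Eql (S x) x)); [|apply Der_hyp; simpl; auto].
      apply (Der_mp _ (Eql (S x) x)); [|apply Der_hyp; simpl; auto].
      apply Der_K, Pv_eq.
  - apply Der_K. apply (Pv_exists T).
Qed.

Lemma Der_sym G x y : Der G (Eql x y) -> Der G (Eql y x).
Proof.
  intros H. apply (Der_mp _ (Eql x x)); [|apply Der_refl].
  apply (Der_mp _ (Eql x y)); auto. apply Der_K, Pv_eq.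
Qed.

Definition subst1 (x y v : nat) : nat := if v =? x then y else v.

Lemma subst1_occurs x y p : x <> y -> occurs x (rename (subst1 x y) p) = false.
Proof.
  intros N. apply occurs_rename_false. intros v. unfold subst1.
  destruct (v =? x) eqn:E; auto. now apply Nat.eqb_neq.
Qed.

Lemma subst1_inj x y p : occurs y p = false -> inj_on (subst1 x y) p.
Proof.
  intros H a b Ha Hb. unfold subst1.
  destruct (a =? x) eqn:E1, (b =? x) eqn:E2;
    rewrite ?Nat.eqb_eq, ?Nat.eqb_neq in *; congruence.
Qed.

(** A quantifier is eliminated by substituting [u] for [v] under an equation
    that [∃v] discharges. *)
Lemma Der_elim v u p q : v <> u -> occurs v q = false ->
  Der [Eql v u] (Imp p q) -> Der [All v p] q.
Proof.
  intros N Hq H.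
  apply (Der_contra _ _ (All v (Not (Eql v u)))).
  2: { apply Der_K. apply (Pv_exists T). }
  assert (A : Proves T (Imp p (Imp (Not q) (Not (Eql v u))))).
  { change (Der [Not q; p] (Not (Eql v u))).
    apply (Der_neg _ _ q); [|apply Der_hyp; simpl; auto].
    apply (Der_mp _ p); [|apply Der_hyp; simpl; auto].
    eapply Der_incl; [exact H|]. intros r [<-|[]]; simpl; auto. }
  apply Pv_gen with (x := v) in A.
  apply (Der_mp _ (All v (Not q))).
  - apply (Der_mp _ (All v (Imp (Not q) (Not (Eql v u))))); [apply Der_K, Pv_dist|].
    apply (Der_mp _ (All v p)); [|apply Der_hyp; simpl; auto].
    apply Der_K. eapply Pv_mp; [apply Pv_dist|exact A].
  - apply (Der_mp _ (Not q)); [|apply Der_hyp; simpl; auto].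
    apply Der_K, Pv_vac. auto.
Qed.

(** Both directions are proved together because negation and implication exchange them. At a
    quantifier binding [x] the renaming turns the bound variable into [y]; that case is a change of
    bound variable and drops the equation from the hypotheses. *)
Lemma Der_subst x y p : x <> y -> occurs y p = false ->
  Der [Eql x y] (Imp p (rename (subst1 x y) p)) /\
  Der [Eql x y] (Imp (rename (subst1 x y) p) p).
Proof.
  intros N.
  assert (V : forall v, Der [Eql x y] (Eql v (subst1 x y v)) /\
                        Der [Eql x y] (Eql (subst1 x y v) v)).
  { intros v. unfold subst1. destruct (v =? x) eqn:E.
    - apply Nat.eqb_eq in E as ->. split; [|apply Der_sym]; apply Der_hyp; simpl; auto.
    - split; apply Der_refl. }
  assert (W : forall p q r G, (Der G (Imp p q)) -> Der G (Imp q r) -> Der G (Imp p r)).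
  { intros a b c G H1 H2. change (Der (a :: G) c).
    apply (Der_mp _ b); [|apply (Der_mp _ a); [|apply Der_hyp; simpl; auto]];
      (eapply Der_incl; [eassumption|intros w; simpl; auto]). }
  assert (A : forall a b a' b', Der [Eql x y] (Eql a a') -> Der [Eql x y] (Eql b b') ->
     Der [Eql x y] (Imp (Mem a b) (Mem a' b')) /\ Der [Eql x y] (Imp (Eql a b) (Eql a' b'))).
  { intros a b a' b' Ha Hb. split.
    - apply (W _ (Mem a' b)).
      + apply (Der_mp _ (Eql a a')); auto. apply Der_K, Pv_meml.
      + apply (Der_mp _ (Eql b b')); auto. apply Der_K, Pv_memr.
    - apply (W _ (Eql a' b)).
      + apply (Der_mp _ (Eql a a')); auto. apply Der_K, Pv_eq.
      + change (Der [Eql a' b; Eql x y] (Eql a' b')).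
        apply (Der_mp _ (Eql b b')); [|eapply Der_incl; [exact Hb|intros w; simpl; auto]].
        apply (Der_mp _ (Eql b a')); [apply Der_K, Pv_eq|].
        apply Der_sym, Der_hyp; simpl; auto. }
  induction p; simpl; intros H.
  - split; apply A; apply V.
  - split; apply A; apply V.
  - destruct (IHp H) as [H1 H2]. split.
    + change (Der [Not p; Eql x y] (Not (rename (subst1 x y) p))).
      apply (Der_neg _ _ p); [|apply Der_hyp; simpl; auto].
      eapply Der_mp; [eapply Der_incl; [exact H2|]|apply Der_hyp; simpl; auto].
      intros w; simpl; tauto.
    + change (Der [Not (rename (subst1 x y) p); Eql x y] (Not p)).
      apply (Der_neg _ _ (rename (subst1 x y) p)); [|apply Der_hyp; simpl; auto].
      eapply Der_mp; [eapply Der_incl; [exact H1|]|apply Der_hyp; simpl; auto].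
      intros w; simpl; tauto.
  - apply orb_false_iff in H as [K1 K2].
    destruct (IHp1 K1) as [H1 H2], (IHp2 K2) as [H3 H4]. split.
    + change (Der [rename (subst1 x y) p1; Imp p1 p2; Eql x y] (rename (subst1 x y) p2)).
      apply (Der_mp _ p2); [eapply Der_incl; [exact H3|intros w; simpl; tauto]|].
      apply (Der_mp _ p1); [apply Der_hyp; simpl; auto|].
      apply (Der_mp _ (rename (subst1 x y) p1)); [|apply Der_hyp; simpl; auto].
      eapply Der_incl; [exact H2|intros w; simpl; tauto].
    + change (Der [p1; Imp (rename (subst1 x y) p1) (rename (subst1 x y) p2); Eql x y] p2).
      apply (Der_mp _ (rename (subst1 x y) p2)); [eapply Der_incl; [exact H4|intros w; simpl; tauto]|].
      apply (Der_mp _ (rename (subst1 x y) p1)); [apply Der_hyp; simpl; auto|].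
      apply (Der_mp _ p1); [|apply Der_hyp; simpl; auto].
      eapply Der_incl; [exact H1|intros w; simpl; tauto].
  - apply orb_false_iff in H as [K1 K2]. apply Nat.eqb_neq in K1.
    destruct (IHp K2) as [H1 H2]. unfold subst1 at 1 3.
    destruct (x0 =? x) eqn:E.
    + apply Nat.eqb_eq in E as ->. split.
      * apply (Der_incl []); [|easy]. change (Der [All x p] (All y (rename (subst1 x y) p))).
        apply Der_gen.
        -- intros q [<-|[]]. simpl. rewrite K2, orb_false_r. now apply Nat.eqb_neq.
        -- apply (Der_elim x y); auto. now apply subst1_occurs.
      * apply (Der_incl []); [|easy]. change (Der [All y (rename (subst1 x y) p)] (All x p)).
        apply Der_gen.
        -- intros q [<-|[]]. simpl. rewrite subst1_occurs, orb_false_r by auto.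
           apply Nat.eqb_neq; auto.
        -- apply (Der_elim y x); auto.
           apply (Der_mp _ (Eql x y)); [apply Der_K; exact H2|].
           apply Der_sym, Der_hyp; simpl; auto.
    + apply Nat.eqb_neq in E.
      assert (O : forall q, In q [Eql x y] -> occurs x0 q = false).
      { intros q [<-|[]]. simpl. apply orb_false_iff. rewrite !Nat.eqb_neq. auto. }
      split.
      * apply (Der_mp _ (All x0 (Imp p (rename (subst1 x y) p)))); [apply Der_K, Pv_dist|].
        now apply Der_gen.
      * apply (Der_mp _ (All x0 (Imp (rename (subst1 x y) p) p))); [apply Der_K, Pv_dist|].
        now apply Der_gen.
Qed.

Lemma Der_all_subst G x y p : x <> y -> occurs y p = false ->
  Der G (All x p) -> Der G (rename (subst1 x y) p).
Proof.
  intros N H K. apply (Der_mp _ (All x p)); auto. apply Der_K.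
  change (Der [All x p] (rename (subst1 x y) p)).
  apply (Der_elim x y); auto. { now apply subst1_occurs. }
  now apply Der_subst.
Qed.

Lemma Der_subst_all G x y p : x <> y -> occurs y p = false ->
  (forall q, In q G -> occurs y q = false) ->
  Der G (rename (subst1 x y) p) -> Der G (All x p).
Proof.
  intros N H HG K. apply (Der_mp _ (All y (rename (subst1 x y) p))).
  2: now apply Der_gen.
  apply Der_K. change (Der [All y (rename (subst1 x y) p)] (All x p)).
  apply Der_gen.
  - intros q [<-|[]]. simpl. rewrite subst1_occurs, orb_false_r by auto.
    apply Nat.eqb_neq; auto.
  - apply (Der_elim y x); auto.
    apply (Der_mp _ (Eql x y)); [apply Der_K; now apply Der_subst|].
    apply Der_sym, Der_hyp; simpl; auto.
Qed.

(** ** The Henkin construction *)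

Definition bot : form := Not (Imp (Eql 0 0) (Eql 0 0)).
Definition Con (G : list form) : Prop := ~ Der G bot.

Lemma not_Con G p : Der G p -> Der G (Not p) -> ~ Con G.
Proof. intros H1 H2 C. apply C, (Der_explode _ p); auto. Qed.

Lemma Con_neg G p : Con G -> ~ Con (p :: G) -> Con (Not p :: G).
Proof.
  intros C N K. apply NNPP in N. apply C. apply (Der_contra _ _ (Imp (Eql 0 0) (Eql 0 0))).
  - apply Der_id.
  - apply (Der_mp _ (Not p)).
    + apply (Der_incl G); [exact K|]. intros w; simpl; auto.
    + apply (Der_incl G); [|intros w; simpl; auto].
      apply (Der_neg _ _ (Imp (Eql 0 0) (Eql 0 0))); [apply Der_id|exact N].
Qed.

Fixpoint fresh_list (G : list form) : nat :=
  match G with [] => 0 | p :: G => Nat.max (fresh p) (fresh_list G) end.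

Lemma fresh_list_le p G : In p G -> fresh p <= fresh_list G.
Proof. induction G; simpl; [easy|]. intros [->|H]; [lia|]. specialize (IHG H). lia. Qed.

(** Used only to enumerate the formulas for the Henkin construction; the residue modulo 5 records
    the constructor. *)
Fixpoint code (p : form) : nat :=
  match p with
  | Mem x y => 5 * Cantor.to_nat (x, y)
  | Eql x y => 5 * Cantor.to_nat (x, y) + 1
  | Not p => 5 * code p + 2
  | Imp p q => 5 * Cantor.to_nat (code p, code q) + 3
  | All x p => 5 * Cantor.to_nat (x, code p) + 4
  end.

Lemma code_inj p q : code p = code q -> p = q.
Proof.
  revert q. induction p; intros [] H; cbn -[Cantor.to_nat Nat.mul] in H; try (exfalso; lia).
  1,2,4,5: match type of H with context [Cantor.to_nat ?a] =>
    match type of H with context [_ = _ * Cantor.to_nat ?b + _] =>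
      assert (E : Cantor.to_nat a = Cantor.to_nat b) by lia
    | context [_ = _ * Cantor.to_nat ?b] =>
      assert (E : Cantor.to_nat a = Cantor.to_nat b) by lia end end;
    apply (f_equal Cantor.of_nat) in E; rewrite !Cantor.cancel_of_to in E;
    injection E; intros; subst; f_equal; auto.
  f_equal. apply IHp. lia.
Qed.

(** Off the range of [code] the value is arbitrary, which is harmless: a stage of the construction
    may treat any formula. *)
Definition decode (n : nat) : form := epsilon (inhabits bot) (fun p => code p = n).

Lemma decode_code p : decode (code p) = p.
Proof.
  apply code_inj. unfold decode. apply (epsilon_spec (inhabits bot)). now exists p.
Qed.

Definition henkin (q : form) (n : nat) : list form :=
  match q with
  | All x r => [Not (rename (subst1 x n) r)]
  | _ => []
  end.

Definition extend (G : list form) (q : form) : list form :=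
  if excluded_middle_informative (Con (q :: G)) then q :: G
  else henkin q (Nat.max (fresh q) (fresh_list G)) ++ Not q :: G.

Lemma extend_Con G q : Con G -> Con (extend G q).
Proof.
  intros C. unfold extend. destruct excluded_middle_informative as [H|H]; auto.
  pose proof (Con_neg _ _ C H) as C'. destruct q; auto.
  set (n := Nat.max (fresh (All x q)) (fresh_list G)).
  assert (Hn : fresh (All x q) <= n /\ fresh_list G <= n) by lia. clearbody n.
  destruct Hn as [Hn1 Hn2]. cbn -[Nat.max] in Hn1.
  simpl. intros K.
  assert (D : Der (Not (All x q) :: G) (rename (subst1 x n) q)).
  { eapply Der_contra; [apply Der_id|exact K]. }
  apply Der_subst_all in D; [|lia|apply occurs_fresh; lia|].
  - revert C'. eapply not_Con; [exact D|apply Der_hyp; simpl; auto].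
  - intros p [<-|Hp]; apply occurs_fresh; [cbn -[Nat.max]; lia|].
    apply fresh_list_le in Hp. lia.
Qed.

Section Model.
Context (G0 : list form) (HG0 : Con G0).

Fixpoint stage (n : nat) : list form :=
  match n with 0 => G0 | S n => extend (stage n) (decode n) end.

Definition max_con (q : form) : Prop := exists n, In q (stage n).

Lemma stage_Con n : Con (stage n).
Proof. induction n; simpl; auto using extend_Con. Qed.

Lemma stage_incl n m : n <= m -> incl (stage n) (stage m).
Proof.
  induction 1 as [|m H IH]; [easy|]. intros q Hq. apply IH in Hq. simpl. unfold extend.
  destruct excluded_middle_informative; simpl; auto.
  apply in_or_app. right. now right.
Qed.

Lemma stage_list G : (forall p, In p G -> max_con p) -> exists n, incl G (stage n).
Proof.
  induction G as [|p G IH]; intros H. { exists 0. intros q []. }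
  destruct IH as [n Hn]. { intros; apply H; now right. }
  destruct (H p) as [m Hm]; [now left|].
  exists (Nat.max n m). intros q [<-|Hq].
  - apply (stage_incl m); auto; lia.
  - apply (stage_incl n); auto; lia.
Qed.

Lemma max_con_cases q : max_con q \/
  (exists n, fresh q <= n /\ In (Not q) (stage (S (code q))) /\
     incl (henkin q n) (stage (S (code q)))).
Proof.
  set (k := code q).
  assert (E : stage (S k) = extend (stage k) q).
  { simpl. unfold k. now rewrite decode_code. }
  unfold extend in E. destruct excluded_middle_informative.
  - left. exists (S k). rewrite E. now left.
  - right. eexists. split; [|rewrite E; split].
    2: apply in_or_app; right; now left.
    2: apply incl_appl, incl_refl. lia.
Qed.

Lemma max_con_Der G q : (forall p, In p G -> max_con p) -> Der G q -> max_con q.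
Proof.
  intros HG D. destruct (max_con_cases q) as [|(n & _ & Hn & _)]; auto. exfalso.
  apply stage_list in HG as [m Hm].
  set (l := Nat.max m (S (code q))).
  apply (stage_Con l). apply (Der_explode _ q).
  - eapply Der_incl; [exact D|]. intros p Hp. apply (stage_incl m); auto; lia.
  - apply Der_hyp. apply (stage_incl (S (code q))); auto; lia.
Qed.

Lemma max_con_neg q : max_con (Not q) <-> ~ max_con q.
Proof.
  split.
  - intros H1 H2. destruct (stage_list [q; Not q]) as [n Hn].
    { intros p [<-|[<-|[]]]; auto. }
    apply (stage_Con n), (Der_explode _ q); apply Der_hyp, Hn; simpl; auto.
  - intros H. destruct (max_con_cases q) as [|(n & _ & Hn & _)]; [easy|]. eexists; eauto.
Qed.

Lemma max_con_imp p q : max_con (Imp p q) <-> (max_con p -> max_con q).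
Proof.
  split.
  - intros H1 H2. apply (max_con_Der [p; Imp p q]).
    { intros r [<-|[<-|[]]]; auto. }
    apply (Der_mp _ p); apply Der_hyp; simpl; auto.
  - intros H. destruct (classic (max_con p)) as [K|K].
    + apply (max_con_Der [q]); [intros r [<-|[]]; auto|].
      apply (Der_mp _ q); [apply Der_K, Pv_k|apply Der_hyp; simpl; auto].
    + apply max_con_neg in K. apply (max_con_Der [Not p]); [intros r [<-|[]]; auto|].
      change (Der [p; Not p] q). apply (Der_explode _ p); apply Der_hyp; simpl; auto.
Qed.

Lemma max_con_all x p : max_con (All x p) <->
  (forall y, x <> y -> occurs y p = false -> max_con (rename (subst1 x y) p)).
Proof.
  split.
  - intros H y N O. apply (max_con_Der [All x p]); [intros r [<-|[]]; auto|].
    apply Der_all_subst; auto. apply Der_hyp; simpl; auto.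
  - intros H. destruct (max_con_cases (All x p)) as [|(n & Hn & _ & Hh)]; auto. exfalso.
    cbn -[Nat.max] in Hn.
    assert (K : max_con (Not (rename (subst1 x n) p))).
    { exists (S (code (All x p))). apply Hh. simpl; auto. }
    apply max_con_neg in K. apply K, H; [lia|apply occurs_fresh; lia].
Qed.

(** [sat] reads [Eql] as equality of Rocq, so variables that are equal in the completed theory must
    be identified; their classes are predicates, made equal by extensionality. *)
Definition cls (n m : nat) : Prop := max_con (Eql n m).

Lemma cls_eq n m : cls n = cls m <-> max_con (Eql n m).
Proof.
  split.
  - intros E. change (cls n m). rewrite E. apply (max_con_Der []); [easy|apply Der_refl].
  - intros H. apply functional_extensionality. intros k. apply propositional_extensionality.
    split; intros K.
    + apply (max_con_Der [Eql n m; Eql n k]); [intros r [<-|[<-|[]]]; auto|].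
      apply (Der_mp _ (Eql n k)); [|apply Der_hyp; simpl; auto].
      apply (Der_mp _ (Eql n m)); [|apply Der_hyp; simpl; auto]. apply Der_K, Pv_eq.
    + apply (max_con_Der [Eql n m; Eql m k]); [intros r [<-|[<-|[]]]; auto|].
      apply (Der_mp _ (Eql m k)); [|apply Der_hyp; simpl; auto].
      apply (Der_mp _ (Eql m n)); [|apply Der_sym, Der_hyp; simpl; auto]. apply Der_K, Pv_eq.
Qed.

Definition term_model : structure :=
  {| dom := {P : nat -> Prop | exists n, P = cls n};
     ein := fun P Q => exists m n, proj1_sig P = cls m /\ proj1_sig Q = cls n /\
                          max_con (Mem m n) |}.

Definition elt (n : nat) : term_model := exist _ (cls n) (ex_intro _ n eq_refl).

Lemma elt_eq n m : elt n = elt m <-> max_con (Eql n m).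
Proof.
  rewrite <- cls_eq. split.
  - intros E. apply (f_equal (@proj1_sig _ _)) in E. exact E.
  - intros E. unfold elt. apply eq_sig_hprop; auto. intros; apply proof_irrelevance.
Qed.

Lemma elt_surj (a : term_model) : exists n, a = elt n.
Proof.
  destruct a as [P [n ->]]. exists n. reflexivity.
Qed.

Lemma elt_in n m : @ein term_model (elt n) (elt m) <-> max_con (Mem n m).
Proof.
  split.
  - intros (a & b & Ha & Hb & K). simpl in *.
    rewrite cls_eq in Ha, Hb.
    apply (max_con_Der [Eql n a; Eql m b; Mem a b]); [intros r [<-|[<-|[<-|[]]]]; auto|].
    apply (Der_mp _ (Mem n b)).
    + apply (Der_mp _ (Eql b m)); [apply Der_K, Pv_memr|apply Der_sym, Der_hyp; simpl; auto].
    + apply (Der_mp _ (Mem a b)); [|apply Der_hyp; simpl; auto].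
      apply (Der_mp _ (Eql a n)); [apply Der_K, Pv_meml|apply Der_sym, Der_hyp; simpl; auto].
  - intros H. exists n, m. auto.
Qed.

(** The truth lemma passes from [All x p] to renamings of [p], which are not subterms, so its
    induction is on this measure. *)
Fixpoint size (p : form) : nat :=
  match p with
  | Mem _ _ | Eql _ _ => 0
  | Not p => S (size p)
  | Imp p q => S (size p + size q)
  | All _ p => S (size p)
  end.

Lemma size_rename f p : size (rename f p) = size p.
Proof. induction p; simpl; auto. Qed.

(** [max_con_all] concerns only variables that do not occur in the formula, so every element needs a
    name among these. The Henkin witness for the existence of a [z] equal to [y] is such a name: it
    exceeds [z], which is chosen at least [fresh p]. *)
Lemma elt_fresh p y : exists y', fresh p <= y' /\ elt y' = elt y.
Proof.
  set (z := Nat.max (S y) (fresh p)).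
  destruct (max_con_cases (All z (Not (Eql z y)))) as [H|(n & Hn & _ & Hh)].
  - exfalso. apply max_con_neg in H; auto.
    apply (max_con_Der []); [easy|]. apply Der_K. apply (Pv_exists T).
  - cbn -[Nat.max] in Hn. exists n. split; [lia|].
    assert (K : max_con (Not (Not (Eql n y)))).
    { eexists. apply Hh. left. unfold subst1. simpl. rewrite Nat.eqb_refl.
      destruct (y =? z) eqn:E; auto. apply Nat.eqb_eq in E. lia. }
    rewrite !max_con_neg in K. apply elt_eq. now apply NNPP.
Qed.

Lemma truth p : sat term_model elt p <-> max_con p.
Proof.
  remember (size p) as k eqn:E. revert p E.
  induction k as [k IH] using lt_wf_ind. intros p ->. destruct p; simpl in IH |- *.
  - apply elt_in.
  - apply elt_eq.
  - rewrite max_con_neg. rewrite (IH (size p)); auto. tauto.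
  - rewrite max_con_imp. rewrite (IH (size p1)), (IH (size p2)); auto; lia || tauto.
  - rewrite max_con_all.
    assert (A : forall y, x <> y -> occurs y p = false ->
      (max_con (rename (subst1 x y) p) <-> sat term_model (upd elt x (elt y)) p)).
    { intros y N O. rewrite <- (IH (size p)); auto; [|now rewrite size_rename].
      rewrite !sat_holds. rewrite holds_rename by now apply subst1_inj.
      apply holds_ext. intros v _. unfold subst1, upd. now destruct (v =? x). }
    split.
    + intros H y N O. apply A; auto.
    + intros H a. destruct (elt_surj a) as [y ->].
      destruct (elt_fresh (All x p) y) as (y' & Hy & <-).
      cbn -[Nat.max] in Hy.
      apply A; [lia|apply occurs_fresh; lia|].
      apply H; [lia|apply occurs_fresh; lia].
Qed.

Fixpoint close (n : nat) (p : form) : form :=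
  match n with 0 => p | S n => All n (close n p) end.

Lemma close_Proves n p : Proves T p -> Proves T (close n p).
Proof. induction n; simpl; auto using Pv_gen. Qed.

Lemma close_sat (M : structure) n p sigma rho :
  sat M rho (close n p) -> (forall v, n <= v -> rho v = sigma v) ->
  sat M sigma p.
Proof.
  revert rho. induction n; simpl; intros rho H E.
  - replace sigma with rho; auto. apply functional_extensionality. intros v. apply E. lia.
  - apply (IHn _ (H (sigma n))). intros v Hv. unfold upd.
    destruct (v =? n) eqn:K; [now apply Nat.eqb_eq in K as ->|].
    apply Nat.eqb_neq in K. apply E. lia.
Qed.

(** [truth] speaks only of the assignment [elt]. The universal closure is provable too, and its
    finitely many quantifiers are instantiated to reach [sigma], which agrees with [rho] on the
    variables of [p]. *)
Lemma term_model_valid p : Proves T p -> valid term_model p.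
Proof.
  intros H rho.
  assert (K : sat term_model elt (close (fresh p) p)).
  { apply truth. apply (max_con_Der []); [easy|]. apply Der_K. now apply close_Proves. }
  set (sigma := fun v => if v <? fresh p then rho v else elt v).
  assert (L : sat term_model sigma p).
  { eapply close_sat; [exact K|]. intros v Hv. unfold sigma.
    now apply Nat.ltb_ge in Hv as ->. }
  rewrite sat_holds in *. eapply holds_ext; [|exact L].
  intros v Hv. apply free_fresh in Hv. unfold sigma. apply Nat.ltb_lt in Hv as ->. easy.
Qed.
End Model.

Theorem completeness p :
  (forall M : structure, (forall q, Proves T q -> valid M q) -> valid M p) ->
  Proves T p.
Proof.
  intros H. apply NNPP. intros N.
  assert (C : Con [Not p]).
  { intros K. apply N. change (Der [] p).
    eapply Der_contra; [apply Der_id|exact K]. }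
  pose proof (H (term_model [Not p]) (term_model_valid [Not p] C) (elt [Not p])) as K.
  apply truth in K; auto. revert K. apply max_con_neg; auto.
  exists 0. simpl; auto.
Qed.
End Completeness.

(** * Meaning of the formalized notions in transitive classes *)

Notation "x ∊ y" := (ein x y) (at level 70, no associativity).

(** Just enough to build pairs, codes of standard formulas and finite sequences. No induction is
    assumed at this level. *)
Class SetModel (M : structure) : Type := {
  emp : M;
  adj : M -> M -> M;
  ext : forall x y : M, (forall z, z ∊ x <-> z ∊ y) -> x = y;
  emp_spec : forall z, ~ z ∊ emp;
  adj_spec : forall x y z, z ∊ adj x y <-> z ∊ x \/ z = y }.

Section Sets.
Context {M : structure} {SM : SetModel M}.
Implicit Types (D : M -> Prop) (x y z f a s n : M).

Definition upair x y : M := adj (adj emp x) y.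
Definition pr x y : M := upair (upair x x) (upair x y).
Definition suc x : M := adj x x.
Fixpoint num (k : nat) : M := match k with 0 => emp | S k => suc (num k) end.

Lemma upair_spec x y z : z ∊ upair x y <-> z = x \/ z = y.
Proof. unfold upair. rewrite !adj_spec. pose proof (emp_spec z). tauto. Qed.

Lemma upair_inj x y x' y' : upair x y = upair x' y' ->
  x = x' /\ y = y' \/ x = y' /\ y = x'.
Proof.
  intros E.
  assert (H : forall z, z = x \/ z = y <-> z = x' \/ z = y').
  { intros z. now rewrite <- !upair_spec, E. }
  pose proof (proj1 (H x)). pose proof (proj1 (H y)).
  pose proof (proj2 (H x')). pose proof (proj2 (H y')).
  intuition congruence.
Qed.

Lemma pr_inj x y x' y' : pr x y = pr x' y' -> x = x' /\ y = y'.
Proof.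
  unfold pr. intros E.
  apply upair_inj in E as [[E1 E2]|[E1 E2]];
    apply upair_inj in E1; apply upair_inj in E2; intuition congruence.
Qed.

Lemma suc_spec x z : z ∊ suc x <-> z ∊ x \/ z = x.
Proof. apply adj_spec. Qed.

Definition closed D : Prop := D emp /\ forall x y, D x -> D y -> D (adj x y).

Lemma closed_emp D : closed D -> D emp.
Proof. now intros []. Qed.
Lemma closed_adj D x y : closed D -> D x -> D y -> D (adj x y).
Proof. intros []; auto. Qed.
Lemma closed_upair D x y : closed D -> D x -> D y -> D (upair x y).
Proof. intros []; unfold upair; auto. Qed.
Lemma closed_pr D x y : closed D -> D x -> D y -> D (pr x y).
Proof. intros; repeat apply (closed_upair D); auto. Qed.
Lemma closed_suc D x : closed D -> D x -> D (suc x).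
Proof. intros; now apply (closed_adj D). Qed.
Lemma closed_num D k : closed D -> D (num k).
Proof. intros; induction k; [now apply (closed_emp D)|now apply (closed_suc D)]. Qed.

Lemma trans_upair D x y : transitive_class D -> D (upair x y) -> D x /\ D y.
Proof. intros T H. split; apply (T _ _ H), upair_spec; auto. Qed.
Lemma trans_pr D x y : transitive_class D -> D (pr x y) -> D x /\ D y.
Proof. intros T H. apply (trans_upair D) in H as [_ H]; auto. now apply (trans_upair D) in H. Qed.
Lemma trans_suc D x : transitive_class D -> D (suc x) -> D x.
Proof. intros T H. apply (T _ _ H), suc_spec; auto. Qed.

Fixpoint cd (p : form) : M :=
  match p with
  | Mem x y => pr (num 0) (pr (num x) (num y))
  | Eql x y => pr (num 1) (pr (num x) (num y))
  | Not p => pr (num 2) (cd p)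
  | Imp p q => pr (num 3) (pr (cd p) (cd q))
  | All x p => pr (num 4) (pr (num x) (cd p))
  end.

(** A further interpretation of the connectives, as operations on elements. Schemes such as
    [ax_sep p] or [at_L R 1 2 p] thereby also denote codes built from a possibly nonstandard code
    [p]. *)
#[export] Instance model_syntax : Syntax M M := {
  mem := fun x y => pr (num 0) (pr x y);
  eql := fun x y => pr (num 1) (pr x y);
  neg := fun p => pr (num 2) p;
  imp := fun p q => pr (num 3) (pr p q);
  all := fun x p => pr (num 4) (pr x p);
  nm := num;
  emb := cd }.

Lemma closed_cd D p : closed D -> D (cd p).
Proof. intros H; induction p; cbn -[num]; repeat apply (closed_pr D); auto; apply (closed_num D); auto. Qed.

(** ** Absolute notions *)

Definition Trans x : Prop := forall y, y ∊ x -> forall z, z ∊ y -> z ∊ x.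
Definition Ord x : Prop := Trans x /\ forall y, y ∊ x -> Trans y.
Definition Nat n : Prop := Ord n /\
  forall m, m ∊ n \/ m = n -> m = emp \/ exists k, k ∊ n /\ m = suc k.
Definition App f x y : Prop := pr x y ∊ f.
Definition Fun f a : Prop :=
  (forall p, p ∊ f -> exists x, x ∊ a /\ exists y, p = pr x y) /\
  (forall x, x ∊ a -> exists y, App f x y) /\
  (forall x, x ∊ a -> forall y z, App f x y -> App f x z -> y = z).

Definition Built D (Step : (M -> Prop) -> M -> Prop) (c : M) : Prop :=
  exists n, D n /\ exists s, D s /\ Nat n /\ Fun s n /\
    (forall i, i ∊ n -> forall e, D e -> App s i e ->
       Step (fun e' => exists j, j ∊ i /\ App s j e') e) /\
    exists m, m ∊ n /\ App s m c.

(** * Meaning of formulas in a transitive class *)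

Section Denotation.
Context (D : M -> Prop) (DT : transitive_class D).

Definition env (d : nat) (rho : nat -> M) : Prop := forall v, v < d -> D (rho v).

Definition extn (rho : nat -> M) (d : nat) (rho' : nat -> M) (d' : nat) : Prop :=
  d <= d' /\ (forall v, v < d -> rho' v = rho v) /\ env d' rho'.

Lemma env_upd d rho a : env d rho -> D a -> env (S d) (upd rho d a).
Proof.
  intros H Ha v Hv. unfold upd. destruct (v =? d) eqn:E; auto.
  apply Nat.eqb_neq in E. apply H. lia.
Qed.

Lemma extn_refl rho d : env d rho -> extn rho d rho d.
Proof. now repeat split. Qed.

Lemma extn_trans r1 d1 r2 d2 r3 d3 :
  extn r1 d1 r2 d2 -> extn r2 d2 r3 d3 -> extn r1 d1 r3 d3.
Proof.
  intros (A1 & A2 & A3) (B1 & B2 & B3). repeat split; auto; try lia.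
  intros v Hv. rewrite B2 by lia. auto.
Qed.

Lemma extn_upd rho d rho' d' a : extn rho d rho' d' -> D a ->
  extn rho d (upd rho' d' a) (S d').
Proof.
  intros (A1 & A2 & A3) Ha. repeat split; auto using env_upd.
  intros v Hv. rewrite upd_other by lia. auto.
Qed.

Lemma den_all rho d (f : nat -> pre) (P : M -> Prop) : env d rho ->
  (forall a, D a -> env (S d) (upd rho d a) ->
     (holds D (upd rho d a) (f d (S d)) <-> P a)) ->
  (holds D rho (bind f d) <-> forall a, D a -> P a).
Proof.
  intros He H. simpl. split; intros K a Ha; apply H; auto using env_upd.
Qed.

Lemma den_ex rho d (f : nat -> pre) (P : M -> Prop) : env d rho ->
  (forall a, D a -> env (S d) (upd rho d a) ->
     (holds D (upd rho d a) (f d (S d)) <-> P a)) ->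
  (holds D rho (neg (bind (fun x : nat => neg (f x))) d) <-> exists a, D a /\ P a).
Proof.
  intros He H. simpl. split.
  - intros K. apply NNPP. intros N. apply K. intros a Ha L. apply N.
    exists a. split; auto. apply H; auto using env_upd.
  - intros (a & Ha & K) L. apply (L a Ha), H; auto using env_upd.
Qed.

Lemma den_ball rho d (y : nat) b (f : nat -> pre) (P : M -> Prop) : env d rho -> y < d ->
  rho y = b -> (forall a, a ∊ b -> D a -> env (S d) (upd rho d a) ->
     (holds D (upd rho d a) (f d (S d)) <-> P a)) ->
  (holds D rho (bind (fun x : nat => imp (mem x y) (f x)) d) <-> forall a, a ∊ b -> P a).
Proof.
  intros He Hy <- H. pose proof (He y Hy) as Dy.
  simpl. split; intros K a Ha.
  - assert (Da : D a) by (eapply DT; eauto).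
    apply H; auto using env_upd. apply K; auto. now rewrite upd_same, upd_other by lia.
  - rewrite upd_same, upd_other by lia. intros Hay. apply H; auto using env_upd.
Qed.

Lemma den_bex rho d (y : nat) b (f : nat -> pre) (P : M -> Prop) : env d rho -> y < d ->
  rho y = b -> (forall a, a ∊ b -> D a -> env (S d) (upd rho d a) ->
     (holds D (upd rho d a) (f d (S d)) <-> P a)) ->
  (holds D rho (neg (bind (fun x : nat => imp (mem x y) (neg (f x)))) d) <->
     exists a, a ∊ b /\ P a).
Proof.
  intros He Hy <- H. simpl. split.
  - intros K. apply NNPP. intros N. apply K. intros a Ha L1 L. apply N.
    rewrite upd_same, upd_other in L1 by lia.
    exists a. split; auto. apply H; auto using env_upd.
  - intros (a & Ha & K) L. assert (Da : D a) by (eapply DT; eauto).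
    apply (L a Da); [now rewrite upd_same, upd_other by lia|].
    apply H; auto using env_upd.
Qed.

Lemma den_neg rho d (p : pre) P : (holds D rho (p d) <-> P) ->
  (holds D rho (neg p d) <-> ~ P).
Proof. simpl. tauto. Qed.
Lemma den_imp rho d (p q : pre) P Q : (holds D rho (p d) <-> P) ->
  (holds D rho (q d) <-> Q) -> (holds D rho (imp p q d) <-> (P -> Q)).
Proof. simpl. tauto. Qed.
Lemma den_and rho d (p q : pre) P Q : (holds D rho (p d) <-> P) ->
  (holds D rho (q d) <-> Q) -> (holds D rho (conj_ p q d) <-> P /\ Q).
Proof. simpl. tauto. Qed.
Lemma den_or rho d (p q : pre) P Q : (holds D rho (p d) <-> P) ->
  (holds D rho (q d) <-> Q) -> (holds D rho (disj_ p q d) <-> P \/ Q).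
Proof. simpl. tauto. Qed.
Lemma den_iff rho d (p q : pre) P Q : (holds D rho (p d) <-> P) ->
  (holds D rho (q d) <-> Q) -> (holds D rho (iff_ p q d) <-> (P <-> Q)).
Proof. simpl. tauto. Qed.
Lemma den_mem rho d (x y : nat) a b : rho x = a -> rho y = b ->
  (holds D rho (mem (F := pre) x y d) <-> a ∊ b).
Proof. intros <- <-. reflexivity. Qed.
Lemma den_eql rho d (x y : nat) a b : rho x = a -> rho y = b ->
  (holds D rho (eql (F := pre) x y d) <-> a = b).
Proof. intros <- <-. reflexivity. Qed.

End Denotation.
End Sets.

Ltac lookup :=
  repeat match goal with
  | |- context [upd _ ?x _ ?x] => rewrite upd_same
  | |- context [upd ?r ?x ?a ?y] => rewrite (upd_other r x a y) by lia
  | H : extn _ _ ?d ?r _ |- context [?r ?x] =>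
      rewrite (proj1 (proj2 H) x) by lia
  end; try reflexivity.

Ltac den_side :=
  try assumption; try lia; try (solve [lookup]).

Ltac den_leaf := fail.

(** Existential quantifiers are matched before plain negation and bounded quantifiers before [bind]
    alone, since they unfold to instances of these. [den_leaf] is redefined each time further
    notions have received their meaning. *)
Ltac den1 :=
  lazymatch goal with
  | |- holds _ _ (@conj_ _ _ _ _ _ _) <-> _ => apply den_and
  | |- holds _ _ (@disj_ _ _ _ _ _ _) <-> _ => apply den_or
  | |- holds _ _ (@iff_ _ _ _ _ _ _) <-> _ => apply den_iff
  | |- holds _ _ (@imp _ _ _ _ _ _) <-> _ => apply den_imp
  | |- holds _ _ (@mem _ _ _ _ _ _) <-> _ => apply den_mem; den_side
  | |- holds _ _ (@eql _ _ _ _ _ _) <-> _ => apply den_eql; den_side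
  | |- holds _ _ (@neg _ _ _ (bind (fun x => @imp _ _ _ (mem x _) (@neg _ _ _ _))) _) <-> _ =>
      eapply den_bex; [assumption|assumption|lia|den_side|intros ? ? ? ?]
  | |- holds _ _ (@neg _ _ _ (bind (fun x => @neg _ _ _ _)) _) <-> _ =>
      eapply den_ex; [assumption|intros ? ? ?]
  | |- holds _ _ (@neg _ _ _ _ _) <-> _ => apply den_neg
  | |- holds _ _ (bind (fun x => @imp _ _ _ (mem x _) _) _) <-> _ =>
      eapply den_ball; [assumption|assumption|lia|den_side|intros ? ? ? ?]
  | |- holds _ _ (bind _ _) <-> _ => eapply den_all; [assumption|intros ? ? ?]
  | |- _ => den_leaf
  end.
Ltac den := repeat (cbv beta; den1).

Section Basic.
Context {M : structure} {SM : SetModel M} (D : M -> Prop) (DT : transitive_class D).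

Lemma den_isEmpty rho d x : env D d rho -> x < d ->
  (holds D rho (isEmpty x d) <-> rho x = emp).
Proof.
  intros He Hx. pose proof (He x Hx) as Dx.
  transitivity (forall y, D y -> ~ y ∊ rho x).
  { unfold isEmpty. den. }
  split.
  - intros H. apply ext. intros z. split; intros K.
    + destruct (H z); auto. (eapply DT; [|exact K]; auto).
    + now apply emp_spec in K.
  - intros -> y _. apply emp_spec.
Qed.

Lemma den_isSucc rho d x y : env D d rho -> x < d -> y < d ->
  (holds D rho (isSucc x y d) <-> rho y = suc (rho x)).
Proof.
  intros He Hx Hy. pose proof (He x Hx) as Dx. pose proof (He y Hy) as Dy.
  transitivity (forall z, D z -> (z ∊ rho y <-> z ∊ rho x \/ z = rho x)).
  { unfold isSucc. den. }
  split.
  - intros H. apply ext. intros z. rewrite suc_spec. split; intros K.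
    + apply H; auto. (eapply DT; [|exact K]; auto).
    + apply H; auto. destruct K as [K| ->]; [(eapply DT; [|exact K]; auto)|]. auto.
  - intros -> z _. apply suc_spec.
Qed.

Lemma den_isUPair rho d x y u : env D d rho -> x < d -> y < d -> u < d ->
  (holds D rho (isUPair x y u d) <-> rho u = upair (rho x) (rho y)).
Proof.
  intros He Hx Hy Hu. pose proof (He x Hx) as Dx. pose proof (He y Hy) as Dy. pose proof (He u Hu) as Du.
  transitivity (forall z, D z -> (z ∊ rho u <-> z = rho x \/ z = rho y)).
  { unfold isUPair. den. }
  split.
  - intros H. apply ext. intros z. rewrite upair_spec. split; intros K.
    + apply H; auto. (eapply DT; [|exact K]; auto).
    + apply H; auto. destruct K as [-> | ->]; auto.
  - intros -> z _. apply upair_spec.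
Qed.

(** [D] is not assumed closed under pairing. If the value of [p] is a pair, the sets u and v that
    the formula asks for are elements of it, hence in [D] by transitivity. *)
Lemma den_isPair rho d x y p : env D d rho -> x < d -> y < d -> p < d ->
  (holds D rho (isPair x y p d) <-> rho p = pr (rho x) (rho y)).
Proof.
  intros He Hx Hy Hp. pose proof (He x Hx) as Dx. pose proof (He y Hy) as Dy.
  pose proof (He p Hp) as Dp.
  transitivity (exists u, D u /\ exists v, D v /\ u = upair (rho x) (rho x) /\
     v = upair (rho x) (rho y) /\ rho p = upair u v).
  { unfold isPair. den.
    1,2,3: (eapply iff_trans; [eapply den_isUPair; den_side|lookup]). }
  split.
  - intros (u & _ & v & _ & -> & -> & E). exact E.
  - intros E. exists (upair (rho x) (rho x)).
    rewrite E in Dp. apply (trans_upair D) in Dp as [D1 D2]; auto.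
    split; auto. exists (upair (rho x) (rho y)). auto.
Qed.
End Basic.

Ltac leaf L := eapply iff_trans; [eapply L; den_side|lookup].

Ltac den_leaf ::=
  lazymatch goal with
  | |- holds _ _ (isEmpty _ _) <-> _ => leaf den_isEmpty
  | |- holds _ _ (isSucc _ _ _) <-> _ => leaf den_isSucc
  | |- holds _ _ (isPair _ _ _ _) <-> _ => leaf den_isPair
  end.

Section Basic2.
Context {M : structure} {SM : SetModel M} (D : M -> Prop) (DT : transitive_class D).

Lemma den_isTrans rho d x : env D d rho -> x < d ->
  (holds D rho (isTrans x d) <-> Trans (rho x)).
Proof. intros He Hx. unfold isTrans, Trans. den. Qed.

Lemma den_app rho d f x y : env D d rho -> f < d -> x < d -> y < d ->
  (holds D rho (app f x y d) <-> App (rho f) (rho x) (rho y)).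
Proof.
  intros He Hf Hx Hy.
  transitivity (exists p, p ∊ rho f /\ p = pr (rho x) (rho y)).
  { unfold app. den. }
  unfold App. split; [now intros (p & Hp & <-)|eauto].
Qed.
End Basic2.

Ltac den_leaf ::=
  lazymatch goal with
  | |- holds _ _ (isEmpty _ _) <-> _ => leaf den_isEmpty
  | |- holds _ _ (isSucc _ _ _) <-> _ => leaf den_isSucc
  | |- holds _ _ (isPair _ _ _ _) <-> _ => leaf den_isPair
  | |- holds _ _ (isTrans _ _) <-> _ => leaf den_isTrans
  | |- holds _ _ (app _ _ _ _) <-> _ => leaf den_app
  end.

Section Basic3.
Context {M : structure} {SM : SetModel M} (D : M -> Prop) (DT : transitive_class D).

Lemma den_isOrd rho d x : env D d rho -> x < d ->
  (holds D rho (isOrd x d) <-> Ord (rho x)).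
Proof. intros He Hx. unfold isOrd, Ord. den. Qed.

Lemma den_isFun rho d f a : env D d rho -> f < d -> a < d ->
  (holds D rho (isFun f a d) <-> Fun (rho f) (rho a)).
Proof.
  intros He Hf Ha. pose proof (He f Hf) as Df. pose proof (He a Ha) as Da.
  transitivity (
    (forall p, p ∊ rho f -> exists x, x ∊ rho a /\ exists y, D y /\ p = pr x y) /\
    (forall x, x ∊ rho a -> exists y, D y /\ App (rho f) x y) /\
    (forall x, x ∊ rho a -> forall y, D y -> forall z, D z ->
       App (rho f) x y -> App (rho f) x z -> y = z)).
  { unfold isFun. den. }
  assert (A : forall x y, pr x y ∊ rho f -> D y).
  { intros x y H. apply (DT _ _ Df) in H. now apply (trans_pr D) in H. }
  unfold Fun, App in *. split; intros (H1 & H2 & H3); repeat split.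
  - intros p Hp. destruct (H1 p Hp) as (x & Hx & y & _ & E). eauto.
  - intros x Hx. destruct (H2 x Hx) as (y & _ & E). eauto.
  - eauto.
  - intros p Hp. destruct (H1 p Hp) as (x & Hx & y & ->). exists x. split; auto.
    exists y. eauto.
  - intros x Hx. destruct (H2 x Hx) as (y & E). eauto.
  - eauto.
Qed.
End Basic3.

Ltac den_leaf ::=
  lazymatch goal with
  | |- holds _ _ (isEmpty _ _) <-> _ => leaf den_isEmpty
  | |- holds _ _ (isSucc _ _ _) <-> _ => leaf den_isSucc
  | |- holds _ _ (isPair _ _ _ _) <-> _ => leaf den_isPair
  | |- holds _ _ (isTrans _ _) <-> _ => leaf den_isTrans
  | |- holds _ _ (isOrd _ _) <-> _ => leaf den_isOrd
  | |- holds _ _ (isFun _ _ _) <-> _ => leaf den_isFun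
  | |- holds _ _ (app _ _ _ _) <-> _ => leaf den_app
  end.

Section Basic4.
Context {M : structure} {SM : SetModel M} (D : M -> Prop) (DT : transitive_class D).

Lemma den_isNat rho d n : env D d rho -> n < d ->
  (holds D rho (isNat n d) <-> Nat (rho n)).
Proof.
  intros He Hn. pose proof (He n Hn) as Dn.
  transitivity (Ord (rho n) /\ forall m, D m -> m ∊ rho n \/ m = rho n ->
    m = emp \/ exists k, k ∊ rho n /\ m = suc k).
  { unfold isNat. den. }
  unfold Nat. split; intros [H1 H2]; split; auto.
  intros m Hm. apply H2; auto. destruct Hm as [Hm| ->]; auto. eapply DT; eauto.
Qed.
End Basic4.

Ltac den_leaf0 :=
  lazymatch goal with
  | |- holds _ _ (isEmpty _ _) <-> _ => leaf den_isEmpty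
  | |- holds _ _ (isSucc _ _ _) <-> _ => leaf den_isSucc
  | |- holds _ _ (isPair _ _ _ _) <-> _ => leaf den_isPair
  | |- holds _ _ (isTrans _ _) <-> _ => leaf den_isTrans
  | |- holds _ _ (isOrd _ _) <-> _ => leaf den_isOrd
  | |- holds _ _ (isNat _ _) <-> _ => leaf den_isNat
  | |- holds _ _ (isFun _ _ _) <-> _ => leaf den_isFun
  | |- holds _ _ (app _ _ _ _) <-> _ => leaf den_app
  end.
Ltac den_leaf ::= den_leaf0.

Section Terms.
Context {M : structure} {SM : SetModel M} (D : M -> Prop) (DT : transitive_class D).

(** A predicate passed as an argument is used below binders that its author does not see, so its
    meaning is required in every extension of the environment. The same holds for [den_step] and
    [den_term]. *)
Definition den_pred (rho : nat -> M) (d : nat) (A : nat -> pre) (Asem : M -> Prop)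
    : Prop :=
  forall rho1 d1 x, extn D rho d rho1 d1 -> x < d1 ->
    (holds D rho1 (A x d1) <-> Asem (rho1 x)).

Definition den_step (rho : nat -> M) (d : nat)
    (step : (nat -> pre) -> nat -> pre) (Step : (M -> Prop) -> M -> Prop) : Prop :=
  forall rho1 d1 earlier Earlier e, extn D rho d rho1 d1 -> e < d1 ->
    den_pred rho1 d1 earlier Earlier ->
    (holds D rho1 (step earlier e d1) <-> Step Earlier (rho1 e)).

Lemma den_built rho d step Step c : env D d rho -> c < d -> den_step rho d step Step ->
  (holds D rho (built step c d) <-> Built D Step (rho c)).
Proof.
  intros He Hc Hs. unfold built, Built. den.
  unfold den_step in Hs. eapply iff_trans.
  - eapply Hs with (Earlier := fun e' => exists j, j ∊ a1 /\ App a0 j e').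
    + repeat apply extn_upd; auto using extn_refl.
    + lia.
    + intros rho2 d2 e' E He'. assert (env D d2 rho2) by apply E.
      pose proof (proj1 E). den.
  - lookup.
Qed.

Definition den_term (rho : nat -> M) (d : nat) (t : term) (v : M) : Prop :=
  forall rho1 d1 c, extn D rho d rho1 d1 -> c < d1 ->
    (holds D rho1 (t c d1) <-> rho1 c = v).

Lemma den_is rho d c t v : env D d rho -> c < d -> den_term rho d t v ->
  (holds D rho (is_ c t d) <-> rho c = v).
Proof. intros He Hc H. apply H; auto using extn_refl. Qed.

Lemma den_tvar rho d x : x < d -> den_term rho d (tvar x) (rho x).
Proof.
  intros Hx rho1 d1 c E Hc. unfold tvar. den.
Qed.

Lemma den_tnum rho d k : den_term rho d (tnum k) (num k).
Proof.
  induction k as [|k IH]; intros rho1 d1 c E Hc;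
    assert (He : env D d1 rho1) by apply E; cbn [tnum]; cbv beta.
  - den.
  - transitivity (exists x, D x /\ x = num k /\ rho1 c = suc x).
    { den. eapply iff_trans.
      - apply IH; [|lia]. apply extn_upd; auto.
      - lookup. }
    simpl. split; [now intros (x & _ & -> & ->)|].
    intros K. exists (num k). pose proof (He c Hc) as Dc. rewrite K in Dc.
    apply (trans_suc D) in Dc; auto.
Qed.

Lemma den_tpair rho d s t u v : den_term rho d s u -> den_term rho d t v ->
  den_term rho d (tpair s t) (pr u v).
Proof.
  intros Hs Ht rho1 d1 c E Hc. assert (He : env D d1 rho1) by apply E.
  transitivity (exists x, D x /\ exists y, D y /\ x = u /\ y = v /\ rho1 c = pr x y).
  { unfold tpair. den.
    - eapply iff_trans; [apply Hs; [|lia]|lookup]. repeat apply extn_upd; auto.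
    - eapply iff_trans; [apply Ht; [|lia]|lookup]. repeat apply extn_upd; auto. }
  split.
  - intros (x & _ & y & _ & -> & -> & K). exact K.
  - intros K. exists u. pose proof (He c Hc) as Dc. rewrite K in Dc.
    apply (trans_pr D) in Dc as [D1 D2]; auto. split; auto. exists v. auto.
Qed.

Lemma den_cMem rho d s t u v : den_term rho d s u -> den_term rho d t v ->
  den_term rho d (mem s t) (mem u v).
Proof. intros. repeat apply den_tpair; auto. apply (den_tnum rho d 0). Qed.
Lemma den_cEql rho d s t u v : den_term rho d s u -> den_term rho d t v ->
  den_term rho d (eql s t) (eql u v).
Proof. intros. repeat apply den_tpair; auto. apply (den_tnum rho d 1). Qed.
Lemma den_cNot rho d s u : den_term rho d s u ->
  den_term rho d (neg s) (neg u).
Proof. intros. repeat apply den_tpair; auto. apply (den_tnum rho d 2). Qed.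
Lemma den_cImp rho d s t u v : den_term rho d s u -> den_term rho d t v ->
  den_term rho d (imp s t) (imp u v).
Proof. intros. repeat apply den_tpair; auto. apply (den_tnum rho d 3). Qed.
Lemma den_cAll rho d s t u v : den_term rho d s u -> den_term rho d t v ->
  den_term rho d (all s t) (all u v).
Proof. intros. repeat apply den_tpair; auto. apply (den_tnum rho d 4). Qed.

Lemma den_quote rho d p : den_term rho d (quote p) (cd p).
Proof.
  induction p; cbn [quote].
  - apply den_cMem; apply den_tnum.
  - apply den_cEql; apply den_tnum.
  - now apply den_cNot.
  - now apply den_cImp.
  - apply den_cAll; auto. apply den_tnum.
Qed.
End Terms.

Ltac den_term_tac :=
  repeat lazymatch goal with
  | |- den_term _ _ _ (@mem _ _ _ _ _) _ => apply den_cMem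
  | |- den_term _ _ _ (@eql _ _ _ _ _) _ => apply den_cEql
  | |- den_term _ _ _ (@neg _ _ _ _) _ => apply den_cNot
  | |- den_term _ _ _ (@imp _ _ _ _ _) _ => apply den_cImp
  | |- den_term _ _ _ (@all _ _ _ _ _) _ => apply den_cAll
  | |- den_term _ _ _ (@nm _ _ _ _) _ => apply den_tnum
  | |- den_term _ _ _ (@emb _ _ _ _) _ => apply den_quote
  | |- den_term _ _ _ (tnum _) _ => apply den_tnum
  | |- den_term _ _ _ (quote _) _ => apply den_quote
  | |- den_term _ _ _ (tvar _) _ => apply den_tvar; lia
  end; auto.

Ltac den_unfold :=
  unfold lax_k, lax_s, lax_contra, lax_dist, lax_inst, lax_vac, lax_exists,
    lax_eq, lax_meml, lax_memr, ax_sep, ax_coll, ax_ind, at_L,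
    iff_; unfold exIn, allIn, conj_, disj_, Defs.ex.

Ltac den_extn :=
  repeat (apply extn_upd; [|assumption]);
  first [assumption
        | apply extn_refl; assumption
        | eapply extn_trans; [eassumption|]; den_extn].

Ltac den_var A :=
  match goal with
  | H : den_pred _ _ _ A _ |- _ =>
      eapply iff_trans; [eapply H; [den_extn|lia]|lookup]
  end.

Ltac den_leaf1 :=
  lazymatch goal with
  | |- holds _ _ (is_ _ _ _) <-> _ =>
      eapply iff_trans; [eapply den_is; [assumption|lia|den_unfold; den_term_tac]|lookup]
  | |- holds _ _ (?A _ _) <-> _ => first [is_var A; den_var A | den_leaf0]
  | |- _ => den_leaf0
  end.
Ltac den_leaf ::= den_leaf1.

Ltac den_start E :=
  let He := fresh "He" in pose proof (proj2 (proj2 E)) as He.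

(** ** Formalized syntax *)

(** The formalization of Δ₀-formulas with the variables restricted by [A];
    [isDelta0] is the case [A = isNat]. *)
Definition isDelta0In (A : nat -> pre) (c : nat) : pre :=
  built (fun earlier e =>
    (∃' x, ∃' y, A x ⩓ A y ⩓
       (e ≗ (tvar x ∈ tvar y) ⩔ e ≗ (tvar x ≐ tvar y))) ⩔
    (∃' p, earlier p ⩓ e ≗ (∼ tvar p)) ⩔
    (∃' p, ∃' q, earlier p ⩓ earlier q ⩓ e ≗ (tvar p ⇒ tvar q)) ⩔
    (∃' x, ∃' y, ∃' p, A x ⩓ A y ⩓ ∼ (x ≐ y) ⩓ earlier p ⩓
       e ≗ allIn (tvar x) (tvar y) (tvar p))) c.

Section Syntax.
Context {M : structure} {SM : SetModel M}.
Implicit Types (A D : M -> Prop) (x y z f a s n c e p q r t : M).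

(** This and the following definitions copy the formulas clause by clause, with the unbounded
    quantifiers over [D], so that [den] matches the two sides without further argument. *)
Definition FormStep D A (ear : M -> Prop) e : Prop :=
  (exists x, D x /\ exists y, D y /\ A x /\ A y /\ (e = mem x y \/ e = eql x y)) \/
  (exists p, D p /\ ear p /\ e = neg p) \/
  (exists p, D p /\ exists q, D q /\ ear p /\ ear q /\ e = imp p q) \/
  (exists x, D x /\ exists p, D p /\ A x /\ ear p /\ e = all x p).
Definition IsFormIn D A : M -> Prop := Built D (FormStep D A).
Definition IsForm D : M -> Prop := IsFormIn D Nat.
Definition IsFormWithout D x : M -> Prop := IsFormIn D (fun y => Nat y /\ ~ y = x).

Definition Delta0Step D A (ear : M -> Prop) e : Prop :=
  (exists x, D x /\ exists y, D y /\ A x /\ A y /\ (e = mem x y \/ e = eql x y)) \/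
  (exists p, D p /\ ear p /\ e = neg p) \/
  (exists p, D p /\ exists q, D q /\ ear p /\ ear q /\ e = imp p q) \/
  (exists x, D x /\ exists y, D y /\ exists p, D p /\ A x /\ A y /\ ~ x = y /\ ear p /\
     e = allIn x y p).
Definition IsDelta0 D A : M -> Prop := Built D (Delta0Step D A).

Definition FreeStep D (ear : M -> Prop) e : Prop :=
  exists p, D p /\ exists t, D t /\ e = pr p t /\
    ((exists x, x ∊ t /\ exists y, y ∊ t /\ (p = mem x y \/ p = eql x y)) \/
     (exists q, D q /\ (exists b, D b /\ ear b /\ b = pr q t) /\ p = neg q) \/
     (exists q, D q /\ exists r, D r /\ (exists b, D b /\ ear b /\ b = pr q t) /\
        (exists b, D b /\ ear b /\ b = pr r t) /\ p = imp q r) \/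
     (exists x, D x /\ exists q, D q /\ exists t', D t' /\ Nat x /\
        (forall y, D y -> (y ∊ t' <-> y ∊ t \/ y = x)) /\
        (exists b, D b /\ ear b /\ b = pr q t') /\ p = all x q)).
Definition FreeIn D c s : Prop := Built D (FreeStep D) (pr c s).

Definition LogAx D e : Prop :=
  (exists p, D p /\ exists q, D q /\ IsForm D p /\ IsForm D q /\
     (e = lax_k p q \/ e = lax_contra p q)) \/
  (exists p, D p /\ exists q, D q /\ exists r, D r /\
     IsForm D p /\ IsForm D q /\ IsForm D r /\ e = lax_s p q r) \/
  (exists x, D x /\ exists p, D p /\ exists q, D q /\
     Nat x /\ IsForm D p /\ IsForm D q /\ e = lax_dist x p q) \/
  (exists x, D x /\ exists p, D p /\ Nat x /\ IsForm D p /\ e = lax_inst x p) \/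
  (exists x, D x /\ exists p, D p /\ Nat x /\ IsFormWithout D x p /\ e = lax_vac x p) \/
  (exists x, D x /\ exists y, D y /\ Nat x /\ Nat y /\ e = lax_exists x y) \/
  (exists x, D x /\ exists y, D y /\ exists z, D z /\ Nat x /\ Nat y /\ Nat z /\
     (e = lax_eq x y z \/ e = lax_meml x y z \/ e = lax_memr x y z)).

Definition ProofStep D A (ear : M -> Prop) e : Prop :=
  LogAx D e \/ A e \/
  (exists p, D p /\ exists q, D q /\ ear p /\ ear q /\ q = imp p e) \/
  (exists x, D x /\ exists p, D p /\ Nat x /\ ear p /\ e = all x p).
Definition Provable D A : M -> Prop := Built D (ProofStep D A).

Definition IsUnary D c : Prop := FreeIn D c (num 1).
Definition IsSigma1 D c : Prop :=
  exists x, D x /\ exists p, D p /\ Nat x /\ IsDelta0 D Nat p /\ c = Defs.ex x p.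
Definition IsKP D c : Prop :=
  c = cd ax_ext \/ c = cd ax_union \/ c = cd ax_pairing \/ c = cd ax_infinity \/
  (exists p, D p /\ IsDelta0 D Nat p /\ IsFormWithout D (num 2) p /\ c = ax_sep p) \/
  (exists p, D p /\ IsSigma1 D p /\ IsFormWithout D (num 3) p /\ c = ax_coll p) \/
  (exists p, D p /\ IsFormWithout D (num 1) p /\ c = ax_ind p).

Definition IsAssignments D n z (A : M) : Prop := forall a, D a ->
  (a ∊ A <-> Fun a n /\ forall i, i ∊ n -> forall u, D u -> App a i u -> u ∊ z).
Definition AgreeOff D n x a b : Prop :=
  forall i, i ∊ n -> ~ i = x -> exists u, D u /\ App a i u /\ App b i u.

Definition EvStep D n (A : M) (ear : M -> Prop) e : Prop :=
  exists p, D p /\ exists Y, D Y /\ e = pr p Y /\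
    ((exists x, x ∊ n /\ exists y, y ∊ n /\ p = mem x y /\
        forall a, D a -> (a ∊ Y <-> a ∊ A /\ exists u, D u /\ exists v, D v /\
          App a x u /\ App a y v /\ u ∊ v)) \/
     (exists x, x ∊ n /\ exists y, y ∊ n /\ p = eql x y /\
        forall a, D a -> (a ∊ Y <-> a ∊ A /\ exists u, D u /\ exists v, D v /\
          App a x u /\ App a y v /\ u = v)) \/
     (exists q, D q /\ exists Z, D Z /\ (exists b, D b /\ ear b /\ b = pr q Z) /\
        p = neg q /\ forall a, D a -> (a ∊ Y <-> a ∊ A /\ ~ a ∊ Z)) \/
     (exists q, D q /\ exists Z, D Z /\ exists r, D r /\ exists W, D W /\
        (exists b, D b /\ ear b /\ b = pr q Z) /\ (exists b, D b /\ ear b /\ b = pr r W) /\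
        p = imp q r /\ forall a, D a -> (a ∊ Y <-> a ∊ A /\ (a ∊ Z -> a ∊ W))) \/
     (exists x, x ∊ n /\ exists q, D q /\ exists Z, D Z /\
        (exists b, D b /\ ear b /\ b = pr q Z) /\ p = all x q /\
        forall a, D a -> (a ∊ Y <-> a ∊ A /\ forall b, b ∊ A -> AgreeOff D n x a b -> b ∊ Z))).
Definition Evaluates D z n (A : M) c (X : M) : Prop :=
  Nat n /\ IsAssignments D n z A /\ exists b, D b /\ b = pr c X /\ Built D (EvStep D n A) b.
Definition Models D z c : Prop :=
  (exists x, D x /\ x ∊ z) /\
  exists n, D n /\ exists A : M, D A /\ exists X, D X /\ Evaluates D z n A c X /\
    forall a, a ∊ A -> a ∊ X.

Definition IsDef D z (E : M) : Prop := forall y, D y -> (y ∊ E <->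
  exists n, D n /\ exists A : M, D A /\ exists c, D c /\ exists X, D X /\ exists a, D a /\
    Evaluates D z n A c X /\ Fun a n /\ exists o, D o /\ o = emp /\
      forall u, D u -> (u ∊ y <-> exists b, b ∊ X /\ App b o u /\ AgreeOff D n o a b)).
Definition IsL D xi z : Prop :=
  Ord xi /\ exists f, D f /\ exists e, D e /\ e = suc xi /\ Fun f e /\
    (forall eta, eta ∊ e -> forall w, D w -> App f eta w ->
       forall u, D u -> (u ∊ w <->
         exists zeta, zeta ∊ eta /\ exists v, D v /\ exists E, D E /\
           App f zeta v /\ IsDef D v E /\ u ∊ E)) /\
    App f xi z.
Definition IsAdmissible D xi : Prop :=
  exists z, D z /\ IsL D xi z /\ forall c, D c -> IsKP D c -> Models D z c.

Section Denotation.
Context (D : M -> Prop) (DT : transitive_class D).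

Lemma den_isFormIn rho d (A : nat -> pre) Asem (c : nat) : env D d rho -> c < d ->
  den_pred D rho d A Asem ->
  (holds D rho (isFormIn A c d) <-> IsFormIn D Asem (rho c)).
Proof.
  intros He Hc HA. unfold isFormIn, IsFormIn. apply den_built; auto.
  intros rho1 d1 ear Ear e E Hlt Hear. den_start E. unfold FormStep. den.
Qed.

Lemma den_isForm rho d (c : nat) : env D d rho -> c < d ->
  (holds D rho (isForm c d) <-> IsForm D (rho c)).
Proof.
  intros He Hc. apply den_isFormIn; auto.
  intros rho1 d1 x E Hx. den_start E. den.
Qed.

Lemma den_isFormWithout rho d (x c : nat) : env D d rho -> c < d -> x < d ->
  (holds D rho (isFormWithout x c d) <-> IsFormWithout D (rho x) (rho c)).
Proof.
  intros He Hc Hx. apply den_isFormIn; auto.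
  intros rho1 d1 y E Hy. den_start E. pose proof (proj1 E). den.
Qed.

Lemma den_isDelta0In rho d (A : nat -> pre) Asem (c : nat) : env D d rho -> c < d ->
  den_pred D rho d A Asem ->
  (holds D rho (isDelta0In A c d) <-> IsDelta0 D Asem (rho c)).
Proof.
  intros He Hc HA. unfold isDelta0In, IsDelta0. apply den_built; auto.
  intros rho1 d1 ear Ear e E Hlt Hear. den_start E. unfold Delta0Step. den.
Qed.

Lemma den_isDelta0 rho d (c : nat) : env D d rho -> c < d ->
  (holds D rho (isDelta0 c d) <-> IsDelta0 D Nat (rho c)).
Proof.
  intros He Hc. change (isDelta0 c) with (isDelta0In isNat c).
  apply den_isDelta0In; auto. intros rho1 d1 x E Hx. den_start E. den.
Qed.

Lemma den_freeIn rho d (c s : nat) : env D d rho -> c < d -> s < d ->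
  (holds D rho (freeIn c s d) <-> FreeIn D (rho c) (rho s)).
Proof.
  intros He Hc Hs.
  transitivity (exists cs, D cs /\ cs = pr (rho c) (rho s) /\ Built D (FreeStep D) cs).
  { unfold freeIn. den. eapply iff_trans.
    - apply den_built with (Step := FreeStep D); auto.
      intros rho1 d1 ear Ear e E Hlt Hear. den_start E. unfold FreeStep, earlierPair.
      den.
    - lookup. }
  unfold FreeIn. split.
  - now intros (cs & _ & -> & H).
  - intros H. exists (pr (rho c) (rho s)). split; [|split]; auto.
    destruct H as (n & _ & f & Df & _ & _ & _ & m & _ & H).
    apply (DT _ _ Df) in H. now apply (trans_pr D) in H.
Qed.

Lemma FreeIn_class c s : FreeIn D c s -> D s.
Proof.
  intros (n & _ & f & Df & _ & _ & _ & m & _ & H).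
  apply (DT _ _ Df) in H. apply (trans_pr D) in H as [_ H]; auto. now apply (trans_pr D) in H.
Qed.

Lemma den_isUnary rho d (c : nat) : env D d rho -> c < d ->
  (holds D rho (isUnary c d) <-> IsUnary D (rho c)).
Proof.
  intros He Hc. transitivity (exists s, D s /\ s = num 1 /\ FreeIn D (rho c) s).
  { unfold isUnary. den. leaf den_freeIn. }
  unfold IsUnary. split.
  - now intros (s & _ & -> & H).
  - intros H. pose proof (FreeIn_class _ _ H). eauto.
Qed.

Lemma den_isFormWithoutNum rho d k (c : nat) : env D d rho -> c < d -> closed D ->
  (holds D rho (isFormWithoutNum k c d) <-> IsFormWithout D (num k) (rho c)).
Proof.
  intros He Hc HD. transitivity (exists x, D x /\ x = num k /\ IsFormWithout D x (rho c)).
  { unfold isFormWithoutNum. den. leaf den_isFormWithout. }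
  split.
  - now intros (s & _ & -> & H).
  - intros H. exists (num k). split; auto. now apply (closed_num D).
Qed.

Lemma den_isSigma1 rho d (c : nat) : env D d rho -> c < d ->
  (holds D rho (isSigma1 c d) <-> IsSigma1 D (rho c)).
Proof.
  intros He Hc. unfold isSigma1, IsSigma1. den. leaf den_isDelta0.
Qed.

Lemma den_isLogicalAxiom rho d (e : nat) : env D d rho -> e < d ->
  (holds D rho (isLogicalAxiom e d) <-> LogAx D (rho e)).
Proof.
  intros He Hc. unfold isLogicalAxiom, LogAx. den.
  all: lazymatch goal with
    | |- holds _ _ (isForm _ _) <-> _ => leaf den_isForm
    | |- _ => leaf den_isFormWithout end.
Qed.

Lemma den_Pr rho d (A : nat -> pre) Asem (c : nat) : env D d rho -> c < d ->
  den_pred D rho d A Asem ->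
  (holds D rho (Pr A c d) <-> Provable D Asem (rho c)).
Proof.
  intros He Hc HA. unfold Pr, Provable. apply den_built; auto.
  intros rho1 d1 ear Ear e E Hlt Hear. den_start E. unfold ProofStep. den.
  leaf den_isLogicalAxiom.
Qed.

Lemma den_isKP rho d (c : nat) : env D d rho -> c < d -> closed D ->
  (holds D rho (isKP c d) <-> IsKP D (rho c)).
Proof.
  intros He Hc HD. unfold isKP, IsKP. den.
  all: lazymatch goal with
    | |- holds _ _ (isDelta0 _ _) <-> _ => leaf den_isDelta0
    | |- holds _ _ (isSigma1 _ _) <-> _ => leaf den_isSigma1
    | |- _ => leaf den_isFormWithoutNum end.
Qed.

Lemma den_evaluates rho d (z n A c X : nat) : env D d rho ->
  z < d -> n < d -> A < d -> c < d -> X < d ->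
  (holds D rho (evaluates z n A c X d) <->
   Evaluates D (rho z) (rho n) (rho A) (rho c) (rho X)).
Proof.
  intros He Hz Hn HA Hc HX. unfold evaluates, Evaluates, isAssignments, IsAssignments.
  den. eapply iff_trans.
  - apply den_built with (Step := EvStep D (rho n) (rho A)); auto.
    intros rho1 d1 ear Ear e E Hlt Hear. den_start E. pose proof (proj1 E).
    unfold EvStep, earlierPair, agreeOff, AgreeOff. den.
  - lookup.
Qed.

Lemma den_models rho d (z c : nat) : env D d rho -> z < d -> c < d ->
  (holds D rho (models z c d) <-> Models D (rho z) (rho c)).
Proof.
  intros He Hz Hc. unfold models, Models. den. leaf den_evaluates.
Qed.

Lemma den_isDef rho d (z E : nat) : env D d rho -> z < d -> E < d ->
  (holds D rho (isDef z E d) <-> IsDef D (rho z) (rho E)).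
Proof.
  intros He Hz Hc. unfold isDef, IsDef, agreeOff, AgreeOff. den. leaf den_evaluates.
Qed.

Lemma den_isL rho d (xi z : nat) : env D d rho -> xi < d -> z < d ->
  (holds D rho (isL xi z d) <-> IsL D (rho xi) (rho z)).
Proof.
  intros He Hx Hz. unfold isL, IsL. den. leaf den_isDef.
Qed.

Lemma den_isAdmissible rho d (xi : nat) : env D d rho -> xi < d -> closed D ->
  (holds D rho (isAdmissible xi d) <-> IsAdmissible D (rho xi)).
Proof.
  intros He Hx HD. unfold isAdmissible, IsAdmissible. den.
  - leaf den_isL.
  - leaf den_isKP.
  - leaf den_models.
Qed.
End Denotation.
End Syntax.

(** ** Standard formulas and proofs *)

Section Standard.
Context {M : structure} {SM : SetModel M}.
Implicit Types (x y z f s n c e : M) (k j : nat) (p q : form).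

Lemma num_spec k x : x ∊ num k <-> exists j, j < k /\ x = num j.
Proof.
  induction k as [|k IH]; cbn [num].
  - split; [now intros H%emp_spec|intros (j & H & _); lia].
  - rewrite suc_spec, IH. split.
    + intros [(j & Hj & ->)| ->]; [exists j|exists k]; split; auto; lia.
    + intros (j & Hj & ->). destruct (Nat.eq_dec j k) as [->|N]; auto.
      left. exists j. split; auto; lia.
Qed.

Lemma num_irrefl k : ~ num k ∊ num k.
Proof.
  induction k as [k IH] using lt_wf_ind. intros H.
  pose proof H as (j & Hj & E)%num_spec. apply (IH j Hj). now rewrite <- E.
Qed.

Lemma num_inj k j : num k = num j -> k = j.
Proof.
  intros E. destruct (lt_eq_lt_dec k j) as [[H|H]|H]; auto; exfalso.
  - apply (num_irrefl j). rewrite <- E at 1. apply num_spec. eauto.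
  - apply (num_irrefl k). rewrite E at 1. apply num_spec. eauto.
Qed.

Lemma Nat_num k : Nat (num k).
Proof.
  assert (T : forall k, Trans (num k)).
  { intros m y (j & Hj & ->)%num_spec z (i & Hi & ->)%num_spec.
    apply num_spec. exists i. split; auto; lia. }
  split; [split; auto|].
  - intros y (j & Hj & ->)%num_spec. auto.
  - assert (A : forall j, j <= k -> num j = emp \/ exists m, m ∊ num k /\ num j = suc m).
    { intros [|j] Hj; [now left|right]. exists (num j). split; auto.
      apply num_spec. exists j. split; auto; lia. }
    intros m [(j & Hj & ->)%num_spec| ->]; apply A; lia.
Qed.

Fixpoint seqset (k : nat) (l : list M) : M :=
  match l with [] => emp | e :: l => adj (seqset (S k) l) (pr (num k) e) end.

Lemma seqset_spec l k x :
  x ∊ seqset k l <-> exists j e, nth_error l j = Some e /\ x = pr (num (k + j)) e.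
Proof.
  revert k. induction l as [|e l IH]; intros k; cbn [seqset].
  - split; [now intros H%emp_spec|]. intros ([|j] & e & H & _); easy.
  - rewrite adj_spec, IH. split.
    + intros [(j & e' & H & ->)| ->].
      * exists (S j), e'. now rewrite Nat.add_succ_r.
      * exists 0, e. now rewrite Nat.add_0_r.
    + intros ([|j] & e' & H & ->).
      * right. rewrite Nat.add_0_r. injection H as ->. easy.
      * left. exists j, e'. now rewrite Nat.add_succ_r.
Qed.

Lemma App_seqset l x e :
  App (seqset 0 l) x e <-> exists j, nth_error l j = Some e /\ x = num j.
Proof.
  unfold App. rewrite seqset_spec. split.
  - intros (j & e' & H & [-> ->]%pr_inj). eauto.
  - intros (j & H & ->). exists j, e. auto.
Qed.

Lemma Fun_seqset l : Fun (seqset 0 l) (num (length l)).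
Proof.
  repeat split.
  - intros x (j & e & H & ->)%seqset_spec. exists (num j). split; eauto.
    apply num_spec. exists j. split; auto. apply nth_error_Some. congruence.
  - intros x (j & Hj & ->)%num_spec. destruct (nth_error l j) as [e|] eqn:E.
    + exists e. apply App_seqset. eauto.
    + apply nth_error_None in E. lia.
  - intros x _ y z (j & Hj & ->)%App_seqset (i & Hi & E)%App_seqset.
    apply num_inj in E. subst. congruence.
Qed.

Lemma closed_seqset (D : M -> Prop) l k : closed D -> (forall e, In e l -> D e) ->
  D (seqset k l).
Proof.
  intros HD. revert k. induction l as [|e l IH]; intros k H; cbn [seqset].
  - now apply (closed_emp D).
  - apply (closed_adj D); auto.
    + apply IH. intros; apply H; now right.
    + apply (closed_pr D); auto; [now apply (closed_num D)|apply H; now left].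
Qed.

Definition mono (Step : (M -> Prop) -> M -> Prop) : Prop :=
  forall ear ear' e, (forall x, ear x -> ear' x) -> Step ear e -> Step ear' e.

Section Derivations.
Context (D : M -> Prop) (HD : closed D).

(** Building sequences as lists of the metatheory can be concatenated freely, which is what
    inductions over standard formulas and proofs need. [Listed_Built] turns them into sets, using
    only closure of [D] under adjunction. *)
Definition listing (Step : (M -> Prop) -> M -> Prop) (l : list M) : Prop :=
  forall k e, nth_error l k = Some e ->
    D e /\ Step (fun e' => exists j, j < k /\ nth_error l j = Some e') e.

Definition Listed Step c : Prop := exists l, listing Step l /\ In c l.

Lemma Listed_Built Step c : mono Step -> Listed Step c -> Built D Step c.
Proof.
  intros Hm (l & Hl & Hc). exists (num (length l)). split; [now apply (closed_num D)|].
  exists (seqset 0 l). split.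
  { apply closed_seqset; auto. intros e He. apply In_nth_error in He as [k Hk].
    now apply Hl in Hk. }
  split; [apply Nat_num|]. split; [apply Fun_seqset|]. split.
  - intros i _ e _ (j & Hj & ->)%App_seqset. apply Hl in Hj as [_ Hj].
    eapply Hm; [|exact Hj]. intros x (m & Hm1 & Hm2). exists (num m). split.
    + apply num_spec. eauto.
    + apply App_seqset. eauto.
  - apply In_nth_error in Hc as [k Hk]. exists (num k). split.
    + apply num_spec. exists k. split; auto. apply nth_error_Some. congruence.
    + apply App_seqset. eauto.
Qed.

Lemma listing_app Step l l' : mono Step -> listing Step l -> listing Step l' ->
  listing Step (l ++ l').
Proof.
  intros Hm H1 H2 k e Hk. destruct (le_lt_dec (length l) k) as [L|L].
  - rewrite nth_error_app2 in Hk by lia. apply H2 in Hk as [De Hk]. split; auto.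
    eapply Hm; [|exact Hk]. intros x (j & Hj & Hx). exists (length l + j).
    split; [lia|]. rewrite nth_error_app2 by lia. rewrite <- Hx. f_equal. lia.
  - rewrite nth_error_app1 in Hk by lia. apply H1 in Hk as [De Hk]. split; auto.
    eapply Hm; [|exact Hk]. intros x (j & Hj & Hx). exists j.
    split; auto. rewrite nth_error_app1 by lia. auto.
Qed.

Lemma Listed_step Step c (prem : list M) : mono Step ->
  (forall e, In e prem -> Listed Step e) -> D c ->
  Step (fun e => In e prem) c -> Listed Step c.
Proof.
  intros Hm Hp Dc Hs.
  assert (H : exists l, listing Step l /\ incl prem l).
  { clear Hs. induction prem as [|e prem IH].
    - exists []. split; [|easy]. now intros [|k] e.
    - destruct IH as (l & Hl & I). { intros; apply Hp; now right. }
      destruct (Hp e) as (l' & Hl' & I'); [now left|].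
      exists (l' ++ l). split; [now apply listing_app|].
      intros x [<-|Hx]; apply in_or_app; auto. }
  destruct H as (l & Hl & I). exists (l ++ [c]). split; [|apply in_or_app; simpl; auto].
  intros k e Hk. destruct (lt_eq_lt_dec k (length l)) as [[L|L]|L].
  - rewrite nth_error_app1 in Hk by lia. apply Hl in Hk as [De Hk]. split; auto.
    eapply Hm; [|exact Hk]. intros x (j & Hj & Hx). exists j.
    split; auto. rewrite nth_error_app1 by lia. auto.
  - subst k. rewrite nth_error_app2, Nat.sub_diag in Hk by lia. injection Hk as <-.
    split; auto. eapply Hm; [|exact Hs]. intros x Hx. apply I, In_nth_error in Hx as [j Hj].
    exists j. assert (j < length l) by (apply nth_error_Some; congruence).
    split; auto. rewrite nth_error_app1 by lia. auto.
  - assert (k < length (l ++ [c])) by (apply nth_error_Some; congruence).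
    rewrite length_app in *. simpl in *. lia.
Qed.

Lemma mono_FormStep A : mono (FormStep D A).
Proof. intros ear ear' e H. unfold FormStep. firstorder. Qed.
Lemma mono_Delta0Step A : mono (Delta0Step D A).
Proof. intros ear ear' e H. unfold Delta0Step. firstorder. Qed.
Lemma mono_FreeStep : mono (FreeStep D).
Proof.
  intros ear ear' e H (p & Dp & t & Dt & E & K). exists p. split; auto. exists t.
  do 2 (split; auto). destruct K as [K|[K|[K|K]]].
  - auto.
  - right; left. firstorder.
  - right; right; left. firstorder.
  - right; right; right. destruct K as (x & Dx & q & Dq & t' & Dt' & Nx & Ht' & K & E').
    exists x; split; auto. exists q; split; auto. exists t'. firstorder.
Qed.
Lemma mono_ProofStep A : mono (ProofStep D A).
Proof.
  intros ear ear' e H [K|[K|[K|K]]]; [left|right;left|right;right;left|right;right;right];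
    firstorder.
Qed.

Local Ltac clos := first [ assumption | apply (closed_cd D); assumption
  | apply (closed_num D); assumption | apply (closed_pr D); [assumption|clos|clos]].

Lemma IsFormIn_cd (A : M -> Prop) p :
  (forall v, occurs v p = true -> A (num v)) -> IsFormIn D A (cd p).
Proof.
  intros H. apply Listed_Built; [apply mono_FormStep|].
  induction p; simpl in H.
  - apply (Listed_step _ _ []); [apply mono_FormStep|easy|apply (closed_cd D); auto|].
    left. exists (num x). split; [clos|]. exists (num y). split; [clos|].
    repeat split; auto; apply H; now rewrite Nat.eqb_refl, ?orb_true_r.
  - apply (Listed_step _ _ []); [apply mono_FormStep|easy|apply (closed_cd D); auto|].
    left. exists (num x). split; [clos|]. exists (num y). split; [clos|].
    repeat split; auto; apply H; now rewrite Nat.eqb_refl, ?orb_true_r.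
  - apply (Listed_step _ _ [cd p]); [apply mono_FormStep| |apply (closed_cd D); auto|].
    { intros e [<-|[]]; auto. }
    right; left. exists (cd p). split; [clos|]. simpl; auto.
  - apply (Listed_step _ _ [cd p1; cd p2]); [apply mono_FormStep| |apply (closed_cd D); auto|].
    { intros e [<-|[<-|[]]]; [apply IHp1|apply IHp2]; intros v Hv; apply H;
        rewrite Hv, ?orb_true_r; auto. }
    right; right; left. exists (cd p1). split; [clos|]. exists (cd p2). split; [clos|].
    simpl; auto.
  - apply (Listed_step _ _ [cd p]); [apply mono_FormStep| |apply (closed_cd D); auto|].
    { intros e [<-|[]]; apply IHp; intros v Hv; apply H; rewrite Hv, ?orb_true_r; auto. }
    right; right; right. exists (num x). split; [clos|]. exists (cd p). split; [clos|].
    split; [|simpl; auto]. apply H. now rewrite Nat.eqb_refl.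
Qed.

Lemma IsForm_cd p : IsForm D (cd p).
Proof. apply IsFormIn_cd. intros; apply Nat_num. Qed.

Lemma IsFormWithout_cd k p : occurs k p = false -> IsFormWithout D (num k) (cd p).
Proof.
  intros H. apply IsFormIn_cd. intros v Hv. split; [apply Nat_num|].
  intros E%num_inj. congruence.
Qed.

Lemma IsDelta0_cd (A : M -> Prop) p : Delta0 p ->
  (forall v, occurs v p = true -> A (num v)) -> IsDelta0 D A (cd p).
Proof.
  intros H HA. apply Listed_Built; [apply mono_Delta0Step|].
  induction H; simpl in HA.
  - apply (Listed_step _ _ []); [apply mono_Delta0Step|easy|apply (closed_cd D (Mem x y)); auto|].
    left. exists (num x). split; [clos|]. exists (num y). split; [clos|].
    repeat split; auto; apply HA; now rewrite Nat.eqb_refl, ?orb_true_r.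
  - apply (Listed_step _ _ []); [apply mono_Delta0Step|easy|apply (closed_cd D (Eql x y)); auto|].
    left. exists (num x). split; [clos|]. exists (num y). split; [clos|].
    repeat split; auto; apply HA; now rewrite Nat.eqb_refl, ?orb_true_r.
  - apply (Listed_step _ _ [cd p]);
      [apply mono_Delta0Step| |apply (closed_cd D (Not p)); auto|].
    { intros e [<-|[]]; auto. }
    right; left. exists (cd p). split; [clos|]. simpl; auto.
  - apply (Listed_step _ _ [cd p; cd q]);
      [apply mono_Delta0Step| |apply (closed_cd D (Imp p q)); auto|].
    { intros e [<-|[<-|[]]]; [apply IHDelta0_1|apply IHDelta0_2]; intros v Hv; apply HA;
        rewrite Hv, ?orb_true_r; auto. }
    right; right; left. exists (cd p). split; [clos|]. exists (cd q). split; [clos|].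
    simpl; auto.
  - apply (Listed_step _ _ [cd p]);
      [apply mono_Delta0Step| |apply (closed_cd D (allIn x y p)); auto|].
    { intros e [<-|[]]; apply IHDelta0; intros v Hv; apply HA; rewrite Hv, ?orb_true_r; auto. }
    right; right; right. exists (num x). split; [clos|]. exists (num y). split; [clos|].
    exists (cd p). split; [clos|].
    repeat split; simpl; auto; try (apply HA; now rewrite Nat.eqb_refl, ?orb_true_r).
    intros E%num_inj. auto.
Qed.

Lemma IsSigma1_cd p : Sigma1 p -> IsSigma1 D (cd p).
Proof.
  intros (x & q & Hq & ->). exists (num x). split; [clos|]. exists (cd q). split; [clos|].
  split; [apply Nat_num|]. split; [|reflexivity]. apply IsDelta0_cd; auto. intros; apply Nat_num.
Qed.

Lemma IsKP_cd p : KP1 p -> IsKP D (cd p).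
Proof.
  intros H. unfold IsKP. destruct H; auto.
  - do 4 right; left. exists (cd p). split; [clos|]. split; [|split; [|reflexivity]].
    + apply IsDelta0_cd; auto. intros; apply Nat_num.
    + now apply IsFormWithout_cd.
  - do 5 right; left. exists (cd p). split; [clos|]. split; [|split; [|reflexivity]].
    + now apply IsSigma1_cd.
    + now apply IsFormWithout_cd.
  - do 6 right. exists (cd p). split; [clos|]. split; [|reflexivity].
    now apply IsFormWithout_cd.
Qed.

Lemma FreeIn_cd p t : D t -> (forall v, free v p = true -> num v ∊ t) -> FreeIn D (cd p) t.
Proof.
  intros Dt H. apply Listed_Built; [apply mono_FreeStep|].
  revert t Dt H. induction p; intros t Dt H; simpl in H;
    match goal with |- Listed _ (pr (cd ?q) _) => assert (Dc : D (pr (cd q) t)) by clos end.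
  - apply (Listed_step _ _ []); [apply mono_FreeStep|easy|auto|].
    exists (cd (Mem x y)). split; [clos|]. exists t. do 2 (split; auto).
    left. exists (num x). split; [|exists (num y); split; auto].
    all: apply H; now rewrite Nat.eqb_refl, ?orb_true_r.
  - apply (Listed_step _ _ []); [apply mono_FreeStep|easy|auto|].
    exists (cd (Eql x y)). split; [clos|]. exists t. do 2 (split; auto).
    left. exists (num x). split; [|exists (num y); split; auto].
    all: apply H; now rewrite Nat.eqb_refl, ?orb_true_r.
  - apply (Listed_step _ _ [pr (cd p) t]); [apply mono_FreeStep| |auto|].
    { intros e [<-|[]]. auto. }
    exists (cd (Not p)). split; [clos|]. exists t. do 2 (split; auto).
    right; left. exists (cd p). split; [clos|]. split; [|reflexivity].
    eexists. split; [|split; [left|]]; auto. clos.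
  - apply (Listed_step _ _ [pr (cd p1) t; pr (cd p2) t]); [apply mono_FreeStep| |auto|].
    { intros e [<-|[<-|[]]]; [apply IHp1|apply IHp2]; auto; intros v Hv; apply H;
        rewrite Hv, ?orb_true_r; auto. }
    exists (cd (Imp p1 p2)). split; [clos|]. exists t. do 2 (split; auto).
    right; right; left. exists (cd p1). split; [clos|]. exists (cd p2). split; [clos|].
    split; [|split; [|reflexivity]].
    + eexists. split; [|split; [left|]]; auto. clos.
    + eexists. split; [|split; [right; left|]]; auto. clos.
  - assert (Dt' : D (adj t (num x))) by (apply (closed_adj D); auto; clos).
    apply (Listed_step _ _ [pr (cd p) (adj t (num x))]); [apply mono_FreeStep| |auto|].
    { intros e [<-|[]]. apply IHp; auto. intros v Hv. apply adj_spec.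
      destruct (Nat.eq_dec v x) as [->|N]; auto. left. apply H. rewrite Hv, andb_true_r.
      apply negb_true_iff, Nat.eqb_neq. auto. }
    exists (cd (All x p)). split; [clos|]. exists t. do 2 (split; auto).
    right; right; right. exists (num x). split; [clos|]. exists (cd p). split; [clos|].
    exists (adj t (num x)). split; auto. split; [apply Nat_num|].
    split; [intros; apply adj_spec|]. split; [|reflexivity].
    eexists. split; [|split; [left|]]; auto. clos.
Qed.

Lemma IsUnary_cd p : unary p -> IsUnary D (cd p).
Proof.
  intros H. apply FreeIn_cd; [clos|]. intros v Hv. apply H in Hv. subst.
  apply num_spec. exists 0. auto.
Qed.

(** An actual proof is finite in the metatheory, so closure of [D] under adjunction suffices to
    contain it. This is what places actual proofs in the set [h] of a bound. *)
Lemma Provable_cd (T : theory) (A : M -> Prop) p :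
  (forall q, T q -> A (cd q)) -> Proves T p -> Provable D A (cd p).
Proof.
  intros HA H. apply Listed_Built; [apply mono_ProofStep|].
  induction H.
  1-11: apply (Listed_step _ _ []); [apply mono_ProofStep|easy|apply (closed_cd D); auto|].
  - right; left. auto.
  - left; left. exists (cd p). split; [clos|]. exists (cd q). split; [clos|].
    repeat split; auto using IsForm_cd.
  - left; right; left. exists (cd p). split; [clos|]. exists (cd q). split; [clos|].
    exists (cd r). split; [clos|]. repeat split; auto using IsForm_cd.
  - left; left. exists (cd p). split; [clos|]. exists (cd q). split; [clos|].
    repeat split; auto using IsForm_cd.
  - left; do 2 right; left. exists (num x). split; [clos|].
    exists (cd p). split; [clos|]. exists (cd q). split; [clos|].
    repeat split; auto using IsForm_cd; apply Nat_num.
  - left; do 3 right; left. exists (num x). split; [clos|].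
    exists (cd p). split; [clos|].
    repeat split; auto using IsForm_cd; apply Nat_num.
  - left; do 4 right; left. exists (num x). split; [clos|].
    exists (cd p). split; [clos|].
    split; [apply Nat_num|]. split; [now apply IsFormWithout_cd|reflexivity].
  - left; do 5 right; left. exists (num x). split; [clos|].
    exists (num y). split; [clos|]. split; [apply Nat_num|]. split; [apply Nat_num|reflexivity].
  - left; do 6 right. exists (num x). split; [clos|]. exists (num y). split; [clos|].
    exists (num z). split; [clos|]. do 3 (split; [apply Nat_num|]). left; reflexivity.
  - left; do 6 right. exists (num x). split; [clos|]. exists (num y). split; [clos|].
    exists (num z). split; [clos|]. do 3 (split; [apply Nat_num|]). right; left; reflexivity.
  - left; do 6 right. exists (num x). split; [clos|]. exists (num y). split; [clos|].
    exists (num z). split; [clos|]. do 3 (split; [apply Nat_num|]). right; right; reflexivity.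
  - apply (Listed_step _ _ [cd p; cd (Imp p q)]); [apply mono_ProofStep| |clos|].
    { intros e [<-|[<-|[]]]; auto. }
    right; right; left. exists (cd p). split; [clos|]. exists (cd (Imp p q)). split; [clos|].
    simpl; auto.
  - apply (Listed_step _ _ [cd p]); [apply mono_ProofStep| |apply (closed_cd D (All x p)); auto|].
    { intros e [<-|[]]; auto. }
    right; right; right. exists (num x). split; [clos|]. exists (cd p). split; [clos|].
    split; [apply Nat_num|]. simpl; auto.
Qed.
End Derivations.

(** ** Upward absoluteness *)

Section Upward.
Context (D1 D2 : M -> Prop) (H12 : forall x, D1 x -> D2 x) (DT : transitive_class D1).

(** The sequence lies in the transitive class [D1], and so do all its entries; passing to [D2]
    imposes the step condition on no new ones. *)
Lemma Built_up (S1 S2 : (M -> Prop) -> M -> Prop) c :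
  (forall ear e, S1 ear e -> S2 ear e) -> Built D1 S1 c -> Built D2 S2 c.
Proof.
  intros HS (n & Dn & s & Ds & Nn & Fs & K & H).
  exists n. split; auto. exists s. do 3 (split; auto). split; auto.
  intros i Hi e _ He. apply HS, K; auto.
  apply (DT _ _ Ds) in He. now apply (trans_pr D1) in He.
Qed.

Lemma IsFormIn_up (A1 A2 : M -> Prop) c : (forall x, A1 x -> A2 x) ->
  IsFormIn D1 A1 c -> IsFormIn D2 A2 c.
Proof.
  intros HA. apply Built_up. intros ear e. unfold FormStep. firstorder.
Qed.

Lemma IsDelta0_up (A1 A2 : M -> Prop) c : (forall x, A1 x -> A2 x) ->
  IsDelta0 D1 A1 c -> IsDelta0 D2 A2 c.
Proof.
  intros HA. apply Built_up. intros ear e. unfold Delta0Step. firstorder.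
Qed.

Lemma IsUnary_up c : IsUnary D1 c -> IsUnary D2 c.
Proof.
  apply Built_up. intros ear e (p & Dp & t & Dt & E & K). exists p. split; auto. exists t.
  do 2 (split; auto). destruct K as [K|[K|[K|K]]].
  - auto.
  - right; left. firstorder.
  - right; right; left. firstorder.
  - right; right; right. destruct K as (x & Dx & q & Dq & t' & Dt' & Nx & Ht' & K & E').
    exists x; split; auto. exists q; split; auto. exists t'. split; auto. split; auto.
    split; [|split; auto; firstorder].
    (* This is the one universal clause of the step. It is safe because t and t' lie in [D1], so
       their elements already do. *)
    intros y _. split.
    + intros Hy. apply Ht'; auto. eapply DT; [|exact Hy]. auto.
    + intros Hy. apply Ht'; auto. destruct Hy as [Hy| ->]; auto. eapply DT; [|exact Hy]. auto.
Qed.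

Lemma LogAx_up e : LogAx D1 e -> LogAx D2 e.
Proof.
  pose proof (IsFormIn_up Nat Nat) as HF.
  assert (HW : forall x c, IsFormWithout D1 x c -> IsFormWithout D2 x c).
  { intros x c. apply IsFormIn_up. auto. }
  unfold LogAx, IsForm.
  intros [K|[K|[K|[K|[K|[K|K]]]]]].
  - left. destruct K as (p & Dp & q & Dq & K1 & K2 & K). exists p. split; auto.
    exists q. auto 6.
  - right; left. destruct K as (p & Dp & q & Dq & r & Dr & K1 & K2 & K3 & K). exists p.
    split; auto. exists q. split; auto. exists r. auto 6.
  - do 2 right; left. destruct K as (x & Dx & p & Dp & q & Dq & Nx & K1 & K2 & K).
    exists x. split; auto. exists p. split; auto. exists q. auto 6.
  - do 3 right; left. destruct K as (x & Dx & p & Dp & Nx & K1 & K).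
    exists x. split; auto. exists p. auto 6.
  - do 4 right; left. destruct K as (x & Dx & p & Dp & Nx & K1 & K).
    exists x. split; auto. exists p. auto 6.
  - do 5 right; left. destruct K as (x & Dx & y & Dy & K).
    exists x. split; auto. exists y. auto 6.
  - do 6 right. destruct K as (x & Dx & y & Dy & z & Dz & K).
    exists x. split; auto. exists y. split; auto. exists z. auto 6.
Qed.

Lemma Provable_up (A1 A2 : M -> Prop) c : (forall x, A1 x -> A2 x) ->
  Provable D1 A1 c -> Provable D2 A2 c.
Proof.
  intros HA. apply Built_up. intros ear e [K|[K|[K|K]]].
  - left. now apply LogAx_up.
  - right; left; auto.
  - right; right; left. firstorder.
  - right; right; right. firstorder.
Qed.
End Upward.
End Standard.

(** * Δ₀-definability *)

Section Definability.
Context {M : structure}.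

(** [P x] is defined by a Δ₀-formula whose variable number [i] has the value
    [g x], where [g] is the [i]-th entry of [r]. *)
Definition D0 {X : Type} (r : list (X -> M)) (P : X -> Prop) : Prop :=
  exists p, Delta0 p /\ (forall v, free v p = true -> v < length r) /\
    forall x rho, (forall i g, nth_error r i = Some g -> rho i = g x) ->
      (holds Univ rho p <-> P x).

Definition Crd {X : Type} (r : list (X -> M)) (f : X -> M) : Prop :=
  exists i, nth_error r i = Some f.

(** The variable of a bounded quantifier is appended at the end and so gets the number [length r];
    the earlier coordinates keep their numbers. *)
Definition lift {X : Type} (r : list (X -> M)) : list (X * M -> M) :=
  map (fun g xa => g (fst xa)) r ++ [snd].

Context {X : Type} (r : list (X -> M)).
Implicit Types (P Q : X -> Prop) (f g h : X -> M).

Lemma D0_iff P Q : (forall x, P x <-> Q x) -> D0 r P -> D0 r Q.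
Proof.
  intros H (p & Hp & Hf & Hs). exists p. do 2 (split; auto).
  intros x rho Hr. now rewrite (Hs x rho Hr).
Qed.

Lemma D0_mem f g : Crd r f -> Crd r g -> D0 r (fun x => f x ∊ g x).
Proof.
  intros [i Hi] [j Hj]. exists (Mem i j). split; [constructor|]. split.
  - intros v H. simpl in H. apply orb_true_iff in H as [H|H]; apply Nat.eqb_eq in H; subst;
      apply nth_error_Some; congruence.
  - intros x rho Hr. simpl. now rewrite (Hr i f), (Hr j g).
Qed.

Lemma D0_eq f g : Crd r f -> Crd r g -> D0 r (fun x => f x = g x).
Proof.
  intros [i Hi] [j Hj]. exists (Eql i j). split; [constructor|]. split.
  - intros v H. simpl in H. apply orb_true_iff in H as [H|H]; apply Nat.eqb_eq in H; subst;
      apply nth_error_Some; congruence.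
  - intros x rho Hr. simpl. now rewrite (Hr i f), (Hr j g).
Qed.

Lemma D0_not P : D0 r P -> D0 r (fun x => ~ P x).
Proof.
  intros (p & Hp & Hf & Hs). exists (Not p). split; [now constructor|]. split; auto.
  intros x rho Hr. simpl. now rewrite (Hs x rho Hr).
Qed.

Lemma D0_imp P Q : D0 r P -> D0 r Q -> D0 r (fun x => P x -> Q x).
Proof.
  intros (p & Hp & Hf & Hs) (q & Hq & Hg & Ht). exists (Imp p q).
  split; [now constructor|]. split.
  - intros v H. simpl in H. apply orb_true_iff in H as []; auto.
  - intros x rho Hr. simpl. now rewrite (Hs x rho Hr), (Ht x rho Hr).
Qed.

Lemma D0_and P Q : D0 r P -> D0 r Q -> D0 r (fun x => P x /\ Q x).
Proof.
  intros HP HQ. apply (D0_iff (fun x => ~ (P x -> ~ Q x))). { intros; tauto. }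
  auto using D0_not, D0_imp.
Qed.

Lemma D0_or P Q : D0 r P -> D0 r Q -> D0 r (fun x => P x \/ Q x).
Proof.
  intros HP HQ. apply (D0_iff (fun x => ~ P x -> Q x)). { intros; tauto. }
  auto using D0_not, D0_imp.
Qed.

Lemma D0_equiv P Q : D0 r P -> D0 r Q -> D0 r (fun x => P x <-> Q x).
Proof. intros HP HQ. apply D0_and; auto using D0_imp. Qed.

Lemma D0_ball f (P : X -> M -> Prop) : Crd r f ->
  D0 (lift r) (fun xa => P (fst xa) (snd xa)) ->
  D0 r (fun x => forall a, a ∊ f x -> P x a).
Proof.
  intros [j Hj] (p & Hp & Hf & Hs). set (k := length r).
  assert (Hjk : j < k) by (apply nth_error_Some; congruence).
  exists (allIn k j p). split; [apply D0_ball; auto; lia|]. split.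
  - intros v H. simpl in H. apply andb_true_iff in H as [H1 H2].
    apply negb_true_iff, Nat.eqb_neq in H1.
    rewrite !orb_true_iff, !Nat.eqb_eq in H2. destruct H2 as [[H2|H2]|H2]; try lia.
    apply Hf in H2. unfold lift in H2. rewrite length_app, length_map in H2.
    simpl in H2. fold k in H2 |- *. lia.
  - intros x rho Hr.
    assert (E : forall a, holds Univ (upd rho k a) p <-> P x a).
    { intros a. apply (Hs (x, a)). intros i g Hi. unfold lift in Hi.
      destruct (lt_eq_lt_dec i k) as [[L|L]|L].
      - rewrite nth_error_app1 in Hi by now rewrite length_map.
        rewrite nth_error_map in Hi. destruct (nth_error r i) as [g'|] eqn:E; [|easy].
        injection Hi as <-. rewrite upd_other by lia. now apply Hr.
      - subst i. rewrite nth_error_app2 in Hi by (rewrite length_map; auto).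
        rewrite length_map, Nat.sub_diag in Hi. injection Hi as <-. apply upd_same.
      - assert (i < length (map (fun g (xa : X * M) => g (fst xa)) r ++ [snd]))
          by (apply nth_error_Some; congruence).
        rewrite length_app, length_map in H. simpl in H. fold k in H. lia. }
    simpl. unfold Univ. rewrite <- (Hr j f Hj).
    split; intros K a Ha.
    + apply E. apply K; auto. now rewrite upd_same, upd_other by lia.
    + rewrite upd_same, upd_other by lia. intros H. apply E; auto.
Qed.

(** Lets a given Δ₀-formula enter as an atom: the renaming places its free variables at the right
    coordinates and moves the bound ones injectively out of their way. *)
Lemma D0_formula (p : form) (f : nat -> nat) (g : nat -> X -> M) :
  Delta0 p -> (forall x y, f x = f y -> x = y) ->
  (forall v, free v p = true -> nth_error r (f v) = Some (g v)) ->
  D0 r (fun x => holds Univ (fun v => g v x) p).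
Proof.
  intros Hp Hf Hg. exists (rename f p). split; [now apply Delta0_rename|]. split.
  - intros v H. apply free_rename in H as (w & -> & Hw); [|now apply inj_on_inj].
    apply nth_error_Some. rewrite (Hg w Hw). discriminate.
  - intros x rho Hr. rewrite holds_rename by now apply inj_on_inj.
    apply holds_ext. intros v Hv. apply Hr, Hg, Hv.
Qed.
End Definability.

Lemma D0_bex {M : structure} {X : Type} (r : list (X -> M)) f (P : X -> M -> Prop) : Crd r f ->
  D0 (lift r) (fun xa => P (fst xa) (snd xa)) ->
  D0 r (fun x => exists a, a ∊ f x /\ P x a).
Proof.
  intros Hf HP. apply (D0_iff r (fun x => ~ forall a, a ∊ f x -> ~ P x a)).
  { intros x. split; [|firstorder]. intros H. apply NNPP. intros N. apply H.
    intros a Ha Pa. eauto. }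
  apply D0_not, D0_ball; auto. now apply D0_not in HP.
Qed.


Lemma Crd_lift {M : structure} {X : Type} (r : list (X -> M)) (f : X -> M) :
  Crd r f -> Crd (lift r) (fun xa => f (fst xa)).
Proof.
  intros [i Hi]. exists i. unfold lift. rewrite nth_error_app1.
  - now rewrite nth_error_map, Hi.
  - rewrite length_map. apply nth_error_Some. congruence.
Qed.

Lemma Crd_last {M : structure} {X : Type} (r : list (X -> M)) :
  Crd (lift r) (fun xa => snd xa).
Proof.
  exists (length r). unfold lift.
  now rewrite nth_error_app2, length_map, Nat.sub_diag by (rewrite length_map; auto).
Qed.

Ltac crd :=
  lazymatch goal with
  | |- Crd (lift ?r) (fun xa => snd xa) => apply Crd_last
  | |- Crd (lift ?r) snd => apply Crd_last
  | |- Crd (lift ?r) ?F =>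
      let G := eval cbn [fst snd] in (fun y a => F (y, a)) in
      lazymatch G with
      | (fun y a => @?g y) => apply (Crd_lift r g); crd
      end
  | |- _ => first [assumption
    | exists 0; reflexivity | exists 1; reflexivity | exists 2; reflexivity
    | exists 3; reflexivity | exists 4; reflexivity | exists 5; reflexivity
    | exists 6; reflexivity | exists 7; reflexivity | exists 8; reflexivity
    | exists 9; reflexivity | exists 10; reflexivity]
  end.

Ltac d0_leaf := fail.
Ltac d0_step :=
  lazymatch goal with
  | |- D0 _ (fun x => _ /\ _) => apply D0_and
  | |- D0 _ (fun x => _ \/ _) => apply D0_or
  | |- D0 _ (fun x => _ <-> _) => apply D0_equiv
  | |- D0 _ (fun x => ~ _) => apply D0_not
  | |- D0 _ (fun x => forall a, a ∊ @?f x -> @?P x a) => apply (D0_ball _ f P); [crd|]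
  | |- D0 _ (fun x => exists a, a ∊ @?f x /\ @?P x a) => apply (D0_bex _ f P); [crd|]
  | |- D0 _ (fun x => @?f x ∊ @?g x) => apply (D0_mem _ f g); crd
  | |- D0 _ _ => first [d0_leaf]
  end.
Ltac d0 := repeat (cbv beta; d0_step).
Ltac d0_end := lazymatch goal with
  | |- D0 _ (fun x => @?P x -> @?Q x) => apply D0_imp
  | |- D0 _ (fun x => @?f x = @?g x) => apply (D0_eq _ f g); crd
  end.
Ltac d0_leaf ::= d0_end.

(** * Δ₀-definability of pairs, functions and natural numbers *)

Section SetDefinability.
Context {M : structure} {SM : SetModel M}.

Lemma D0_emp {X} (r : list (X -> M)) f : Crd r f -> D0 r (fun x => f x = emp).
Proof.
  intros Hf. apply (D0_iff r (fun x => forall a, a ∊ f x -> ~ a = a)).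
  - intros x. split.
    + intros H. apply ext. intros z. split; intros K; [now destruct (H z K)|].
      now apply emp_spec in K.
    + intros -> a Ha. now apply emp_spec in Ha.
  - d0.
Qed.

Lemma D0_adj {X} (r : list (X -> M)) f g h : Crd r f -> Crd r g -> Crd r h ->
  D0 r (fun x => f x = adj (g x) (h x)).
Proof.
  intros Hf Hg Hh. apply (D0_iff r (fun x => (forall a, a ∊ f x -> a ∊ g x \/ a = h x) /\
    (forall a, a ∊ g x -> a ∊ f x) /\ h x ∊ f x)).
  - intros x. split.
    + intros (H1 & H2 & H3). apply ext. intros z. rewrite adj_spec. split; auto.
      intros [K| ->]; auto.
    + intros ->. repeat split; intros; rewrite ?adj_spec in *; auto.
  - d0.
Qed.

Lemma D0_suc {X} (r : list (X -> M)) f g : Crd r f -> Crd r g ->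
  D0 r (fun x => f x = suc (g x)).
Proof. intros. now apply D0_adj. Qed.

Lemma D0_upair {X} (r : list (X -> M)) f g h : Crd r f -> Crd r g -> Crd r h ->
  D0 r (fun x => f x = upair (g x) (h x)).
Proof.
  intros Hf Hg Hh. apply (D0_iff r (fun x => (forall a, a ∊ f x -> a = g x \/ a = h x) /\
    g x ∊ f x /\ h x ∊ f x)).
  - intros x. split.
    + intros (H1 & H2 & H3). apply ext. intros z. rewrite upair_spec. split; auto.
      intros [->| ->]; auto.
    + intros ->. repeat split; intros; rewrite ?upair_spec in *; auto.
  - d0.
Qed.
End SetDefinability.

Ltac d0_end1 := lazymatch goal with
  | |- D0 _ (fun x => @?f x = emp) => apply (D0_emp _ f); crd
  | |- D0 _ (fun x => @?f x = adj (@?g x) (@?h x)) => apply (D0_adj _ f g h); crd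
  | |- D0 _ (fun x => @?f x = suc (@?g x)) => apply (D0_suc _ f g); crd
  | |- D0 _ (fun x => @?f x = upair (@?g x) (@?h x)) => apply (D0_upair _ f g h); crd
  | |- _ => d0_end
  end.
Ltac d0_leaf ::= d0_end1.

Section SetDefinability1.
Context {M : structure} {SM : SetModel M}.

Lemma D0_pr {X} (r : list (X -> M)) f g h : Crd r f -> Crd r g -> Crd r h ->
  D0 r (fun x => f x = pr (g x) (h x)).
Proof.
  intros Hf Hg Hh. apply (D0_iff r (fun x => exists u, u ∊ f x /\ exists v, v ∊ f x /\
    u = upair (g x) (g x) /\ v = upair (g x) (h x) /\ f x = upair u v)).
  - intros x. split.
    + intros (u & _ & v & _ & -> & -> & E). exact E.
    + intros ->. eexists. split; [apply upair_spec; now left|].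
      eexists. split; [apply upair_spec; now right|]. auto.
  - d0.
Qed.

(** Both components of a pair belong to its element {a,b}, so quantifying over them is bounded. That
    element and the two components account for the three lifts. *)
Lemma D0_expair {X} (r : list (X -> M)) f (P : X -> M -> M -> Prop) : Crd r f ->
  D0 (lift (lift (lift r))) (fun xab => P (fst (fst (fst xab))) (snd (fst xab)) (snd xab)) ->
  D0 r (fun x => exists a b, f x = pr a b /\ P x a b).
Proof.
  intros Hf HP.
  apply (D0_iff r (fun x => exists w, w ∊ f x /\ exists a, a ∊ w /\ exists b, b ∊ w /\
    f x = pr a b /\ P x a b)).
  - intros x. split.
    + intros (w & _ & a & _ & b & _ & H). eauto.
    + intros (a & b & E & H). exists (upair a b). rewrite E. unfold pr at 1.
      split; [apply upair_spec; now right|]. exists a. split; [apply upair_spec; now left|].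
      exists b. split; [apply upair_spec; now right|]. auto.
  - d0; [apply D0_pr; crd|exact HP].
Qed.

Lemma D0_App {X} (r : list (X -> M)) f g h : Crd r f -> Crd r g -> Crd r h ->
  D0 r (fun x => App (f x) (g x) (h x)).
Proof.
  intros Hf Hg Hh. apply (D0_iff r (fun x => exists p, p ∊ f x /\ p = pr (g x) (h x))).
  - intros x. unfold App. split; [now intros (p & Hp & <-)|eauto].
  - d0. apply D0_pr; crd.
Qed.

(** The value is the second component of some pair in the function: one lift for the pair and three
    for opening it. *)
Lemma D0_exApp {X} (r : list (X -> M)) f g (P : X -> M -> Prop) : Crd r f -> Crd r g ->
  D0 (lift (lift (lift (lift r)))) (fun xa => P (fst (fst (fst (fst xa)))) (snd xa)) ->
  D0 r (fun x => exists y, App (f x) (g x) y /\ P x y).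
Proof.
  intros Hf Hg HP.
  apply (D0_iff r (fun x => exists p, p ∊ f x /\ exists a b, p = pr a b /\ a = g x /\ P x b)).
  - intros x. unfold App. split.
    + intros (p & Hp & a & b & -> & -> & H). eauto.
    + intros (y & Hy & H). eexists. split; [exact Hy|]. eauto.
  - d0. apply (D0_expair _ (fun xa => snd xa) (fun xa a b => a = g (fst xa) /\ P (fst xa) b)); d0; crd || exact HP.
Qed.

Lemma D0_allApp {X} (r : list (X -> M)) f g (P : X -> M -> Prop) : Crd r f -> Crd r g ->
  D0 (lift (lift (lift (lift r)))) (fun xa => P (fst (fst (fst (fst xa)))) (snd xa)) ->
  D0 r (fun x => forall y, App (f x) (g x) y -> P x y).
Proof.
  intros Hf Hg HP.
  apply (D0_iff r (fun x => ~ exists y, App (f x) (g x) y /\ ~ P x y)).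
  - intros x. split; [|firstorder]. intros H y Hy. apply NNPP. eauto.
  - apply D0_not, D0_exApp; auto. d0. exact HP.
Qed.

Lemma D0_num {X} (r : list (X -> M)) k f : Crd r f -> D0 r (fun x => f x = num k).
Proof.
  revert X r f. induction k as [|k IH]; intros X r f Hf.
  - now apply D0_emp.
  - apply (D0_iff r (fun x => exists y, y ∊ f x /\ y = num k /\ f x = suc y)).
    + intros x. cbn [num]. split; [now intros (y & _ & -> & ->)|].
      intros ->. exists (num k). split; auto. apply suc_spec. auto.
    + d0. apply IH. crd.
Qed.

Lemma D0_Trans {X} (r : list (X -> M)) f : Crd r f -> D0 r (fun x => Trans (f x)).
Proof. intros Hf. unfold Trans. d0. Qed.
End SetDefinability1.

Ltac d0_end2 := lazymatch goal with
  | |- D0 _ (fun x => @?f x = pr (@?g x) (@?h x)) => apply (D0_pr _ f g h); crd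
  | |- D0 _ (fun x => App (@?f x) (@?g x) (@?h x)) => apply (D0_App _ f g h); crd
  | |- D0 _ (fun x => exists a b, @?f x = pr a b /\ @?P x a b) =>
      apply (D0_expair _ f P); [crd|]
  | |- D0 _ (fun x => exists y, App (@?f x) (@?g x) y /\ @?P x y) =>
      apply (D0_exApp _ f g P); [crd|crd|]
  | |- D0 _ (fun x => forall y, App (@?f x) (@?g x) y -> @?P x y) =>
      apply (D0_allApp _ f g P); [crd|crd|]
  | |- D0 _ (fun x => @?f x = num ?k) => apply (D0_num _ k f); crd
  | |- D0 _ (fun x => Trans (@?f x)) => apply (D0_Trans _ f); crd
  | |- _ => d0_end1
  end.
Ltac d0_leaf ::= d0_end2.

Section SetDefinability2.
Context {M : structure} {SM : SetModel M}.

Lemma D0_Nat {X} (r : list (X -> M)) f : Crd r f -> D0 r (fun x => Nat (f x)).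
Proof.
  intros Hf. apply (D0_iff r (fun x => (Trans (f x) /\ forall y, y ∊ f x -> Trans y) /\
    (f x = emp \/ exists k, k ∊ f x /\ f x = suc k) /\
    (forall m, m ∊ f x -> m = emp \/ exists k, k ∊ f x /\ m = suc k))).
  - intros x. unfold Nat, Ord. split; intros (H1 & H2); split; auto.
    destruct H2 as [H2 H3]. intros m [Hm| ->]; auto.
  - d0.
Qed.

Lemma D0_Fun {X} (r : list (X -> M)) f g : Crd r f -> Crd r g ->
  D0 r (fun x => Fun (f x) (g x)).
Proof.
  intros Hf Hg. apply (D0_iff r (fun x =>
    (forall p, p ∊ f x -> exists a b, p = pr a b /\ a ∊ g x) /\
    (forall a, a ∊ g x -> exists y, App (f x) a y /\ y = y) /\
    (forall a, a ∊ g x -> forall y, App (f x) a y -> forall z, App (f x) a z -> y = z))).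
  - intros x. unfold Fun. split; intros (H1 & H2 & H3); repeat split.
    + intros p Hp. destruct (H1 p Hp) as (a & b & E & Ha). eauto.
    + intros a Ha. destruct (H2 a Ha) as [y [Hy _]]. eauto.
    + eauto.
    + intros p Hp. destruct (H1 p Hp) as (a & Ha & b & E). eauto.
    + intros a Ha. destruct (H2 a Ha) as [y Hy]. eauto.
    + eauto.
  - d0.
Qed.
End SetDefinability2.

Ltac d0_end3 := lazymatch goal with
  | |- D0 _ (fun x => Nat (@?f x)) => apply (D0_Nat _ f); crd
  | |- D0 _ (fun x => Fun (@?f x) (@?g x)) => apply (D0_Fun _ f g); crd
  | |- _ => d0_end2
  end.
Ltac d0_leaf ::= d0_end3.

(** * Transitive classes satisfying [KP1] *)

Definition satisfies {M : structure} (D : M -> Prop) (T : theory) : Prop :=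
  forall p, T p -> forall rho, (forall v, D (rho v)) -> holds D rho p.

Lemma SetModel_exists (M : structure) : M -> @satisfies M Univ KP1 -> exists _ : SetModel M, True.
Proof.
  intros o H.
  assert (DT : transitive_class (@Univ M)) by easy.
  pose (rho := fun _ : nat => o).
  assert (He : env (@Univ M) 0 rho) by easy.
  assert (Hr : forall v, Univ (rho v)) by easy.
  pose proof (H _ KP1_ext rho Hr) as E1.
  assert (K1 : forall x : M, Univ x -> forall y, Univ y ->
     (forall z, Univ z -> (z ∊ x <-> z ∊ y)) -> x = y).
  { refine (proj1 (den_all (@Univ M) rho 0 _ _ He _) E1). intros. unfold rho in *. den. }
  pose proof (H _ KP1_union rho Hr) as E2.
  assert (K2 : forall x : M, Univ x -> exists y, Univ y /\ forall z, Univ z ->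
     (z ∊ y <-> exists w, w ∊ x /\ z ∊ w)).
  { refine (proj1 (den_all (@Univ M) rho 0 _ _ He _) E2). intros. unfold rho in *. den. }
  pose proof (H _ KP1_pairing rho Hr) as E3.
  assert (K3 : forall x : M, Univ x -> forall y, Univ y -> exists z, Univ z /\ forall w, Univ w ->
     (w ∊ z <-> w = x \/ w = y)).
  { refine (proj1 (den_all (@Univ M) rho 0 _ _ He _) E3). intros. unfold rho in *. den. }
  pose proof (H _ KP1_infinity rho Hr) as E4.
  (* The axiom of infinity is the source of the empty set. *)
  assert (K4 : exists x : M, forall y, ~ y ∊ x).
  { apply NNPP. intros N. simpl in E4. apply E4. intros a _ K. apply K.
    intros L. exfalso. apply L. intros b _ _ Hb. apply N. exists b.
    intros c. specialize (Hb c I). now rewrite !upd_same in Hb. }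
  unfold Univ in *.
  assert (K5 : forall x y : M, exists z, forall w, w ∊ z <-> w ∊ x \/ w = y).
  { intros x y. destruct (K3 y I y I) as (s & _ & Hs), (K3 x I s I) as (t & _ & Ht),
      (K2 t I) as (u & _ & Hu).
    exists u. intros w. rewrite (Hu w I). split.
    - intros (v & Hv & Hw). apply (Ht v I) in Hv as [->| ->]; auto.
      apply (Hs w I) in Hw. tauto.
    - intros [Hw| ->].
      + exists x. split; auto. apply Ht; auto.
      + exists s. split; [apply Ht|apply Hs]; auto. }
  destruct K4 as [e He'].
  unshelve eexists; auto. refine {| emp := e;
    adj := fun x y => proj1_sig (constructive_indefinite_description _ (K5 x y)) |}.
  - intros x y K. apply K1; auto.
  - exact He'.
  - intros x y z. destruct constructive_indefinite_description as [w Hw]. apply Hw.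
Qed.

Definition consts {M : structure} {X : Type} (cs : list M) : list (X -> M) :=
  map (fun c _ => c) cs.

(** The axioms in semantic form, for properties that are Δ₀ in parameters [cs] from [D]: collection
    for a Δ₀-matrix and induction for Σ₁-properties. It is applied both to the universe of a model
    and to L_α inside it. *)
Record KPclass {M : structure} {SM : SetModel M} (D : M -> Prop) : Prop := {
  kp_trans : transitive_class D;
  kp_closed : closed D;
  kp_union : forall a, D a -> exists b, D b /\ forall z, z ∊ b <-> exists w, w ∊ a /\ z ∊ w;
  kp_inf : exists w, D w /\ emp ∊ w /\ forall x, x ∊ w -> suc x ∊ w;
  kp_sep : forall cs (P : M -> Prop) a, Forall D cs -> D a ->
    D0 ((fun x => x) :: consts cs) P ->
    exists b, D b /\ forall x, x ∊ b <-> x ∊ a /\ P x;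
  kp_coll : forall cs (P : M -> M -> Prop) a, Forall D cs -> D a ->
    D0 (fst :: snd :: consts cs) (fun xy => P (fst xy) (snd xy)) ->
    (forall x, x ∊ a -> exists y, D y /\ P x y) ->
    exists b, D b /\ forall x, x ∊ a -> exists y, y ∊ b /\ P x y;
  kp_ind : forall cs (P : M -> M -> Prop), Forall D cs ->
    D0 (fst :: snd :: consts cs) (fun xy => P (fst xy) (snd xy)) ->
    (forall x, D x -> (forall y, y ∊ x -> exists w, D w /\ P y w) -> exists w, D w /\ P x w) ->
    forall x, D x -> exists w, D w /\ P x w }.

Section MakeKP.
Context {M : structure} {SM : SetModel M} (D : M -> Prop) (DT : transitive_class D).

(** The axiom schemes reserve some small variable numbers, such as 2 for the set asserted by
    separation; [s] moves the coordinates so that these stay free. *)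
Lemma D0_spread {X : Type} (r : list (X -> M)) (P : X -> Prop) (s : nat -> nat) :
  (forall x y, s x = s y -> x = y) -> D0 r P ->
  exists p, Delta0 p /\ (forall v, (forall i, s i <> v) -> occurs v p = false) /\
    forall x rho, (forall i g, nth_error r i = Some g -> rho (s i) = g x /\ D (g x)) ->
      (holds D rho p <-> P x).
Proof.
  intros Hs (p & Hp & Hf & Hr). exists (rename s p). split; [now apply Delta0_rename|].
  split; [intros; now apply occurs_rename_false|].
  intros x rho H.
  assert (K : forall i, i < length r -> exists g, nth_error r i = Some g).
  { intros i Hi. destruct (nth_error r i) eqn:E; eauto. apply nth_error_None in E. lia. }
  rewrite Delta0_absolute; auto using Delta0_rename.
  - rewrite holds_rename by now apply inj_on_inj. apply Hr. intros i g Hi. now apply H.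
  - intros v (w & -> & Hw)%free_rename; [|now apply inj_on_inj].
    destruct (K w (Hf w Hw)) as [g Hg]. destruct (H w g Hg) as [E Dg]. now rewrite E.
Qed.

Lemma nth_consts {X} (cs : list M) (g : X -> M) i x : Forall D cs ->
  nth_error (consts cs) i = Some g -> nth i cs emp = g x /\ D (g x).
Proof.
  unfold consts. intros Hc. rewrite nth_error_map. destruct (nth_error cs i) as [c|] eqn:E; [|easy].
  intros H. injection H as <-. split; [now apply nth_error_nth|].
  apply nth_error_In in E. rewrite Forall_forall in Hc. auto.
Qed.

Lemma KPclass_intro (o : M) : D o -> satisfies D KP1 -> KPclass D.
Proof.
  intros Do H.
  pose (rho0 := fun _ : nat => o).
  assert (He : env D 0 rho0) by (intros v; lia).
  assert (Hr0 : forall v, D (rho0 v)) by easy.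
  pose proof (H _ KP1_union rho0 Hr0) as E2.
  assert (K2 : forall x, D x -> exists y, D y /\ forall z, D z ->
     (z ∊ y <-> exists w, w ∊ x /\ z ∊ w)).
  { refine (proj1 (den_all D rho0 0 _ _ He _) E2). intros. unfold rho0 in *. den. }
  pose proof (H _ KP1_pairing rho0 Hr0) as E3.
  assert (K3 : forall x, D x -> forall y, D y -> exists z, D z /\ forall w, D w ->
     (w ∊ z <-> w = x \/ w = y)).
  { refine (proj1 (den_all D rho0 0 _ _ He _) E3). intros. unfold rho0 in *. den. }
  pose proof (H _ KP1_infinity rho0 Hr0) as E4.
  assert (K4 : exists w, D w /\ (exists x, x ∊ w /\ x = emp) /\
    forall x, x ∊ w -> exists y, y ∊ w /\ y = suc x).
  { refine (proj1 (den_ex D rho0 0 _ _ He _) E4). intros. unfold rho0 in *. den. }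
  clear E2 E3 E4.
  assert (U : forall a, D a -> exists b, D b /\ forall z, z ∊ b <-> exists w, w ∊ a /\ z ∊ w).
  { intros a Da. destruct (K2 a Da) as (b & Db & Hb). exists b. split; auto. intros z. split.
    - intros Hz. apply Hb; auto. eapply DT; [exact Db|auto].
    - intros (w & Hw & Hz). apply Hb; eauto. }
  assert (C1 : forall x y, D x -> D y -> D (upair x y)).
  { intros x y Dx Dy. destruct (K3 x Dx y Dy) as (z & Dz & Hz).
    replace (upair x y) with z; auto. apply ext. intros w. rewrite upair_spec. split.
    - intros Hw. apply Hz; auto. eapply DT; [exact Dz|auto].
    - intros Hw. apply Hz; auto. destruct Hw as [->| ->]; auto. }
  assert (C : closed D).
  { split.
    - destruct K4 as (w & Dw & (x & Hx & ->) & _). eapply DT; eauto.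
    - intros x y Dx Dy. destruct (U (upair x (upair y y))) as (b & Db & Hb); auto.
      replace (adj x y) with b; auto. apply ext. intros z. rewrite Hb, adj_spec. split.
      + intros (w & Hw & Hz). apply upair_spec in Hw as [->| ->]; auto.
        apply upair_spec in Hz. tauto.
      + intros [Hz| ->].
        * exists x. split; auto. apply upair_spec; auto.
        * exists (upair y y). split; apply upair_spec; auto. }
  assert (De : D emp) by now apply (closed_emp D).
  split; auto.
  - destruct K4 as (w & Dw & (x & Hx & ->) & Hs). exists w. repeat split; auto.
    intros x Hx'. destruct (Hs x Hx') as (y & Hy & ->). auto.
  - intros cs P a Hc Da HP.
    destruct (D0_spread _ _ (fun v => match v with 0 => 0 | S v => S (S (S v)) end)
      ltac:(intros [] []; lia) HP) as (p & Hp & Ho & Hs).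
    specialize (H (ax_sep p)). unfold satisfies in H.
    specialize (H (KP1_sep p Hp ltac:(apply Ho; intros []; lia))
      (fun v => match v with 0 => emp | 1 => a | 2 => emp | S (S (S v)) => nth v cs emp end)).
    apply NNPP. intros N. refine (H _ _); clear H.
    + intros [|[|[|v]]]; auto. destruct (nth_in_or_default v cs emp) as [K| ->]; auto.
      rewrite Forall_forall in Hc; auto.
    + intros b Db K. apply N. exists b. split; auto.
      assert (L : forall x, D x -> (x ∊ b <-> x ∊ a /\ P x)).
      { intros x Dx. specialize (K x Dx). simpl in K.
        rewrite (Hs x) in K. { apply NNPP. tauto. }
        intros [|i] g Hi; simpl in Hi.
        - injection Hi as <-. auto.
        - simpl. now apply nth_consts with (x := x) in Hi. }
      intros x. split; intros Hx.
      * apply L; auto. eapply DT; [exact Db|auto].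
      * apply L; auto. eapply DT; [exact Da|tauto].
  - intros cs P a Hc Da HP K.
    destruct (D0_spread _ _ (fun v => match v with 0 => 0 | 1 => 1 | S (S v) => S (S (S (S v))) end)
      ltac:(intros [|[]] [|[]]; lia) HP) as (p & Hp & Ho & Hs).
    (* The scheme asks for a formula beginning with an existential quantifier, so the Δ₀-matrix gets
       a vacuous one, over a variable that does not occur in it and is none of the reserved ones. *)
    set (k := 4 + fresh p).
    specialize (H (ax_coll (ex k p)) (KP1_coll (ex k p)
      ltac:(exists k, p; auto)
      ltac:(cbn -[Nat.eqb k]; rewrite Ho by (intros [|[]]; lia);
            rewrite orb_false_r; apply Nat.eqb_neq; lia))
      (fun v => match v with 0 | 1 | 3 => emp | 2 => a | S (S (S (S v))) => nth v cs emp end)).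
    set (rho := (fun v => match v with 0 | 1 | 3 => emp | 2 => a | S (S (S (S v))) => nth v cs emp end)) in H.
    assert (Hr : forall v, D (rho v)).
    { intros [|[|[|[|v]]]]; simpl; auto. destruct (nth_in_or_default v cs emp) as [L| ->]; auto.
      rewrite Forall_forall in Hc; auto. }
    assert (A : forall sigma x y, D x -> D y -> sigma 0 = x -> sigma 1 = y ->
       (forall v, 3 < v -> v <> k -> sigma v = rho v) ->
       (holds D sigma p <-> P x y)).
    { intros sigma x y Dx Dy E0 E1 Hv.
      rewrite (holds_ext D p sigma (upd (upd rho 0 x) 1 y)).
      - apply (Hs (x, y)). intros [|[|i]] g Hi; simpl in Hi.
        + injection Hi as <-. auto.
        + injection Hi as <-. auto.
        + simpl. now apply nth_consts with (x := (x, y)) in Hi.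
      - intros v Fv. pose proof (free_fresh _ _ Fv). apply free_occurs in Fv.
        unfold upd. destruct v as [|[|[|[|v]]]]; simpl; auto.
        + rewrite Ho in Fv by (intros [|[]]; lia). easy.
        + rewrite Ho in Fv by (intros [|[]]; lia). easy.
        + apply Hv; lia. }
    assert (A' : forall sigma x y, D x -> D y -> sigma 0 = x -> sigma 1 = y ->
       (forall v, 3 < v -> v <> k -> sigma v = rho v) ->
       (holds D sigma (ex k p) <-> P x y)).
    { intros sigma x y Dx Dy E0 E1 Hv. split.
      - intros L. apply NNPP. intros N. apply L. intros c Dc Q. apply N.
        revert Q. apply -> A; auto; try (now rewrite upd_other by lia).
        intros v Lv Nv. rewrite upd_other by lia. auto.
      - intros Q L. apply (L emp De). apply (A _ x y); auto; try (now rewrite upd_other by lia).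
        intros v Lv Nv. rewrite upd_other by lia. auto. }
    specialize (H Hr). clear Ho Hs Hp.
    clear A. generalize dependent (ex k p). intros q H A'.
    apply NNPP. intros N. cbn [ax_coll allIn exIn Defs.ex imp all neg mem nm form_syntax holds] in H.
    refine (H _ _); clear H.
    + intros x Dx Hx L. rewrite upd_same, upd_other in Hx by lia.
      destruct (K x Hx) as (y & Dy & Pxy). apply (L y Dy).
      apply (A' _ x y); auto.
      intros v Lv Nv. rewrite !upd_other by lia. auto.
    + intros b Db L. apply N. exists b. split; auto. intros x Hx.
      assert (Dx : D x) by (eapply DT; [exact Da|auto]).
      apply NNPP. intros N'. refine (L x Dx _ _); clear L.
      * rewrite upd_same, !upd_other by lia. auto.
      * intros y Dy Hy Q. apply N'. exists y.
        rewrite upd_same, !upd_other, upd_same in Hy by lia. split; auto.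
        apply -> A'; [exact Q| | | | |]; auto.
        intros v Lv Nv. rewrite !upd_other by lia. auto.
  - intros cs P Hc HP K.
    destruct (D0_spread _ _ (fun v => match v with 0 => 0 | S v => S (S v) end)
      ltac:(intros [] []; lia) HP) as (p & Hp & Ho & Hs).
    specialize (H (ax_ind (ex 2 p)) (KP1_foundation (ex 2 p)
      ltac:(left; exists 2, p; auto)
      ltac:(cbn -[Nat.eqb]; rewrite Ho by (intros []; lia); easy))
      (fun v => match v with 0 | 1 | 2 => emp | S (S (S v)) => nth v cs emp end)).
    set (rho := (fun v => match v with 0 | 1 | 2 => emp | S (S (S v)) => nth v cs emp end)) in H.
    assert (Hr : forall v, D (rho v)).
    { intros [|[|[|v]]]; simpl; auto. destruct (nth_in_or_default v cs emp) as [L| ->]; auto.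
      rewrite Forall_forall in Hc; auto. }
    assert (A : forall sigma x, D x -> sigma 0 = x ->
       (forall v, 2 < v -> sigma v = rho v) ->
       (holds D sigma (ex 2 p) <-> exists w, D w /\ P x w)).
    { intros sigma x Dx E0 Hv.
      assert (B : forall y, D y -> (holds D (upd sigma 2 y) p <-> P x y)).
      { intros y Dy. rewrite (holds_ext D p _ (upd (upd rho 0 x) 2 y)).
        - apply (Hs (x, y)). intros [|[|i]] g Hi; simpl in Hi.
          + injection Hi as <-. auto.
          + injection Hi as <-. auto.
          + simpl. now apply nth_consts with (x := (x, y)) in Hi.
        - intros v Fv. apply free_occurs in Fv.
          unfold upd. destruct v as [|[|[|v]]]; simpl; auto.
          + rewrite Ho in Fv by (intros []; lia). easy.
          + apply Hv; lia. }
      simpl. split.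
      - intros L. apply NNPP. intros N. apply L. intros y Dy Q. apply N. exists y.
        split; auto. now apply B.
      - intros (y & Dy & Q) L. apply (L y Dy). now apply B. }
    specialize (H Hr). clear Ho Hs Hp.
    generalize dependent (ex 2 p). intros q H A.
    cbn [ax_ind allIn imp all eql mem nm form_syntax holds] in H.
    intros x Dx. apply (A (upd rho 0 x) x); auto.
    { intros v Hv. now rewrite upd_other by lia. }
    apply H; auto. clear x Dx. intros x Dx IH.
    apply (A (upd rho 0 x) x); auto.
    { intros v Hv. now rewrite upd_other by lia. }
    apply K; auto. intros y Hy. assert (Dy : D y) by (eapply DT; [exact Dx|auto]).
    specialize (IH y Dy). rewrite upd_same, upd_other, upd_same in IH by lia.
    specialize (IH Hy y Dy). rewrite upd_same, upd_other, upd_same in IH by lia.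
    apply -> (A (upd (upd (upd rho 0 x) 1 y) 0 y) y); auto.
    intros v Hv. now rewrite !upd_other by lia.
Qed.
End MakeKP.

(** * Elementary set theory *)

Section Elementary.
Context {M : structure} {SM : SetModel M}.
Implicit Types x y z m n k a b t : M.

Lemma Nat_emp : Nat emp.
Proof.
  split; [split|].
  - now intros y H%emp_spec.
  - now intros y H%emp_spec.
  - intros m [H%emp_spec| ->]; [easy|now left].
Qed.

Lemma Nat_Trans n : Nat n -> Trans n.
Proof. now intros [[H _] _]. Qed.

Lemma Nat_elem n m : Nat n -> m ∊ n -> Nat m.
Proof.
  intros [[T1 T2] H] Hm. split; [split; auto|].
  - intros y Hy. apply T2. eapply T1; eauto.
  - intros j Hj. assert (Hjn : j ∊ n \/ j = n) by (destruct Hj as [Hj| ->]; eauto).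
    destruct (H j Hjn) as [|(k & _ & ->)]; auto. right. exists k. split; auto.
    destruct Hj as [Hj|Hj].
    + apply (T2 m Hm _ Hj). apply suc_spec; auto.
    + rewrite <- Hj. apply suc_spec; auto.
Qed.

Lemma Nat_suc n : Nat n -> Nat (suc n).
Proof.
  intros [[T1 T2] H]. split; [split|].
  - intros y Hy z Hz. apply suc_spec in Hy as [Hy| ->]; apply suc_spec; eauto.
  - intros y Hy. apply suc_spec in Hy as [Hy| ->]; auto.
  - intros m [Hm| ->].
    + apply suc_spec in Hm. destruct (H m Hm) as [|(k & Hk & ->)]; auto.
      right. exists k. split; auto. apply suc_spec; auto.
    + right. exists n. split; auto. apply suc_spec; auto.
Qed.

Lemma Nat_pred n : Nat (suc n) -> Nat n.
Proof. intros H. apply (Nat_elem _ _ H), suc_spec; auto. Qed.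

Section Class.
Context (D : M -> Prop) (K : KPclass D).
Let DT : transitive_class D := kp_trans D K.
Let DC : closed D := kp_closed D K.

Lemma kp_emp : D emp.
Proof. now apply (closed_emp D). Qed.

Lemma kp_ind0 cs (P : M -> Prop) : Forall D cs ->
  D0 (fst :: snd :: consts cs) (fun xy : M * M => P (fst xy)) ->
  (forall x, D x -> (forall y, y ∊ x -> P y) -> P x) -> forall x, D x -> P x.
Proof.
  intros Hc HP H x Dx.
  destruct (kp_ind D K cs (fun x _ => P x) Hc HP) with (x := x) as (w & _ & R); auto.
  intros y Dy Hy. exists emp. split; [apply kp_emp|]. apply H; auto.
  intros z Hz. now destruct (Hy z Hz).
Qed.

(** A nonzero natural number is the successor of one of its elements, so ∈-induction for
    Σ₁-properties gives the usual induction. Off the natural numbers the property is made vacuous,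
    with [emp] as witness. *)
Lemma nat_ind1 cs (P : M -> M -> Prop) : Forall D cs ->
  D0 (fst :: snd :: consts cs) (fun xy => P (fst xy) (snd xy)) ->
  (exists w, D w /\ P emp w) ->
  (forall n, D n -> Nat n -> (exists w, D w /\ P n w) -> exists w, D w /\ P (suc n) w) ->
  forall n, D n -> Nat n -> exists w, D w /\ P n w.
Proof.
  intros Hc HP H0 HS n Dn Nn.
  destruct (kp_ind D K cs (fun x w => Nat x -> P x w) Hc) with (x := n) as (w & Dw & R);
    eauto.
  - apply D0_imp; auto. apply (D0_Nat _ fst). exists 0. reflexivity.
  - clear n Dn Nn. intros n Dn IH.
    destruct (classic (Nat n)) as [Nn|Nn].
    2: { exists emp. split; [apply kp_emp|easy]. }
    destruct (proj2 Nn n) as [->|(k & Hk & ->)]; auto.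
    + destruct H0 as (w & Dw & Hw). eauto.
    + destruct (IH k Hk) as (w & Dw & Hw).
      destruct (HS k) as (w' & Dw' & Hw'); eauto using Nat_pred.
Qed.

Lemma nat_ind0 cs (P : M -> Prop) : Forall D cs ->
  D0 (fst :: snd :: consts cs) (fun xy : M * M => P (fst xy)) ->
  P emp -> (forall n, D n -> Nat n -> P n -> P (suc n)) ->
  forall n, D n -> Nat n -> P n.
Proof.
  intros Hc HP H0 HS n Dn Nn.
  destruct (nat_ind1 cs (fun x _ => P x) Hc HP) with (n := n) as (w & _ & R); auto.
  - exists emp. split; auto. apply kp_emp.
  - intros m Dm Nm (w & Dw & Hw). eauto.
Qed.

(** The model may be ill-founded seen from outside, so this has to come from ∈-induction inside
    it. *)
Lemma kp_irrefl x : D x -> ~ x ∊ x.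
Proof.
  revert x. apply (kp_ind0 [] (fun x => ~ x ∊ x)); [constructor|unfold consts; cbn [map]; d0|].
  intros x _ H L. exact (H x L L).
Qed.

Lemma D0_emp_in {X} (r : list (X -> M)) f : Crd r f -> D0 r (fun x : X => emp ∊ f x).
Proof.
  intros Hf. apply (D0_iff r (fun x : X => exists e, e ∊ f x /\ e = emp)); [|d0].
  intros x. split; [now intros (e & He & ->)|eauto].
Qed.

Lemma nat_zero m : D m -> Nat m -> m = emp \/ emp ∊ m.
Proof.
  revert m. apply (nat_ind0 [] (fun m => m = emp \/ emp ∊ m)); [constructor| |now left|].
  - unfold consts; cbn [map]. d0. apply (D0_emp_in _ fst); crd.
  - intros n Dn Nn [->|H]; right; apply suc_spec; auto.
Qed.

Lemma nat_suc_le m : D m -> Nat m -> forall k, k ∊ m -> suc k ∊ m \/ suc k = m.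
Proof.
  intros Dm Nm k Hk.
  assert (H : forall k, k ∊ m -> (exists j, j ∊ m /\ j = suc k) \/ m = suc k).
  { clear k Hk. revert m Dm Nm.
    apply (nat_ind0 [] (fun m => forall k, k ∊ m -> (exists j, j ∊ m /\ j = suc k) \/ m = suc k)).
    - constructor.
    - unfold consts; cbn [map]. d0.
    - now intros k H%emp_spec.
    - intros n Dn Nn IH k Hk. apply suc_spec in Hk as [Hk| ->]; auto.
      left. destruct (IH k Hk) as [(j & Hj & E)|E].
      + exists j. split; auto. apply suc_spec; auto.
      + exists n. split; auto. apply suc_spec; auto. }
  destruct (H k Hk) as [(j & Hj & ->)|E]; auto.
Qed.

Lemma nat_total m n : D m -> Nat m -> D n -> Nat n -> n ∊ m \/ n = m \/ m ∊ n.
Proof.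
  intros Dm Nm. revert n.
  apply (nat_ind0 [m] (fun n => n ∊ m \/ n = m \/ m ∊ n)).
  - repeat constructor; auto.
  - unfold consts; cbn [map]. d0.
  - destruct (nat_zero m); auto.
  - intros n Dn Nn [H|[H|H]].
    + destruct (nat_suc_le m Dm Nm n H); auto.
    + right; right. apply suc_spec; auto.
    + right; right. apply suc_spec; auto.
Qed.

Lemma omega_exists : exists w, D w /\ forall n, n ∊ w <-> D n /\ Nat n.
Proof.
  destruct (kp_inf D K) as (v & Dv & H0 & HS).
  destruct (kp_sep D K [] (fun x => Nat x) v) as (w & Dw & Hw); auto.
  { unfold consts; cbn [map]. d0. }
  exists w. split; auto. intros n. rewrite Hw. split.
  - intros [H N]. split; auto. eapply DT; [|exact H]; auto.
  - intros [Dn N]. split; auto. revert n Dn N.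
    apply (nat_ind0 [v] (fun n => n ∊ v)); auto.
    unfold consts; cbn [map]. d0.
Qed.

(** By Σ₁-induction and collection the elements of [x] lie in transitive sets from one set [b].
    Collection may add other members to [b], so its transitive members are separated before taking
    the union. *)
Lemma trans_closure x : D x -> exists t, D t /\ Trans t /\ x ∊ t.
Proof.
  revert x. apply (kp_ind D K [] (fun x t => Trans t /\ x ∊ t)); [constructor| |].
  { unfold consts; cbn [map]. d0. }
  intros x Dx IH.
  destruct (kp_coll D K [] (fun x t => Trans t /\ x ∊ t) x) as (b & Db & Hb); auto.
  { unfold consts; cbn [map]. d0. }
  destruct (kp_sep D K [] (fun x => Trans x) b) as (c & Dc & Hc); auto.
  { unfold consts; cbn [map]. d0. }
  destruct (kp_union D K c Dc) as (u & Du & Hu).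
  exists (adj u x). split; [now apply (closed_adj D)|]. split.
  - intros y Hy z Hz. apply adj_spec. left. apply Hu.
    apply adj_spec in Hy as [Hy| ->].
    + apply Hu in Hy as (t & Ht & Hy). exists t. split; auto.
      apply Hc in Ht as [_ Tt]. eapply Tt; eauto.
    + destruct (Hb z Hz) as (t & Ht & Tt & Hzt). exists t. split; auto. apply Hc; auto.
  - apply adj_spec; auto.
Qed.

(** Collection gives only supersets, first for each [a] and then for all of them together;
    separation from the union leaves exactly the image. The hypothesis on [F] makes its graph Δ₀ in
    any context. *)
Lemma image2 (F : M -> M -> M -> M) c A B :
  (forall X (r : list (X -> M)) f g1 g2 g3, Crd r f -> Crd r g1 -> Crd r g2 -> Crd r g3 ->
     D0 r (fun x : X => f x = F (g1 x) (g2 x) (g3 x))) ->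
  (forall a b, D a -> D b -> D (F c a b)) -> D c -> D A -> D B ->
  exists C, D C /\ forall y, y ∊ C <-> exists a, a ∊ A /\ exists b, b ∊ B /\ y = F c a b.
Proof.
  intros HF FD Dc DA DB.
  assert (DA' : forall a, a ∊ A -> D a) by (intros a; now apply DT).
  assert (DB' : forall a, a ∊ B -> D a) by (intros a; now apply DT).
  assert (H1 : forall a, a ∊ A -> exists y, D y /\ forall b, b ∊ B -> exists z, z ∊ y /\ z = F c a b).
  { intros a Ha. destruct (kp_coll D K [a; c] (fun b z => z = F c a b) B) as (y & Dy & Hy); auto.
    - unfold consts; cbn [map]. apply (HF _ _ snd (fun _ => c) (fun _ => a) fst); crd.
    - intros b Hb. exists (F c a b). auto.
    - eauto. }
  destruct (kp_coll D K [B; c] (fun a y => forall b, b ∊ B -> exists z, z ∊ y /\ z = F c a b) A)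
    as (y & Dy & Hy); auto.
  { unfold consts; cbn [map]. d0.
    apply (HF _ _ (fun x : _ * _ => snd x) (fun _ => c) (fun x : _ * _ => fst (fst (fst x))) (fun x : _ * _ => snd (fst x)));
      crd. }
  destruct (kp_union D K y Dy) as (u & Du & Hu).
  destruct (kp_sep D K [A; B; c] (fun z => exists a, a ∊ A /\ exists b, b ∊ B /\ z = F c a b) u)
    as (C & DC' & HC); auto.
  { unfold consts; cbn [map]. d0.
    apply (HF _ _ (fun x : _ * _ => fst (fst x)) (fun _ => c) (fun x : _ * _ => snd (fst x)) (fun x : _ * _ => snd x)); crd. }
  exists C. split; auto. intros z. rewrite HC. split; [tauto|].
  intros (a & Ha & b & Hb & ->). split; eauto. apply Hu.
  destruct (Hy a Ha) as (v & Hv & L). destruct (L b Hb) as (z & Hz & ->). eauto.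
Qed.

Lemma const_fun n c : D n -> D c ->
  exists f, D f /\ Fun f n /\ forall i y, App f i y <-> i ∊ n /\ y = c.
Proof.
  intros Dn Dc.
  destruct (image2 (fun c a _ => pr a c) c n (upair emp emp)) as (f & Df & Hf); auto.
  - intros X r f g1 g2 g3 H H1 H2 _. now apply D0_pr.
  - intros; now apply (closed_pr D).
  - apply (closed_upair D); auto using kp_emp.
  - assert (A : forall i y, App f i y <-> i ∊ n /\ y = c).
    { intros i y. unfold App. rewrite Hf. split.
      - intros (a & Ha & b & _ & [-> ->]%pr_inj). auto.
      - intros [Hi ->]. exists i. split; auto. exists emp. split; auto. apply upair_spec; auto. }
    exists f. split; auto. split; auto. repeat split.
    + intros p Hp. apply Hf in Hp as (a & Ha & b & _ & ->). eauto.
    + intros i Hi. exists c. apply A; auto.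
    + intros i Hi y z Hy Hz. apply A in Hy, Hz. destruct Hy, Hz. congruence.
Qed.

Lemma update_fun f n i u : D f -> D i -> D u -> Fun f n -> i ∊ n ->
  exists g, D g /\ Fun g n /\ forall j y, App g j y <-> j = i /\ y = u \/ ~ j = i /\ App f j y.
Proof.
  intros Df Di Du (F1 & F2 & F3) Hi.
  destruct (kp_sep D K [i] (fun p => ~ exists a b, p = pr a b /\ a = i) f) as (h & Dh & Hh); auto.
  { unfold consts; cbn [map]. d0. }
  assert (A : forall j y, App (adj h (pr i u)) j y <-> j = i /\ y = u \/ ~ j = i /\ App f j y).
  { intros j y. unfold App. rewrite adj_spec, Hh. split.
    - intros [[H N]|[-> ->]%pr_inj]; auto. right. split; auto. intros ->. apply N. eauto.
    - intros [[-> ->]|[N H]]; auto. left. split; auto.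
      intros (a & b & [-> ->]%pr_inj & E). auto. }
  exists (adj h (pr i u)). split.
  { apply (closed_adj D); auto. now apply (closed_pr D). }
  split; auto. repeat split.
  - intros p Hp. apply adj_spec in Hp as [Hp| ->]; eauto. apply Hh in Hp as [Hp _]; auto.
  - intros j Hj. destruct (classic (j = i)) as [->|N].
    + exists u. apply A; auto.
    + destruct (F2 j Hj) as [y Hy]. exists y. apply A; auto.
  - intros j Hj y z Hy Hz. apply A in Hy, Hz.
    destruct Hy as [[-> ->]|[N Hy]], Hz as [[E ->]|[N' Hz]]; try easy. eauto.
Qed.
End Class.
End Elementary.

(** * The set of hereditarily finite sets *)

Section HereditarilyFinite.
Context {M : structure} {SM : SetModel M}.
Implicit Types x y z m n k a b c f t s : M.

Lemma extend_fun f a c y : Fun f a -> ~ c ∊ a ->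
  Fun (adj f (pr c y)) (adj a c) /\
  forall i u, App (adj f (pr c y)) i u <-> App f i u \/ i = c /\ u = y.
Proof.
  intros (F1 & F2 & F3) Hc.
  assert (A : forall i u, App (adj f (pr c y)) i u <-> App f i u \/ i = c /\ u = y).
  { intros i u. unfold App. rewrite adj_spec. split; (intros [H|H]; [auto|right]).
    - now apply pr_inj in H.
    - destruct H; congruence. }
  assert (N : forall u, ~ App f c u).
  { intros u Hu. destruct (F1 _ Hu) as (x & Hx & z & [-> ->]%pr_inj). auto. }
  split; auto. repeat split.
  - intros p Hp. apply adj_spec in Hp as [Hp| ->].
    + destruct (F1 p Hp) as (x & Hx & z & ->). exists x. split; eauto. apply adj_spec; auto.
    + exists c. split; eauto. apply adj_spec; auto.
  - intros x Hx. apply adj_spec in Hx as [Hx| ->].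
    + destruct (F2 x Hx) as [u Hu]. exists u. apply A; auto.
    + exists y. apply A; auto.
  - intros x Hx u v Hu Hv. apply A in Hu, Hv. apply adj_spec in Hx.
    destruct Hu as [Hu|[-> ->]], Hv as [Hv|[E ->]]; try subst x; auto; try now apply N in Hu || apply N in Hv.
    destruct Hx as [Hx| ->]; eauto. now apply N in Hu.
Qed.

Lemma Fun_emp : Fun emp emp.
Proof. repeat split; intros x Hx; now apply emp_spec in Hx. Qed.

Lemma Fun_dom f a i u : Fun f a -> App f i u -> i ∊ a.
Proof. intros (F1 & _ & _) H. destruct (F1 _ H) as (x & Hx & y & [-> ->]%pr_inj). auto. Qed.

Lemma Fun_functional f a i u v : Fun f a -> App f i u -> App f i v -> u = v.
Proof. intros F Hu Hv. pose proof (Fun_dom _ _ _ _ F Hu). destruct F as (_ & _ & F). eauto. Qed.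

Lemma App_class (D : M -> Prop) f i u : transitive_class D -> D f -> App f i u -> D i /\ D u.
Proof. intros DT Df H. apply (DT _ _ Df) in H. now apply (trans_pr D) in H. Qed.

(** One round of adjunctions. Iterated from {∅} it leads to a transitive set closed under [adj],
    without power sets, which KP does not provide. *)
Definition Next t t' : Prop :=
  (forall c, c ∊ t' -> c ∊ t \/ exists a, a ∊ t /\ exists b, b ∊ t /\ c = adj a b) /\
  (forall c, c ∊ t -> c ∊ t') /\
  (forall a, a ∊ t -> forall b, b ∊ t -> exists c, c ∊ t' /\ c = adj a b).

(** The iteration as a function on n + 1 with f(0) = {∅}. The clauses run over the pairs in [f],
    because Δ₀-definability is stated for coordinates and [suc k] is not one. *)
Definition Stage f n : Prop :=
  Fun f (suc n) /\
  (forall q, q ∊ f -> exists a b, q = pr a b /\ (a = emp -> b = num 1)) /\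
  forall k, k ∊ n -> forall t, App f k t ->
    forall q, q ∊ f -> exists a b, q = pr a b /\ (a = suc k -> Next t b).

Lemma Next_unique t s s' : Next t s -> Next t s' -> s = s'.
Proof.
  assert (A : forall s s', Next t s -> Next t s' -> forall c, c ∊ s -> c ∊ s').
  { intros r r' (H1 & H2 & H3) (K1 & K2 & K3) c Hc.
    destruct (H1 c Hc) as [Hc'|(a & Ha & b & Hb & ->)]; auto.
    destruct (K3 a Ha b Hb) as (d & Hd & ->). auto. }
  intros H H'. apply ext. intros z. split; eapply A; eauto.
Qed.

Lemma D0_Next {X} (r : list (X -> M)) (f g : X -> M) : Crd r f -> Crd r g ->
  D0 r (fun x : X => Next (f x) (g x)).
Proof. intros Hf Hg. unfold Next. d0. Qed.

Lemma D0_Fun_suc {X} (r : list (X -> M)) (f g : X -> M) : Crd r f -> Crd r g ->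
  D0 r (fun x : X => Fun (f x) (suc (g x))).
Proof.
  intros Hf Hg. apply (D0_iff r (fun x : X =>
    (forall p, p ∊ f x -> exists a b, p = pr a b /\ (a ∊ g x \/ a = g x)) /\
    ((forall a, a ∊ g x -> exists y, App (f x) a y /\ y = y) /\
     (exists y, App (f x) (g x) y /\ y = y)) /\
    ((forall a, a ∊ g x -> forall y, App (f x) a y -> forall z, App (f x) a z -> y = z) /\
     (forall y, App (f x) (g x) y -> forall z, App (f x) (g x) z -> y = z)))).
  - intros x. unfold Fun. split; intros (H1 & H2 & H3); split; [|split| |split].
    + intros p Hp. destruct (H1 p Hp) as (a & b & E & Ha). exists a. rewrite suc_spec. split; eauto.
    + intros a Ha. apply suc_spec in Ha as [Ha| ->].
      * destruct (proj1 H2 a Ha) as [y [Hy _]]; eauto.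
      * destruct (proj2 H2) as [y [Hy _]]; eauto.
    + intros a Ha y z Hy Hz. apply suc_spec in Ha as [Ha| ->].
      * apply (proj1 H3 a Ha y Hy z Hz).
      * apply (proj2 H3 y Hy z Hz).
    + intros p Hp. destruct (H1 p Hp) as (a & Ha & b & E). apply suc_spec in Ha. eauto.
    + split.
      * intros a Ha. destruct (H2 a) as [y Hy]; eauto. apply suc_spec; auto.
      * destruct (H2 (g x)) as [y Hy]; eauto. apply suc_spec; auto.
    + split.
      * intros a Ha y Hy z Hz. apply (H3 a); auto. apply suc_spec; auto.
      * intros y Hy z Hz. apply (H3 (g x)); auto. apply suc_spec; auto.
  - d0.
Qed.

Lemma D0_Stage {X} (r : list (X -> M)) (f g : X -> M) : Crd r f -> Crd r g ->
  D0 r (fun x : X => Stage (f x) (g x)).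
Proof.
  intros Hf Hg. unfold Stage. d0.
  - now apply D0_Fun_suc.
  - apply (D0_Next _ (fun x : _ * _ => snd (fst (fst (fst (fst x))))) (fun x : _ * _ => snd x)); crd.
Qed.
Section Class.
Context (D : M -> Prop) (K : KPclass D).
Let DT : transitive_class D := kp_trans D K.
Let DC : closed D := kp_closed D K.

Lemma Next_exists t : D t -> exists t', D t' /\ Next t t'.
Proof.
  intros Dt.
  destruct (image2 D K (fun _ a b => adj a b) emp t t) as (u & Du & Hu); auto.
  - intros. now apply D0_adj.
  - intros; now apply (closed_adj D).
  - now apply kp_emp.
  - destruct (kp_union D K (upair t u)) as (v & Dv & Hv). { now apply (closed_upair D). }
    assert (A : forall c, c ∊ v <-> c ∊ t \/ c ∊ u).
    { intros c. rewrite Hv. split.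
      - intros (w & Hw & Hc). apply upair_spec in Hw as [->| ->]; auto.
      - intros [Hc|Hc]; [exists t|exists u]; (split; [apply upair_spec; auto|auto]). }
    exists v. split; auto. repeat split.
    + intros c Hc. apply A in Hc. rewrite Hu in Hc. auto.
    + intros c Hc. apply A; auto.
    + intros a Ha b Hb. exists (adj a b). split; auto. apply A. right. apply Hu. eauto.
Qed.

Lemma nat_suc_mem n k : D n -> Nat n -> suc k ∊ suc n -> k ∊ n.
Proof.
  intros Dn Nn H. apply suc_spec in H as [H|H].
  - apply (Nat_Trans _ Nn _ H), suc_spec; auto.
  - rewrite <- H. apply suc_spec; auto.
Qed.

Lemma Stage_exists n : D n -> Nat n -> exists f, D f /\ Stage f n.
Proof.
  revert n. apply (nat_ind1 D K [] (fun n f => Stage f n)); [constructor| | |].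
  - unfold consts; cbn [map]. apply (D0_Stage _ snd fst); crd.
  - assert (De : D emp) by now apply (kp_emp D).
    destruct (extend_fun emp emp emp (num 1) Fun_emp (emp_spec emp)) as [F A].
    exists (adj emp (pr emp (num 1))). split; [|split; [exact F|split]].
    + apply (closed_adj D); auto. apply (closed_pr D); auto. now apply (closed_num D).
    + intros q Hq. apply adj_spec in Hq as [Hq| ->]; [now apply emp_spec in Hq|eauto].
    + now intros k Hk%emp_spec.
  - intros n Dn Nn (f & Df & F & H0 & HS).
    destruct (proj1 (proj2 F) n) as [t Ht]; [apply suc_spec; auto|].
    destruct (App_class D _ _ _ DT Df Ht) as [_ Dt].
    destruct (Next_exists t Dt) as (t' & Dt' & Hn).
    assert (Dsn : D (suc n)) by now apply (closed_suc D).
    assert (Irr : ~ suc n ∊ suc n) by now apply (kp_irrefl D K).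
    destruct (extend_fun f (suc n) (suc n) t' F Irr) as [F' A].
    exists (adj f (pr (suc n) t')). split; [|split; [exact F'|split]].
    + apply (closed_adj D); auto. now apply (closed_pr D).
    + intros q Hq. apply adj_spec in Hq as [Hq| ->]; auto. exists (suc n), t'. split; auto.
      intros E. exfalso. apply (emp_spec n). rewrite <- E. apply suc_spec; auto.
    + intros k Hk s Hs q Hq. apply adj_spec in Hq as [Hq| ->].
      * apply suc_spec in Hk as [Hk| ->].
        -- apply (HS k Hk s); auto. apply A in Hs as [Hs|[-> ->]]; auto.
           exfalso. apply Irr. apply suc_spec. left. auto.
        -- destruct (proj1 F q Hq) as (a & Ha & b & ->). exists a, b. split; auto.
           intros ->. now destruct Irr.
      * exists (suc n), t'. split; auto. intros E.
        assert (k = n).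
        { apply suc_spec in Hk as [Hk| ->]; auto. exfalso.
          apply (kp_irrefl D K n); auto.
          assert (N : n ∊ suc k) by (rewrite <- E; apply suc_spec; auto).
          apply suc_spec in N as [N|N]; [|now rewrite <- N in Hk].
          apply (Nat_Trans _ Nn _ Hk); auto. }
        subst k. apply A in Hs as [Hs|[E' _]].
        -- now rewrite (Fun_functional _ _ _ _ _ F Hs Ht).
        -- exfalso. apply (kp_irrefl D K n); auto. rewrite E' at 2. apply suc_spec; auto.
Qed.

Lemma Stage_unique f n f' n' k : D f -> D n -> D f' -> D n' -> D k -> Nat n -> Nat n' -> Nat k ->
  Stage f n -> Stage f' n' -> k ∊ suc n -> k ∊ suc n' ->
  forall t, App f k t -> forall t', App f' k t' -> t = t'.
Proof.
  intros Df Dn Df' Dn' Dk Nn Nn' Nk (F & H0 & HS) (F' & H0' & HS'). revert k Dk Nk.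
  apply (nat_ind0 D K [f; suc n; f'; suc n'] (fun k => k ∊ suc n -> k ∊ suc n' ->
    forall t, App f k t -> forall t', App f' k t' -> t = t')).
  - repeat constructor; auto; now apply (closed_suc D).
  - unfold consts; cbn [map].
    apply (D0_imp _ (fun xy : M * M => fst xy ∊ suc n)); [d0|].
    apply (D0_imp _ (fun xy : M * M => fst xy ∊ suc n')); d0.
  - intros _ _ t Ht t' Ht'.
    destruct (H0 _ Ht) as (a & b & [<- <-]%pr_inj & E).
    destruct (H0' _ Ht') as (a & b & [<- <-]%pr_inj & E'). now rewrite E, E'.
  - intros k Dk Nk IH Hk Hk' t Ht t' Ht'.
    apply nat_suc_mem in Hk, Hk'; auto.
    assert (Hk1 : k ∊ suc n) by (apply suc_spec; auto).
    assert (Hk2 : k ∊ suc n') by (apply suc_spec; auto).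
    destruct (proj1 (proj2 F) k Hk1) as [s Hs].
    destruct (proj1 (proj2 F') k Hk2) as [s' Hs'].
    assert (s = s') by auto. subst s'.
    destruct (HS k Hk s Hs _ Ht) as (a & b & [<- <-]%pr_inj & E).
    destruct (HS' k Hk' s Hs' _ Ht') as (a & b & [<- <-]%pr_inj & E').
    eapply Next_unique; [apply E|apply E']; auto.
Qed.

Lemma Stage_increasing f n : D f -> D n -> Nat n -> Stage f n ->
  forall k, D k -> Nat k -> k ∊ suc n -> (forall t, App f k t -> Trans t) /\
    forall j, j ∊ k -> forall s, App f j s -> forall t, App f k t -> forall c, c ∊ s -> c ∊ t.
Proof.
  intros Df Dn Nn (F & H0 & HS).
  apply (nat_ind0 D K [f; suc n] (fun k => k ∊ suc n -> (forall t, App f k t -> Trans t) /\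
    forall j, j ∊ k -> forall s, App f j s -> forall t, App f k t -> forall c, c ∊ s -> c ∊ t)).
  - repeat constructor; auto; now apply (closed_suc D).
  - unfold consts; cbn [map].
    apply (D0_imp _ (fun xy : M * M => fst xy ∊ suc n)); d0.
  - intros _. split.
    + intros t Ht. destruct (H0 _ Ht) as (a & b & [<- <-]%pr_inj & E).
      rewrite E by auto. apply Nat_Trans, Nat_num.
    + now intros j Hj%emp_spec.
  - intros k Dk Nk IH Hk. apply nat_suc_mem in Hk; auto.
    assert (Hk1 : k ∊ suc n) by (apply suc_spec; auto).
    destruct (proj1 (proj2 F) k Hk1) as [s Hs].
    destruct (IH Hk1) as [T I].
    assert (N : forall t, App f (suc k) t -> Next s t).
    { intros t Ht. destruct (HS k Hk s Hs _ Ht) as (a & b & [<- <-]%pr_inj & E). auto. }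
    split.
    + intros t Ht. destruct (N t Ht) as (N1 & N2 & N3). intros c Hc x Hx.
      apply N2. destruct (N1 c Hc) as [Hc'|(a & Ha & b & Hb & ->)].
      * apply (T s Hs c Hc'); auto.
      * apply adj_spec in Hx as [Hx| ->]; auto. apply (T s Hs a Ha); auto.
    + intros j Hj u Hu t Ht c Hc. destruct (N t Ht) as (N1 & N2 & N3). apply N2.
      apply suc_spec in Hj as [Hj| ->].
      * eapply I; eauto.
      * now rewrite (Fun_functional _ _ _ _ _ F Hs Hu).
Qed.

(** The union of all stages. Two elements lie in a common stage N since natural numbers are
    comparable, and stage N + 1 contains their adjunction. In an ill-founded model [h] may also have
    nonstandard elements. *)
Lemma HF_exists : exists h, D h /\ Trans h /\ closed (fun x => x ∊ h).
Proof.
  destruct (omega_exists D K) as (w & Dw & Hw).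
  destruct (kp_coll D K [] (fun n f => Stage f n) w) as (B & DB & HB); auto.
  { unfold consts; cbn [map]. apply (D0_Stage _ snd fst); crd. }
  { intros n Hn. apply Hw in Hn as [Dn Nn]. now apply Stage_exists. }
  (* Elements of values of functions in [B] lie in any transitive set containing [B], so the union
     of the stages can be separated from [T]. *)
  destruct (trans_closure D K B DB) as (T & DT' & TT & HT).
  destruct (kp_sep D K [w; B] (fun c => exists n, n ∊ w /\ exists f, f ∊ B /\ Stage f n /\
    exists t, App f n t /\ c ∊ t) T) as (h & Dh & Hh); auto.
  { unfold consts; cbn [map]. d0.
    apply (D0_Stage _ (fun x : _ * _ => snd x) (fun x : _ * _ => snd (fst x))); crd. }
  assert (A : forall c, c ∊ h <-> exists n, D n /\ Nat n /\ exists f, f ∊ B /\ Stage f n /\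
    exists t, App f n t /\ c ∊ t).
  { intros c. rewrite Hh. split.
    - intros (_ & n & Hn & R). apply Hw in Hn as [Dn Nn]. eauto.
    - intros (n & Dn & Nn & f & Hf & Hs & t & Ht & Hc). split.
      + assert (Q : forall x y, x ∊ y -> y ∊ T -> x ∊ T) by (intros; eapply TT; eauto).
        apply (Q _ _ Hc), (Q _ (upair n t)); [apply upair_spec; auto|].
        apply (Q _ (pr n t)); [apply upair_spec; auto|]. eauto.
      + exists n. split; [apply Hw; auto|]. exists f. split; auto. split; auto. eauto. }
  assert (DB' : forall f, f ∊ B -> D f) by (intros f; now apply DT).
  exists h. split; auto. split; [|split].
  - intros c Hc x Hx. apply A in Hc as (n & Dn & Nn & f & Hf & Hs & t & Ht & Hc).
    apply A. exists n. split; auto. split; auto. exists f. split; auto. split; auto.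
    exists t. split; auto.
    destruct (Stage_increasing f n (DB' f Hf) Dn Nn Hs n) as [Tr _]; auto.
    { apply suc_spec; auto. }
    apply (Tr t Ht c Hc); auto.
  - apply A. assert (De : D emp) by now apply (kp_emp D).
    destruct (HB emp) as (f & Hf & Hs). { apply Hw. auto using Nat_emp. }
    exists emp. split; auto. split; [apply Nat_emp|]. exists f. split; auto. split; auto.
    destruct Hs as (F & H0 & _). destruct (proj1 (proj2 F) emp) as [t Ht]; [apply suc_spec; auto|].
    exists t. split; auto. destruct (H0 _ Ht) as (a & b & [<- <-]%pr_inj & E).
    rewrite E by auto. apply suc_spec; auto.
  (* Approximating functions agree where both are defined and their values increase, so an element
     of stage n appears in the value at N of any of them that reaches N. *)
  - assert (Up : forall c n N, D n -> Nat n -> D N -> Nat N -> n ∊ suc N ->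
      (exists f, f ∊ B /\ Stage f n /\ exists t, App f n t /\ c ∊ t) ->
      forall f' t', D f' -> Stage f' N -> App f' N t' -> c ∊ t').
    { intros c n N Dn Nn DN NN Hn (f & Hf & Hs & t & Ht & Hc) f' t' Df' Hs' Ht'.
      destruct (proj1 (proj2 (proj1 Hs')) n Hn) as [u Hu].
      assert (E : t = u).
      { eapply (Stage_unique f n f' N n); eauto. apply suc_spec; auto. }
      subst u. apply suc_spec in Hn as [Hn| ->].
      - destruct (Stage_increasing f' N Df' DN NN Hs' N) as [_ I]; auto.
        { apply suc_spec; auto. }
        eapply I; eauto.
      - now rewrite (Fun_functional _ _ _ _ _ (proj1 Hs') Ht' Hu). }
    intros a b Ha Hb. apply A in Ha as (n & Dn & Nn & Ha), Hb as (m & Dm & Nm & Hb).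
    assert (L : exists N, D N /\ Nat N /\ n ∊ suc N /\ m ∊ suc N).
    { destruct (nat_total D K n m) as [H|[->|H]]; auto.
      - exists n. rewrite !suc_spec. auto.
      - exists n. rewrite !suc_spec. auto.
      - exists m. rewrite !suc_spec. auto. }
    destruct L as (N & DN & NN & Hn & Hm).
    assert (DN' : D (suc N)) by now apply (closed_suc D).
    destruct (HB (suc N)) as (f & Hf & Hs). { apply Hw. auto using Nat_suc. }
    assert (Df : D f) by auto.
    pose proof Hs as (F & _ & HS).
    destruct (proj1 (proj2 F) (suc N)) as [t Ht]; [apply suc_spec; auto|].
    destruct (proj1 (proj2 F) N) as [s Hs']; [rewrite !suc_spec; auto|].
    assert (HN : N ∊ suc N) by (apply suc_spec; auto).
    destruct (HS N HN s Hs' _ Ht) as (x & y & [<- <-]%pr_inj & E).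
    destruct (E eq_refl) as (_ & _ & N3).
    destruct (HB N) as (g & Hg & Hsg). { apply Hw. auto. }
    assert (Es : forall u, App g N u -> u = s).
    { intros u Hu.
      refine (Stage_unique g N f (suc N) N _ _ _ _ _ _ _ _ _ _ _ _ u Hu s Hs');
        auto using Nat_suc.
      rewrite !suc_spec; auto. }
    destruct (proj1 (proj2 (proj1 Hsg)) N HN) as [u Hu].
    rewrite (Es u Hu) in Hu.
    destruct (N3 a) with (b := b) as (c & Hc & ->).
    { apply (Up a n N Dn Nn DN NN Hn Ha g); auto. }
    { apply (Up b m N Dm Nm DN NN Hm Hb g); auto. }
    apply A. exists (suc N). split; auto. split; [now apply Nat_suc|]. exists f. eauto.
Qed.
End Class.
End HereditarilyFinite.

(** * Satisfaction of standard formulas and the levels of L *)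

(** Compares the constructor tags of two codes: different tags refute the equation, equal ones leave
    the equation between the arguments. *)
Ltac code_inv E :=
  cbn [cd mem eql neg imp all nm emb model_syntax] in E;
  let T := fresh "T" in
  apply pr_inj in E as [T E];
  first [apply num_inj in T; discriminate T | clear T].

Section Truth.
Context {M : structure} {SM : SetModel M}.
Implicit Types x y z m n a b c f t s u i j e A X Y : M.

(** Of the set of all assignments n → z the truth lemmas use only this and [updatable]. Both are Δ₀,
    whereas containing every function from n to z is not. *)
Definition values_in n z A : Prop := forall a, a ∊ A ->
  Fun a n /\ forall i, i ∊ n -> forall u, App a i u -> u ∊ z.
Definition updatable n z A : Prop := forall a, a ∊ A -> forall i, i ∊ n -> forall u, u ∊ z ->
  exists b, b ∊ A /\ App b i u /\ forall j, j ∊ n -> ~ j = i -> exists v, App a j v /\ App b j v.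

Definition ev_seq n A m s : Prop := Nat m /\ Fun s m /\
  forall i, i ∊ m -> forall e, App s i e ->
    EvStep Univ n A (fun e' => exists j, j ∊ i /\ App s j e') e.

(** The induction is on the standard formula. The sequence may have nonstandard length, but below an
    entry for [cd p] it must contain entries for the immediate subformulas. *)
Lemma ev_truth z n A m s : values_in n z A -> updatable n z A -> ev_seq n A m s ->
  forall p i X, i ∊ m -> App s i (pr (cd p) X) ->
  forall a, a ∊ A -> forall rho, (forall v, free v p = true -> num v ∊ n -> App a (num v) (rho v)) ->
    (a ∊ X <-> holds (fun x => x ∊ z) rho p).
Proof.
  intros HV HU (Nm & Fs & Hs) p. induction p; intros i X Hi Happ a Ha rho Hr;
    destruct (Hs i Hi _ Happ) as (p' & _ & Y & _ & [E0 <-]%pr_inj & H); subst p';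
    assert (Fa : Fun a n) by now apply HV.
  - destruct H as [H|[H|[H|[H|H]]]].
    2: destruct H as (x' & Hx & y' & Hy & E & H); code_inv E.
    2: destruct H as (q & _ & Z & _ & _ & E & H); code_inv E.
    2: destruct H as (q & _ & Z & _ & r & _ & W & _ & _ & _ & E & H); code_inv E.
    2: destruct H as (x' & Hx & q & _ & Z & _ & _ & E & H); code_inv E.
    destruct H as (x' & Hx & y' & Hy & E & H). code_inv E. apply pr_inj in E as [<- <-].
    rewrite (H a I). simpl.
    assert (R1 : App a (num x) (rho x)) by (apply Hr; auto; simpl; now rewrite Nat.eqb_refl).
    assert (R2 : App a (num y) (rho y)) by (apply Hr; auto; simpl; now rewrite Nat.eqb_refl, orb_true_r).
    split.
    + intros (_ & u & _ & v & _ & U1 & U2 & L).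
      now rewrite (Fun_functional _ _ _ _ _ Fa R1 U1), (Fun_functional _ _ _ _ _ Fa R2 U2).
    + intros L. split; auto. exists (rho x). split; [easy|]. exists (rho y). repeat split; auto.
  - destruct H as [H|[H|[H|[H|H]]]].
    1: destruct H as (x' & Hx & y' & Hy & E & H); code_inv E.
    2: destruct H as (q & _ & Z & _ & _ & E & H); code_inv E.
    2: destruct H as (q & _ & Z & _ & r & _ & W & _ & _ & _ & E & H); code_inv E.
    2: destruct H as (x' & Hx & q & _ & Z & _ & _ & E & H); code_inv E.
    destruct H as (x' & Hx & y' & Hy & E & H). code_inv E. apply pr_inj in E as [<- <-].
    rewrite (H a I). simpl.
    assert (R1 : App a (num x) (rho x)) by (apply Hr; auto; simpl; now rewrite Nat.eqb_refl).
    assert (R2 : App a (num y) (rho y)) by (apply Hr; auto; simpl; now rewrite Nat.eqb_refl, orb_true_r).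
    split.
    + intros (_ & u & _ & v & _ & U1 & U2 & L).
      now rewrite (Fun_functional _ _ _ _ _ Fa R1 U1), (Fun_functional _ _ _ _ _ Fa R2 U2).
    + intros L. split; auto. exists (rho x). split; [easy|]. exists (rho y). repeat split; auto.
  - destruct H as [H|[H|[H|[H|H]]]].
    1, 2: destruct H as (x' & Hx & y' & Hy & E & H); code_inv E.
    2: destruct H as (q & _ & Z & _ & r & _ & W & _ & _ & _ & E & H); code_inv E.
    2: destruct H as (x' & Hx & q & _ & Z & _ & _ & E & H); code_inv E.
    destruct H as (q & _ & Z & _ & (b & _ & (j & Hj & Hb) & ->) & E & H). code_inv E. subst q.
    assert (Hjm : j ∊ m) by exact (Nat_Trans _ Nm i Hi j Hj).
    rewrite (H a I), (IHp j Z Hjm Hb a Ha rho Hr). simpl. tauto.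
  - destruct H as [H|[H|[H|[H|H]]]].
    1, 2: destruct H as (x' & Hx & y' & Hy & E & H); code_inv E.
    1: destruct H as (q & _ & Z & _ & _ & E & H); code_inv E.
    2: destruct H as (x' & Hx & q & _ & Z & _ & _ & E & H); code_inv E.
    destruct H as (q & _ & Z & _ & r & _ & W & _ & (b & _ & (j & Hj & Hb) & ->) &
      (b' & _ & (j' & Hj' & Hb') & ->) & E & H).
    code_inv E. apply pr_inj in E as [<- <-].
    assert (Hjm : j ∊ m) by exact (Nat_Trans _ Nm i Hi j Hj).
    assert (Hjm' : j' ∊ m) by exact (Nat_Trans _ Nm i Hi j' Hj').
    rewrite (H a I), (IHp1 j Z Hjm Hb a Ha rho), (IHp2 j' W Hjm' Hb' a Ha rho).
    + simpl. tauto.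
    + intros v Fv. apply Hr. simpl. now rewrite Fv, orb_true_r.
    + intros v Fv. apply Hr. simpl. now rewrite Fv.
  - destruct H as [H|[H|[H|[H|H]]]].
    1, 2: destruct H as (x' & Hx & y' & Hy & E & H); code_inv E.
    1: destruct H as (q & _ & Z & _ & _ & E & H); code_inv E.
    1: destruct H as (q & _ & Z & _ & r & _ & W & _ & _ & _ & E & H); code_inv E.
    destruct H as (x' & Hx & q & _ & Z & _ & (b & _ & (j & Hj & Hb) & ->) & E & H).
    code_inv E. apply pr_inj in E as [<- <-].
    assert (Hjm : j ∊ m) by exact (Nat_Trans _ Nm i Hi j Hj).
    rewrite (H a I). simpl.
    assert (IH : forall b u, b ∊ A -> App b (num x) u ->
       (forall j, j ∊ n -> ~ j = num x -> exists v, App a j v /\ App b j v) ->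
       (b ∊ Z <-> holds (fun x => x ∊ z) (upd rho x u) p)).
    { intros b u HbA Hu Hag. apply (IHp j Z Hjm Hb); auto.
      intros v Fv Hv. destruct (Nat.eq_dec v x) as [->|N].
      - now rewrite upd_same.
      - rewrite upd_other by auto. destruct (Hag (num v) Hv) as (w & W1 & W2).
        { intros E%num_inj. auto. }
        assert (R : App a (num v) (rho v)).
        { apply Hr; auto. simpl. rewrite Fv, andb_true_r. apply negb_true_iff, Nat.eqb_neq. auto. }
        now rewrite (Fun_functional _ _ _ _ _ Fa R W1). }
    split.
    + intros (_ & L) u Hu. destruct (HU a Ha (num x) Hx u Hu) as (b & HbA & B1 & B2).
      apply (IH b u HbA B1 B2). apply L; auto.
      intros k Hk N. destruct (B2 k Hk N) as (v & V1 & V2). exists v. repeat split; auto.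
    + intros L. split; auto. intros b HbA Hag.
      destruct (HV b HbA) as [Fb Vb]. destruct (proj1 (proj2 Fb) (num x) Hx) as [u Hu].
      apply (IH b u HbA Hu).
      * intros k Hk N. destruct (Hag k Hk N) as (v & _ & V1 & V2). eauto.
      * apply L. eapply Vb; eauto.
Qed.

Section Universe.
Context (K : KPclass (@Univ M)).

Lemma assignments_good n z A : IsAssignments Univ n z A -> values_in n z A /\ updatable n z A.
Proof.
  intros H. assert (HV : values_in n z A).
  { intros a Ha. apply (H a I) in Ha as [F V]. split; auto. intros i Hi u Hu. now apply (V i Hi u). }
  split; auto. intros a Ha i Hi u Hu. destruct (HV a Ha) as [F V].
  destruct (update_fun Univ K a n i u) as (b & _ & Fb & Hb); try easy.
  exists b. split; [|split].
  - apply (H b I). split; auto. intros j Hj w _ Hw. apply Hb in Hw as [[-> ->]|[_ Hw]]; auto.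
    eapply V; eauto.
  - apply Hb; auto.
  - intros j Hj N. destruct (proj1 (proj2 F) j Hj) as [v Hv]. exists v. split; auto.
    apply Hb; auto.
Qed.

Lemma Evaluates_seq z n A c X : Evaluates Univ z n A c X ->
  values_in n z A /\ updatable n z A /\
  exists m s i, ev_seq n A m s /\ i ∊ m /\ App s i (pr c X).
Proof.
  intros (Nn & HA & b & _ & -> & m & _ & s & _ & Nm & Fs & Hs & i & Hi & Happ).
  apply assignments_good in HA as [HV HU]. split; auto. split; auto.
  exists m, s, i. split; auto. split; auto. split; auto. intros j Hj e He. now apply Hs.
Qed.

Lemma Models_holds z p : Models Univ z (cd p) ->
  forall rho, (forall v, rho v ∊ z) -> holds (fun x => x ∊ z) rho p.
Proof.
  intros (_ & n & _ & A & _ & X & _ & Ev & HX) rho Hr.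
  pose proof Ev as (_ & HA & _).
  apply Evaluates_seq in Ev as (HV & HU & m & s & i & Hseq & Hi & Happ).
  (* [rho] is a function of the metatheory and need not exist in the model. Only its values on the
     variables of [p] matter, and these are entered one at a time into a constant assignment. *)
  assert (Q : forall k, exists a, a ∊ A /\ forall v, v < k -> num v ∊ n -> App a (num v) (rho v)).
  { induction k as [|k (a & Ha & IH)].
    - destruct (const_fun Univ K n (rho 0)) as (f & _ & Ff & Hf); try easy.
      exists f. split; [|lia]. apply (HA f I). split; auto.
      intros j Hj u _ Hu. apply Hf in Hu as [_ ->]. auto.
    - destruct (classic (num k ∊ n)) as [Hk|Hk].
      + destruct (HU a Ha (num k) Hk (rho k) (Hr k)) as (b & Hb & B1 & B2).
        exists b. split; auto. intros v Hv Hvn. destruct (Nat.eq_dec v k) as [->|N]; auto.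
        destruct (B2 (num v) Hvn) as (w & W1 & W2). { intros E%num_inj. auto. }
        assert (R : App a (num v) (rho v)) by (apply IH; auto; lia).
        now rewrite (Fun_functional _ _ _ _ _ (proj1 (HV a Ha)) R W1).
      + exists a. split; auto. intros v Hv Hvn. destruct (Nat.eq_dec v k) as [->|N]; [easy|].
        apply IH; auto; lia. }
  destruct (Q (fresh p)) as (a & Ha & Hrho).
  apply (ev_truth z n A m s HV HU Hseq p i X Hi Happ a Ha rho).
  - intros v Fv. apply Hrho. now apply free_fresh.
  - auto.
Qed.

(** ** Levels of L *)

Lemma Evaluates_sub z n A c X : Evaluates Univ z n A c X -> forall a, a ∊ X -> a ∊ A.
Proof.
  intros Ev a Ha. apply Evaluates_seq in Ev as (_ & _ & m & s & i & (_ & _ & Hs) & Hi & Happ).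
  destruct (Hs i Hi _ Happ) as (p & _ & Y & _ & [_ <-]%pr_inj & [H|[H|[H|[H|H]]]]).
  - destruct H as (x' & _ & y' & _ & _ & H). now apply (H a I) in Ha.
  - destruct H as (x' & _ & y' & _ & _ & H). now apply (H a I) in Ha.
  - destruct H as (q & _ & Z & _ & _ & _ & H). now apply (H a I) in Ha.
  - destruct H as (q & _ & Z & _ & r & _ & W & _ & _ & _ & _ & H). now apply (H a I) in Ha.
  - destruct H as (x' & _ & q & _ & Z & _ & _ & _ & H). now apply (H a I) in Ha.
Qed.

Lemma IsDef_sub z A y u : IsDef Univ z A -> y ∊ A -> u ∊ y -> u ∊ z.
Proof.
  intros H Hy Hu.
  apply (H y I) in Hy as (n & _ & B & _ & c & _ & X & _ & a & _ & Ev & Fa & o & _ & -> & Hy).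
  apply (Hy u I) in Hu as (b & Hb & Hbu & _).
  pose proof (Evaluates_sub _ _ _ _ _ Ev b Hb) as HbB.
  apply Evaluates_seq in Ev as (HV & _). destruct (HV b HbB) as [Fb Vb].
  eapply Vb; eauto. eapply Fun_dom; eauto.
Qed.

Lemma suc_Ord_Trans x : Ord x -> Trans (suc x).
Proof.
  intros [T _] y Hy z Hz. apply suc_spec. left.
  apply suc_spec in Hy as [Hy| ->]; auto. eapply T; eauto.
Qed.

(** An element of L_ξ belongs to some Def(L_ζ) with ζ < ξ and so is a subset of L_ζ, whose elements
    belong to Def(L_η) for some η < ζ. *)
Lemma IsL_Trans xi z : IsL Univ xi z -> Trans z.
Proof.
  intros (O & f & _ & e & _ & -> & Ff & Hf & Hz).
  pose proof (suc_Ord_Trans _ O) as T.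
  assert (Hxi : xi ∊ suc xi) by (apply suc_spec; auto).
  intros y Hy u Hu.
  apply (Hf xi Hxi z I Hz y I) in Hy as (zeta & Hzeta & v & _ & E & _ & Hv & HE & Hy).
  pose proof (IsDef_sub _ _ _ _ HE Hy Hu) as Huv.
  assert (Hz' : zeta ∊ suc xi) by (apply suc_spec; auto).
  apply (Hf zeta Hz' v I Hv u I) in Huv as (eta & Heta & w & _ & E' & _ & Hw & HE' & Hu').
  apply (Hf xi Hxi z I Hz u I). exists eta. split.
  - exact (proj1 O zeta Hzeta eta Heta).
  - exists w. split; [easy|]. exists E'. exact (conj I (conj Hw (conj HE' Hu'))).
Qed.

Lemma IsL_unique xi z z' : IsL Univ xi z -> IsL Univ xi z' -> z = z'.
Proof.
  intros (O & f & _ & e & _ & -> & Ff & Hf & Hz) (_ & f' & _ & e' & _ & -> & Ff' & Hf' & Hz').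
  pose proof (suc_Ord_Trans _ O) as T.
  enough (A : forall eta, Univ eta -> eta ∊ suc xi -> forall w, App f eta w ->
    forall w', App f' eta w' -> w = w').
  { apply (A xi I); auto. apply suc_spec; auto. }
  apply (kp_ind0 Univ K [f; f'; suc xi] (fun eta => eta ∊ suc xi -> forall w, App f eta w ->
    forall w', App f' eta w' -> w = w')).
  - repeat constructor.
  - unfold consts; cbn [map]. apply (D0_imp _ (fun xy : M * M => fst xy ∊ suc xi)); d0.
  - intros eta _ IH Heta w Hw w' Hw'.
    assert (B : forall zeta, zeta ∊ eta -> zeta ∊ suc xi) by exact (T eta Heta).
    apply ext. intros u. rewrite (Hf eta Heta w I Hw u I), (Hf' eta Heta w' I Hw' u I).
    split; intros (zeta & Hzeta & v & _ & E & _ & Hv & HE & Hu).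
    + destruct (proj1 (proj2 Ff') zeta (B _ Hzeta)) as [v' Hv'].
      assert (v = v') by eauto. subst v'. exists zeta. split; auto.
      exists v. split; [easy|]. exists E. exact (conj I (conj Hv' (conj HE Hu))).
    + destruct (proj1 (proj2 Ff) zeta (B _ Hzeta)) as [v' Hv'].
      assert (v' = v) by eauto. subst v'. exists zeta. split; auto.
      exists v. split; [easy|]. exists E. exact (conj I (conj Hv' (conj HE Hu))).
Qed.

(** Formal admissibility speaks of codes in the sense of the model. The codes of the actual axioms
    are among them, and for these formal satisfaction is real satisfaction by [Models_holds]. *)
Lemma admissible_KPclass xi z : IsAdmissible Univ xi -> IsL Univ xi z ->
  Trans z /\ KPclass (fun x => x ∊ z).
Proof.
  intros (z' & _ & HL & HM) HL'. rewrite (IsL_unique _ _ _ HL' HL). clear z HL'.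
  pose proof (IsL_Trans _ _ HL) as T. split; auto.
  assert (DC : closed (@Univ M)) by (split; easy).
  destruct (HM _ I (IsKP_cd Univ DC _ KP1_ext)) as [(o & _ & Ho) _].
  apply (KPclass_intro _ (fun x y Hx => T x Hx y) o Ho).
  intros p Hp rho Hr. apply Models_holds; auto. apply HM; [easy|]. now apply IsKP_cd.
Qed.
End Universe.
End Truth.

(** * Δ₀-satisfaction witnessed by sets *)

Section Evidence.
Context {M : structure} {SM : SetModel M}.
Implicit Types x y z m n a b c f g t s u i j k e p q A Y Z W : M.

(** Two inclusions instead of an equivalence over all [a] keep the quantifiers bounded. *)
Definition Sep A Y (Q : M -> Prop) : Prop :=
  (forall a, a ∊ Y -> a ∊ A /\ Q a) /\ (forall a, a ∊ A -> Q a -> a ∊ Y).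
Definition Agree n x a b : Prop :=
  forall i, i ∊ n -> ~ i = x -> exists v, App a i v /\ App b i v.

(** Unlike in [EvStep], codes and satisfaction sets form two sequences with common indices: [g] is
    the building sequence that comes with the formula, and [s] is constructed along it. *)
Definition EStep n A g s j p Y : Prop :=
  (exists x, x ∊ n /\ exists y, y ∊ n /\ p = mem x y /\
     Sep A Y (fun a => exists u, App a x u /\ exists v, App a y v /\ u ∊ v)) \/
  (exists x, x ∊ n /\ exists y, y ∊ n /\ p = eql x y /\
     Sep A Y (fun a => exists u, App a x u /\ exists v, App a y v /\ u = v)) \/
  (exists k, k ∊ j /\ exists q, App g k q /\ (p = neg q /\ exists Z, App s k Z /\
     Sep A Y (fun a => ~ a ∊ Z))) \/
  (exists k, k ∊ j /\ exists q, App g k q /\ (exists l, l ∊ j /\ exists r, App g l r /\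
     (p = imp q r /\ exists Z, App s k Z /\ exists W, App s l W /\
       Sep A Y (fun a => ~ a ∊ Z \/ a ∊ W)))) \/
  (exists x, x ∊ n /\ exists y, y ∊ n /\ (~ x = y /\ exists k, k ∊ j /\ exists q, App g k q /\
     (p = allIn x y q /\ exists Z, App s k Z /\
       Sep A Y (fun a => forall b, b ∊ A -> (~ Agree n x a b) \/
         forall u, App b x u -> forall v, App b y v -> ~ u ∊ v \/ b ∊ Z)))).

(** [g] is a sequence of codes of Δ₀-formulas with variables in [n], each built
    from earlier ones, and [s] the sequence of the sets of satisfying
    assignments. *)
Definition Ev0 n A m g s : Prop := Nat m /\ Fun g m /\ Fun s m /\
  forall j, j ∊ m -> forall p, App g j p -> forall Y, App s j Y -> EStep n A g s j p Y.

(** The domain [z] is transitive so that bounded quantifiers are evaluated correctly in it, and [n]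
    exceeds the variables of the formula. The witness, the value [u] of variable 0, is required to
    lie in [w]: this membership drives the descent. *)
Definition Evidence w p n : Prop :=
  exists z, z ∊ w /\ exists A, A ∊ w /\ exists m, m ∊ w /\ exists g, g ∊ w /\ exists s, s ∊ w /\
    Trans z /\ values_in n z A /\ updatable n z A /\ Ev0 n A m g s /\
    exists i, i ∊ m /\ App g i p /\ exists Y, App s i Y /\
      exists a, a ∊ A /\ a ∊ Y /\ exists o, o ∊ w /\ o = emp /\ exists u, u ∊ w /\ App a o u.

(** ** Definability *)

Lemma D0_cMem {X} (r : list (X -> M)) (f g h : X -> M) : Crd r f -> Crd r g -> Crd r h ->
  D0 r (fun x : X => f x = mem (g x) (h x)).
Proof.
  intros. apply (D0_iff r (fun x : X => exists a b, f x = pr a b /\ (a = num 0 /\ b = pr (g x) (h x)))).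
  - intros x. split; [now intros (a & b & -> & -> & ->)|intros ->; cbn; eauto].
  - d0.
Qed.
Lemma D0_cEql {X} (r : list (X -> M)) (f g h : X -> M) : Crd r f -> Crd r g -> Crd r h ->
  D0 r (fun x : X => f x = eql (g x) (h x)).
Proof.
  intros. apply (D0_iff r (fun x : X => exists a b, f x = pr a b /\ (a = num 1 /\ b = pr (g x) (h x)))).
  - intros x. split; [now intros (a & b & -> & -> & ->)|intros ->; cbn; eauto].
  - d0.
Qed.
Lemma D0_cNot {X} (r : list (X -> M)) (f g : X -> M) : Crd r f -> Crd r g ->
  D0 r (fun x : X => f x = neg (g x)).
Proof.
  intros. apply (D0_iff r (fun x : X => exists a b, f x = pr a b /\ (a = num 2 /\ b = g x))).
  - intros x. split; [now intros (a & b & -> & -> & ->)|intros ->; cbn; eauto].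
  - d0.
Qed.
Lemma D0_cImp {X} (r : list (X -> M)) (f g h : X -> M) : Crd r f -> Crd r g -> Crd r h ->
  D0 r (fun x : X => f x = imp (g x) (h x)).
Proof.
  intros. apply (D0_iff r (fun x : X => exists a b, f x = pr a b /\ (a = num 3 /\ b = pr (g x) (h x)))).
  - intros x. split; [now intros (a & b & -> & -> & ->)|intros ->; cbn; eauto].
  - d0.
Qed.
Lemma D0_callIn {X} (r : list (X -> M)) (f g h k : X -> M) :
  Crd r f -> Crd r g -> Crd r h -> Crd r k ->
  D0 r (fun x : X => f x = allIn (g x) (h x) (k x)).
Proof.
  intros. apply (D0_iff r (fun x : X => exists a b, f x = pr a b /\ (a = num 4 /\
    exists c d, b = pr c d /\ (c = g x /\
    exists a' b', d = pr a' b' /\ (a' = num 3 /\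
    exists c' d', b' = pr c' d' /\ (c' = mem (g x) (h x) /\ d' = k x)))))).
  - intros x. split.
    + now intros (a & b & -> & -> & c & d & -> & -> & a' & b' & -> & -> & c' & d' & -> & -> & ->).
    + intros ->. cbn. do 2 eexists. split; [reflexivity|]. split; auto.
      do 2 eexists. split; [reflexivity|]. split; auto.
      do 2 eexists. split; [reflexivity|]. split; auto.
      do 2 eexists. split; [reflexivity|]. split; auto.
  - d0. eapply D0_cMem; crd.
Qed.
End Evidence.

Ltac d0_end4 := lazymatch goal with
  | |- D0 _ (fun x => @?f x = mem (@?g x) (@?h x)) => apply (D0_cMem _ f g h); crd
  | |- D0 _ (fun x => @?f x = eql (@?g x) (@?h x)) => apply (D0_cEql _ f g h); crd
  | |- D0 _ (fun x => @?f x = imp (@?g x) (@?h x)) => apply (D0_cImp _ f g h); crd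
  | |- D0 _ (fun x => @?f x = neg (@?g x)) => apply (D0_cNot _ f g); crd
  | |- D0 _ (fun x => @?f x = allIn (@?g x) (@?h x) (@?k x)) =>
      apply (D0_callIn _ f g h k); crd
  | |- D0 _ (fun x => emp ∊ @?f x) => apply (D0_emp_in _ f); crd
  | |- _ => d0_end3
  end.
Ltac d0_leaf ::= d0_end4.

Section Evidence1.
Context {M : structure} {SM : SetModel M}.
Implicit Types x y z m n a b c t u i j k e p q A Y Z W : M.

Lemma D0_allpair {X} (r : list (X -> M)) f (P : X -> M -> M -> Prop) : Crd r f ->
  D0 (lift (lift (lift r))) (fun xab => P (fst (fst (fst xab))) (snd (fst xab)) (snd xab)) ->
  D0 r (fun x : X => forall a b, f x = pr a b -> P x a b).
Proof.
  intros Hf HP.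
  apply (D0_iff r (fun x : X => ~ exists a b, f x = pr a b /\ ~ P x a b)).
  - intros x. split.
    + intros H a b E. apply NNPP. intros N. apply H. eauto.
    + intros H (a & b & E & N). auto.
  - apply D0_not, D0_expair; auto. d0. exact HP.
Qed.

Lemma D0_Agree {X} (r : list (X -> M)) (f g h k : X -> M) :
  Crd r f -> Crd r g -> Crd r h -> Crd r k ->
  D0 r (fun x : X => Agree (f x) (g x) (h x) (k x)).
Proof.
  intros. apply (D0_iff r (fun x : X => forall i, i ∊ f x -> i = g x \/
    exists v, App (h x) i v /\ App (k x) i v)).
  - intros x. unfold Agree. split; intros L i Hi.
    + intros N. destruct (L i Hi); easy.
    + destruct (classic (i = g x)); auto.
  - d0.
Qed.

End Evidence1.

Ltac d0_end5 := lazymatch goal with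
  | |- D0 _ (fun x => Agree (@?f x) (@?g x) (@?h x) (@?k x)) => apply (D0_Agree _ f g h k); crd
  | |- D0 _ (fun x => forall q t, @?f x = pr q t -> @?P x q t) =>
      apply (D0_allpair _ f P); [crd|]
  | |- _ => d0_end4
  end.
Ltac d0_leaf ::= d0_end5.

Section Evidence2.
Context {M : structure} {SM : SetModel M}.
Implicit Types x y z m n a b c t u i j k e p q A Y Z W : M.

Lemma D0_EStep {X} (r : list (X -> M)) (n A g s j p Y : X -> M) :
  Crd r n -> Crd r A -> Crd r g -> Crd r s -> Crd r j -> Crd r p -> Crd r Y ->
  D0 r (fun x : X => EStep (n x) (A x) (g x) (s x) (j x) (p x) (Y x)).
Proof. intros. unfold EStep, Sep. d0. Qed.

End Evidence2.

Ltac d0_end6 := lazymatch goal with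
  | |- D0 _ (fun x => EStep (@?n x) (@?A x) (@?g x) (@?s x) (@?j x) (@?p x) (@?Y x)) =>
      apply (D0_EStep _ n A g s j p Y); crd
  | |- _ => d0_end5
  end.
Ltac d0_leaf ::= d0_end6.

Section Evidence3.
Context {M : structure} {SM : SetModel M}.
Implicit Types x y z m n a b c f t u i j k e p q A Y Z W : M.

Lemma D0_Evidence {X} (r : list (X -> M)) (w p n : X -> M) :
  Crd r w -> Crd r p -> Crd r n -> D0 r (fun x : X => Evidence (w x) (p x) (n x)).
Proof. intros. unfold Evidence, values_in, updatable, Ev0. d0. Qed.

Lemma Evidence_mono w w' p n : (forall x, x ∊ w -> x ∊ w') -> Evidence w p n -> Evidence w' p n.
Proof.
  intros H (z & Hz & A & HA & m & Hm & g & Hg & s & Hs & R1 & R2 & R3 & R4 & i & Hi & R5 &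
    Y & R6 & a & R7 & R8 & o & Ho & Eo & u & Hu & R9).
  exists z; split; auto. exists A; split; auto. exists m; split; auto. exists g; split; auto.
  exists s; split; auto. do 4 (split; auto). exists i; split; auto. split; auto.
  exists Y; split; auto. exists a; split; auto. split; auto.
  exists o. split; auto. split; auto. eauto.
Qed.

(** ** Evidence is correct for standard formulas *)

Lemma ev0_truth z n A m g s : Trans z -> values_in n z A -> updatable n z A -> Ev0 n A m g s ->
  forall p : form, Delta0 p -> forall i Y, i ∊ m -> App g i (cd p) -> App s i Y ->
  forall a, a ∊ A -> forall rho, (forall v, free v p = true -> num v ∊ n /\ App a (num v) (rho v)) ->
    (a ∊ Y <-> holds Univ rho p).
Proof.
  intros Tz HV HU (Nm & Fg & Fs & Hs) p Dp. induction Dp as [x y|x y|p Dp IHDp|p q Dp1 IHDp1 Dp2 IHDp2|x y p Nxy Dp IHDp];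
    intros i Y Hi Hg HY a Ha rho Hr;
    pose proof (Hs i Hi _ Hg Y HY) as H;
    assert (Fa : Fun a n) by now apply HV.
  - destruct H as [H|[H|[H|[H|H]]]].
    2: destruct H as (x' & Hx & y' & Hy & E & H); code_inv E.
    2: destruct H as (k & Hk & q & Hq & E & H); code_inv E.
    2: destruct H as (k & Hk & q & Hq & k' & Hk' & r & _ & E & H); code_inv E.
    2: destruct H as (x' & Hx & y' & Hy & N & k & Hk & q & Hq & E & H); code_inv E.
    destruct H as (x' & Hx & y' & Hy & E & H1 & H2). code_inv E. apply pr_inj in E as [<- <-].
    simpl in *.
    destruct (Hr x) as [_ R1]; [now rewrite Nat.eqb_refl|].
    destruct (Hr y) as [_ R2]; [now rewrite Nat.eqb_refl, orb_true_r|].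
    split.
    + intros L. destruct (H1 a L) as (_ & u & U1 & v & U2 & L').
      now rewrite (Fun_functional _ _ _ _ _ Fa R1 U1), (Fun_functional _ _ _ _ _ Fa R2 U2).
    + intros L. apply H2; eauto.
  - destruct H as [H|[H|[H|[H|H]]]].
    1: destruct H as (x' & Hx & y' & Hy & E & H); code_inv E.
    2: destruct H as (k & Hk & q & Hq & E & H); code_inv E.
    2: destruct H as (k & Hk & q & Hq & k' & Hk' & r & _ & E & H); code_inv E.
    2: destruct H as (x' & Hx & y' & Hy & N & k & Hk & q & Hq & E & H); code_inv E.
    destruct H as (x' & Hx & y' & Hy & E & H1 & H2). code_inv E. apply pr_inj in E as [<- <-].
    simpl in *.
    destruct (Hr x) as [_ R1]; [now rewrite Nat.eqb_refl|].
    destruct (Hr y) as [_ R2]; [now rewrite Nat.eqb_refl, orb_true_r|].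
    split.
    + intros L. destruct (H1 a L) as (_ & u & U1 & v & U2 & L').
      now rewrite (Fun_functional _ _ _ _ _ Fa R1 U1), (Fun_functional _ _ _ _ _ Fa R2 U2).
    + intros L. apply H2; eauto.
  - destruct H as [H|[H|[H|[H|H]]]].
    1, 2: destruct H as (x' & Hx & y' & Hy & E & H); code_inv E.
    2: destruct H as (k & Hk & q & Hq & k' & Hk' & r & _ & E & H); code_inv E.
    2: destruct H as (x' & Hx & y' & Hy & N & k & Hk & q & Hq & E & H); code_inv E.
    destruct H as (k & Hk & q & Hq & E & Z & HZ & H1 & H2). code_inv E. subst q.
    assert (Hkm : k ∊ m) by exact (Nat_Trans _ Nm i Hi k Hk).
    simpl. rewrite <- (IHDp k Z Hkm Hq HZ a Ha rho Hr).
    split; [apply H1|auto].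
  - destruct H as [H|[H|[H|[H|H]]]].
    1, 2: destruct H as (x' & Hx & y' & Hy & E & H); code_inv E.
    1: destruct H as (k & Hk & q' & Hq & E & H); code_inv E.
    2: destruct H as (x' & Hx & y' & Hy & N & k & Hk & q' & Hq & E & H); code_inv E.
    destruct H as (k & Hk & q' & Hq & k' & Hk' & r & Hr' & E & Z & HZ & W & HW & H1 & H2).
    code_inv E. apply pr_inj in E as [<- <-].
    assert (Hkm : k ∊ m) by exact (Nat_Trans _ Nm i Hi k Hk).
    assert (Hkm' : k' ∊ m) by exact (Nat_Trans _ Nm i Hi k' Hk').
    simpl. rewrite <- (IHDp1 k Z Hkm Hq HZ a Ha rho), <- (IHDp2 k' W Hkm' Hr' HW a Ha rho).
    + split.
      * intros L. apply H1 in L. tauto.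
      * intros L. apply H2; auto. tauto.
    + intros v Fv. apply Hr. simpl. now rewrite Fv, orb_true_r.
    + intros v Fv. apply Hr. simpl. now rewrite Fv.
  - destruct H as [H|[H|[H|[H|H]]]].
    1, 2: destruct H as (x' & Hx & y' & Hy & E & H'); code_inv E.
    1: destruct H as (k & Hk & q & Hq & E & H'); code_inv E.
    1: destruct H as (k & Hk & q & Hq & k' & Hk' & r & _ & E & H'); code_inv E.
    destruct H as (x' & Hx & y' & Hy & N & k & Hk & q & Hq & E & Z & HZ & H1 & H2).
    unfold allIn in E. code_inv E. apply pr_inj in E as [<- E]. apply pr_inj in E as [_ E].
    apply pr_inj in E as [E <-]. apply pr_inj in E as [_ E]. apply pr_inj in E as [_ <-].
    assert (Hkm : k ∊ m) by exact (Nat_Trans _ Nm i Hi k Hk).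
    simpl in Hr |- *.
    destruct (Hr y) as [_ R2].
    { rewrite Nat.eqb_refl, orb_true_r, andb_true_r.
      now apply negb_true_iff, Nat.eqb_neq. }
    assert (IH : forall b u, b ∊ A -> App b (num x) u -> Agree n (num x) a b ->
       (b ∊ Z <-> holds Univ (upd rho x u) p)).
    { intros b u HbA Hu Hag. apply (IHDp k Z Hkm Hq HZ b HbA).
      intros v Fv. destruct (Nat.eq_dec v x) as [->|N'].
      - rewrite upd_same. auto.
      - rewrite upd_other by auto. destruct (Hr v) as [Hv R].
        { rewrite Fv, orb_true_r, andb_true_r. apply negb_true_iff, Nat.eqb_neq. auto. }
        split; auto.
        destruct (Hag (num v) Hv) as (w & W1 & W2). { intros E%num_inj. auto. }
        now rewrite (Fun_functional _ _ _ _ _ Fa R W1). }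
    assert (By : forall b v, Agree n (num x) a b -> Fun b n -> App b (num y) v -> v = rho y).
    { intros b v Hag Fb Hv. destruct (Hag (num y) Hy) as (w & W1 & W2).
      { intros E. apply N. auto. }
      rewrite (Fun_functional _ _ _ _ _ Fb Hv W2). exact (Fun_functional _ _ _ _ _ Fa W1 R2). }
    split.
    + intros L u _. rewrite upd_same, upd_other by auto. intros Huy.
      destruct (H1 a L) as [_ L'].
      (* However small [z] is, it contains the value of the bound, so by transitivity it contains
         every [u] that the quantifier speaks of. *)
      assert (Hu : u ∊ z).
      { apply (Tz (rho y)); auto. apply (proj2 (HV a Ha) (num y) Hy); auto. }
      destruct (HU a Ha (num x) Hx u Hu) as (b & HbA & B1 & B2).
      apply (IH b u HbA B1 B2).
      destruct (L' b HbA) as [NA|L'']; [now destruct NA|].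
      destruct (B2 (num y) Hy) as (v & V1 & V2). { intros E. apply N. auto. }
      assert (v = rho y) by (apply (By b); auto; apply HV; auto). subst v.
      destruct (L'' u B1 (rho y) V2); auto. easy.
    + intros L. apply H2; auto. intros b HbA.
      destruct (classic (Agree n (num x) a b)) as [Hag|]; [right|now left].
      intros u Hu v Hv. destruct (classic (u ∊ v)) as [Huv|]; [right|now left].
      apply (IH b u HbA Hu Hag). apply L; [easy|].
      rewrite upd_same, upd_other by auto.
      assert (v = rho y) by (apply (By b); auto; apply HV; auto). now subst v.
Qed.
End Evidence3.

(** ** Existence of evidence *)

Section Existence.
Context {M : structure} {SM : SetModel M} (D : M -> Prop) (K : KPclass D).
Implicit Types x y z m n a b c f g t s u i j e p q A Y Z W : M.
Let DT : transitive_class D := kp_trans D K.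
Let DC : closed D := kp_closed D K.

Lemma assignments_exist z : D z -> emp ∊ z -> forall n, D n -> Nat n ->
  exists A, D A /\ values_in n z A /\ updatable n z A /\
    exists a, a ∊ A /\ forall i, i ∊ n -> exists v, App a i v /\ v = emp.
Proof.
  intros Dz Hz.
  apply (nat_ind1 D K [z] (fun n A => values_in n z A /\ updatable n z A /\
    exists a, a ∊ A /\ forall i, i ∊ n -> exists v, App a i v /\ v = emp)).
  - repeat constructor; auto.
  - unfold consts, values_in, updatable; cbn [map]. d0.
  (* The only assignment on no variables is ∅, and [num 1] is {∅}. *)
  - exists (num 1). split; [now apply (closed_num D)|]. repeat split.
    + intros p Hp. apply num_spec in H as (j & Hj & ->). replace j with 0 in Hp by lia.
      now apply emp_spec in Hp.
    + now intros x Hx%emp_spec.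
    + now intros x Hx%emp_spec.
    + now intros i Hi%emp_spec.
    + now intros a _ i Hi%emp_spec.
    + exists emp. split; [apply num_spec; exists 0; auto|]. now intros i Hi%emp_spec.
  - intros n Dn Nn (A & DA & HV & HU & c & Hc & Hcv).
    assert (Irr : ~ n ∊ n) by now apply (kp_irrefl D K).
    destruct (image2 D K (fun n a u => adj a (pr n u)) n A z) as (B & DB & HB); auto.
    { intros X r f g1 g2 g3 C C1 C2 C3.
      apply (D0_iff r (fun x : X => (forall w, w ∊ f x -> w ∊ g2 x \/ w = pr (g1 x) (g3 x)) /\
        (forall w, w ∊ g2 x -> w ∊ f x) /\ exists w, w ∊ f x /\ w = pr (g1 x) (g3 x))); [|d0].
      intros x. split.
      - intros (L1 & L2 & w & L3 & ->). apply ext. intros v. rewrite adj_spec. split; auto.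
        intros [L| ->]; auto.
      - intros ->. repeat split; intros; rewrite ?adj_spec in *; auto.
        eexists. rewrite adj_spec. eauto. }
    { intros. apply (closed_adj D); auto. now apply (closed_pr D). }
    assert (EX : forall a u, a ∊ A -> Fun (adj a (pr n u)) (suc n) /\
      forall i v, App (adj a (pr n u)) i v <-> App a i v \/ i = n /\ v = u).
    { intros a u Ha. apply extend_fun; auto. now apply HV. }
    exists B. split; auto. split; [|split].
    + intros b Hb. apply HB in Hb as (a & Ha & u & Hu & ->).
      destruct (EX a u Ha) as [F E]. split; auto. intros i Hi v Hv.
      apply E in Hv as [Hv|[-> ->]]; auto. apply (proj2 (HV a Ha) i); auto.
      eapply Fun_dom; eauto. now apply HV.
    + intros b Hb i Hi w Hw. apply HB in Hb as (a & Ha & u & Hu & ->).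
      destruct (EX a u Ha) as [F E].
      destruct (classic (i = n)) as [->|N].
      * exists (adj a (pr n w)). destruct (EX a w Ha) as [F' E']. split; [|split].
        -- apply HB. eauto.
        -- apply E'. auto.
        -- intros j Hj N. apply suc_spec in Hj as [Hj|]; [|easy].
           destruct (proj1 (proj2 (proj1 (HV a Ha))) j Hj) as [v Hv].
           exists v. split; [apply E|apply E']; auto.
      * apply suc_spec in Hi as [Hi|]; [|easy].
        destruct (HU a Ha i Hi w Hw) as (a' & Ha' & V1 & V2).
        destruct (EX a' u Ha') as [F' E']. exists (adj a' (pr n u)). split; [|split].
        -- apply HB. eauto.
        -- apply E'. auto.
        -- intros j Hj N'. apply suc_spec in Hj as [Hj| ->].
           ++ destruct (V2 j Hj N') as (v & W1 & W2).
              exists v. split; [apply E|apply E']; auto.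
           ++ exists u. split; [apply E|apply E']; auto.
    + exists (adj c (pr n emp)). split; [apply HB; eauto|].
      intros i Hi. exists emp. split; auto. apply (EX c emp Hc).
      apply suc_spec in Hi as [Hi| ->]; auto.
      destruct (Hcv i Hi) as (v & Hv & ->). auto.
Qed.

Lemma EStep_extend n A g s j p Y x : EStep n A g s j p Y -> EStep n A g (adj s x) j p Y.
Proof.
  assert (E : forall k Z, App s k Z -> App (adj s x) k Z).
  { intros k Z HZ. apply adj_spec. auto. }
  intros [H|[H|[H|[H|H]]]].
  - now left.
  - right; now left.
  - right; right; left. destruct H as (k & Hk & q & Hq & E1 & Z & HZ & H).
    exists k. split; auto. exists q. split; auto. split; auto. eauto.
  - right; right; right; left.
    destruct H as (k & Hk & q & Hq & k' & Hk' & r & Hr & E1 & Z & HZ & W & HW & H).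
    exists k. split; auto. exists q. split; auto. exists k'. split; auto. exists r. split; auto.
    split; auto. exists Z. split; auto. eauto.
  - right; right; right; right.
    destruct H as (x' & Hx & y & Hy & N & k & Hk & q & Hq & E1 & Z & HZ & H).
    exists x'. split; auto. exists y. split; auto. split; auto. exists k. split; auto.
    exists q. split; auto. split; auto. eauto.
Qed.

Lemma Sep_exists cs A (Q : M -> Prop) : Forall D cs -> D A ->
  D0 ((fun x => x) :: consts cs) Q -> exists Y, D Y /\ Sep A Y Q.
Proof.
  intros Hc DA HQ. destruct (kp_sep D K cs Q A Hc DA HQ) as (Y & DY & HY).
  exists Y. split; auto. split; intros a; rewrite HY; tauto.
Qed.

(** The length [m] may be nonstandard, so [s] is extended along [g] by Σ₁-induction inside [D], each
    new value being separated from [A]. Lengths beyond [m] are left unconstrained and get the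
    default [emp]. *)
Lemma Ev0_exists n A m g : D n -> D A -> D m -> D g -> Nat m -> Fun g m ->
  (forall j, j ∊ m -> forall p, App g j p ->
     Delta0Step D (fun x => x ∊ n) (fun e => exists k, k ∊ j /\ App g k e) p) ->
  exists s, D s /\ Ev0 n A m g s.
Proof.
  intros Dn DA Dm Dg Nm Fg Hg.
  assert (H : forall i, D i -> Nat i -> exists s, D s /\ (i ∊ m \/ i = m ->
    Fun s i /\ forall j, j ∊ i -> forall p, App g j p -> forall Y, App s j Y ->
      EStep n A g s j p Y)).
  { apply (nat_ind1 D K [m; g; n; A] (fun i s => i ∊ m \/ i = m ->
      Fun s i /\ forall j, j ∊ i -> forall p, App g j p -> forall Y, App s j Y ->
        EStep n A g s j p Y)).
    - repeat constructor; auto.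
    - unfold consts; cbn [map]. d0.
    - exists emp. split; [now apply (kp_emp D)|]. intros _. split; [apply Fun_emp|].
      now intros j Hj%emp_spec.
    - intros i Di Ni (s & Ds & IH).
      destruct (classic (i ∊ m)) as [Him|Him].
      2: { exists emp. split; [now apply (kp_emp D)|]. intros Hi. exfalso. apply Him.
           destruct Hi as [Hi| <-].
           - apply (Nat_Trans _ Nm _ Hi), suc_spec; auto.
           - apply suc_spec; auto. }
      destruct IH as [Fs Hs]; auto.
      destruct (proj1 (proj2 Fg) i Him) as [p Hp].
      assert (Dp : D p) by exact (proj2 (App_class D _ _ _ DT Dg Hp)).
      assert (Val : forall k, k ∊ i -> exists Z, D Z /\ App s k Z).
      { intros k Hk. destruct (proj1 (proj2 Fs) k Hk) as [Z HZ]. exists Z. split; auto.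
        exact (proj2 (App_class D _ _ _ DT Ds HZ)). }
      assert (HY : exists Y, D Y /\ EStep n A g s i p Y).
      { destruct (Hg i Him p Hp) as [H|[H|[H|H]]].
        - destruct H as (x & Dx & y & Dy & Hx & Hy & [E|E]).
          + destruct (Sep_exists [x; y] A (fun a => exists u, App a x u /\
              exists v, App a y v /\ u ∊ v)) as (Y & DY & HY); auto.
            { unfold consts; cbn [map]. d0. }
            exists Y. split; auto. left. exists x. split; auto. exists y. auto.
          + destruct (Sep_exists [x; y] A (fun a => exists u, App a x u /\
              exists v, App a y v /\ u = v)) as (Y & DY & HY); auto.
            { unfold consts; cbn [map]. d0. }
            exists Y. split; auto. right; left. exists x. split; auto. exists y. auto.
        - destruct H as (q & Dq & (k & Hk & Hq) & E). destruct (Val k Hk) as (Z & DZ & HZ).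
          destruct (Sep_exists [Z] A (fun a => ~ a ∊ Z)) as (Y & DY & HY); auto.
          { unfold consts; cbn [map]. d0. }
          exists Y. split; auto. right; right; left. exists k. split; auto.
          exists q. split; auto. split; auto. eauto.
        - destruct H as (q & Dq & r & Dr & (k & Hk & Hq) & (k' & Hk' & Hr) & E).
          destruct (Val k Hk) as (Z & DZ & HZ). destruct (Val k' Hk') as (W & DW & HW).
          destruct (Sep_exists [Z; W] A (fun a => ~ a ∊ Z \/ a ∊ W)) as (Y & DY & HY); auto.
          { unfold consts; cbn [map]. d0. }
          exists Y. split; auto. right; right; right; left. exists k. split; auto.
          exists q. split; auto. exists k'. split; auto. exists r. split; auto. split; auto.
          exists Z. split; auto. eauto.
        - destruct H as (x & Dx & y & Dy & q & Dq & Hx & Hy & N & (k & Hk & Hq) & E).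
          destruct (Val k Hk) as (Z & DZ & HZ).
          destruct (Sep_exists [n; x; y; Z; A] A (fun a => forall b, b ∊ A -> ~ Agree n x a b \/
            forall u, App b x u -> forall v, App b y v -> ~ u ∊ v \/ b ∊ Z)) as (Y & DY & HY); auto.
          { repeat constructor; auto. }
          { unfold consts; cbn [map]. d0. }
          exists Y. split; auto. right; right; right; right. exists x. split; auto.
          exists y. split; auto. split; auto. exists k. split; auto. exists q. split; auto.
          split; auto. eauto. }
      destruct HY as (Y & DY & HY).
      assert (Irr : ~ i ∊ i) by now apply (kp_irrefl D K).
      destruct (extend_fun s i i Y Fs Irr) as [Fs' HA].
      exists (adj s (pr i Y)). split.
      { apply (closed_adj D); auto. now apply (closed_pr D). }
      intros _. split; auto. intros j Hj q Hq Z HZ. apply EStep_extend.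
      apply suc_spec in Hj as [Hj| ->].
      + apply HA in HZ as [HZ|[-> _]]; [auto|easy].
      + rewrite (Fun_functional _ _ _ _ _ Fg Hq Hp).
        apply HA in HZ as [HZ|[_ ->]]; auto.
        apply (Fun_dom _ _ _ _ Fs) in HZ. easy. }
  destruct (H m Dm Nm) as (s & Ds & R). destruct R as [Fs R]; auto.
  exists s. split; auto. split; auto.
Qed.
End Existence.

(** ** Evidence compared with satisfaction *)

Section Comparison.
Context {M : structure} {SM : SetModel M}.
Implicit Types x y z m n a b c f g t s u i j e p q A Y Z W : M.

Lemma EvStep_mem n A ear x y Y : EvStep Univ n A ear (pr (mem x y) Y) ->
  x ∊ n /\ y ∊ n /\ forall a, a ∊ Y <-> a ∊ A /\ exists u, App a x u /\ exists v, App a y v /\ u ∊ v.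
Proof.
  intros (p & _ & Y' & _ & [E0 <-]%pr_inj & [H|[H|[H|[H|H]]]]); subst p.
  2: destruct H as (x' & Hx & y' & Hy & E & H); code_inv E.
  2: destruct H as (q & _ & Z & _ & _ & E & H); code_inv E.
  2: destruct H as (q & _ & Z & _ & r & _ & W & _ & _ & _ & E & H); code_inv E.
  2: destruct H as (x' & Hx & q & _ & Z & _ & _ & E & H); code_inv E.
  destruct H as (x' & Hx & y' & Hy & E & H). code_inv E. apply pr_inj in E as [-> ->].
  do 2 (split; auto). intros a. rewrite (H a I). unfold Univ. firstorder.
Qed.

Lemma EvStep_eql n A ear x y Y : EvStep Univ n A ear (pr (eql x y) Y) ->
  x ∊ n /\ y ∊ n /\ forall a, a ∊ Y <-> a ∊ A /\ exists u, App a x u /\ exists v, App a y v /\ u = v.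
Proof.
  intros (p & _ & Y' & _ & [E0 <-]%pr_inj & [H|[H|[H|[H|H]]]]); subst p.
  1: destruct H as (x' & Hx & y' & Hy & E & H); code_inv E.
  2: destruct H as (q & _ & Z & _ & _ & E & H); code_inv E.
  2: destruct H as (q & _ & Z & _ & r & _ & W & _ & _ & _ & E & H); code_inv E.
  2: destruct H as (x' & Hx & q & _ & Z & _ & _ & E & H); code_inv E.
  destruct H as (x' & Hx & y' & Hy & E & H). code_inv E. apply pr_inj in E as [-> ->].
  do 2 (split; auto). intros a. rewrite (H a I). unfold Univ. firstorder.
Qed.

Lemma EvStep_neg n A ear q Y : EvStep Univ n A ear (pr (neg q) Y) ->
  exists Z, ear (pr q Z) /\ forall a, a ∊ Y <-> a ∊ A /\ ~ a ∊ Z.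
Proof.
  intros (p & _ & Y' & _ & [E0 <-]%pr_inj & [H|[H|[H|[H|H]]]]); subst p.
  1, 2: destruct H as (x' & Hx & y' & Hy & E & H); code_inv E.
  2: destruct H as (q' & _ & Z & _ & r & _ & W & _ & _ & _ & E & H); code_inv E.
  2: destruct H as (x' & Hx & q' & _ & Z & _ & _ & E & H); code_inv E.
  destruct H as (q' & _ & Z & _ & (b & _ & Hb & ->) & E & H). code_inv E. subst q'.
  exists Z. split; auto. intros a. apply (H a I).
Qed.

Lemma EvStep_imp n A ear q r Y : EvStep Univ n A ear (pr (imp q r) Y) ->
  exists Z W, ear (pr q Z) /\ ear (pr r W) /\ forall a, a ∊ Y <-> a ∊ A /\ (a ∊ Z -> a ∊ W).
Proof.
  intros (p & _ & Y' & _ & [E0 <-]%pr_inj & [H|[H|[H|[H|H]]]]); subst p.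
  1, 2: destruct H as (x' & Hx & y' & Hy & E & H); code_inv E.
  1: destruct H as (q' & _ & Z & _ & _ & E & H); code_inv E.
  2: destruct H as (x' & Hx & q' & _ & Z & _ & _ & E & H); code_inv E.
  destruct H as (q' & _ & Z & _ & r' & _ & W & _ & (b & _ & Hb & ->) & (b' & _ & Hb' & ->) & E & H).
  code_inv E. apply pr_inj in E as [-> ->].
  exists Z, W. do 2 (split; auto). intros a. apply (H a I).
Qed.

Lemma EvStep_all n A ear x q Y : EvStep Univ n A ear (pr (all x q) Y) ->
  x ∊ n /\ exists Z, ear (pr q Z) /\
    forall a, a ∊ Y <-> a ∊ A /\ forall b, b ∊ A -> Agree n x a b -> b ∊ Z.
Proof.
  intros (p & _ & Y' & _ & [E0 <-]%pr_inj & [H|[H|[H|[H|H]]]]); subst p.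
  1, 2: destruct H as (x' & Hx & y' & Hy & E & H); code_inv E.
  1: destruct H as (q' & _ & Z & _ & _ & E & H); code_inv E.
  1: destruct H as (q' & _ & Z & _ & r' & _ & W & _ & _ & _ & E & H); code_inv E.
  destruct H as (x' & Hx & q' & _ & Z & _ & (b & _ & Hb & ->) & E & H).
  code_inv E. apply pr_inj in E as [-> ->].
  split; auto. exists Z. split; auto. intros a. rewrite (H a I).
  assert (Ag : forall b, AgreeOff Univ n x' a b <-> Agree n x' a b).
  { intros c. unfold AgreeOff, Agree, Univ. firstorder. }
  split; intros [H1 H2]; (split; [exact H1|]); intros c Hc Hag; apply H2; auto; apply Ag; auto.
Qed.

Context (K : KPclass (@Univ M)) (z l n n' A A' m m' g s s' : M).
Context (Tz : Trans z) (Hzl : forall x, x ∊ z -> x ∊ l).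
Context (HV : values_in n z A) (HU : updatable n z A).
Context (HV' : values_in n' l A') (HU' : updatable n' l A').
Context (Hev : Ev0 n A m g s) (Hev' : ev_seq n' A' m' s').

Definition compatible a a' : Prop :=
  forall i, i ∊ n -> i ∊ n' -> forall u, App a i u -> App a' i u.

(** For a nonstandard formula no induction on formulas is available; Δ₀-induction on the index [i]
    in the model replaces it. At a bounded quantifier the values taken in [l] already lie in [z],
    since the bound has its value in the transitive set [z]; hence the small domain suffices. *)
Lemma ev0_compare i : i ∊ m -> forall p, App g i p -> forall Y, App s i Y ->
  forall i', i' ∊ m' -> forall Y', App s' i' (pr p Y') ->
  forall a, a ∊ A -> forall a', a' ∊ A' -> compatible a a' -> (a ∊ Y <-> a' ∊ Y').
Proof.
  destruct Hev as (Nm & Fg & Fs & Hs). destruct Hev' as (Nm' & Fs' & Hs').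
  (* The same claim with compatibility unfolded and the pair at [i'] named, a shape that [d0]
     accepts as induction property. *)
  assert (Main : forall i, Univ i -> i ∊ m -> forall p, App g i p -> forall Y, App s i Y ->
    forall i', i' ∊ m' -> forall e, App s' i' e -> forall q Y', e = pr q Y' -> q = p ->
    forall a, a ∊ A -> forall a', a' ∊ A' ->
      (forall j, j ∊ n -> j ∊ n' -> forall u, App a j u -> App a' j u) -> (a ∊ Y <-> a' ∊ Y')).
  2: { intros Hi p Hp Y HY i' Hi' Y' HY' a Ha a' Ha' C. eapply Main; eauto. easy. }
  apply (kp_ind0 Univ K [m; g; s; m'; s'; A; A'; n; n'] (fun i => i ∊ m -> forall p, App g i p ->
    forall Y, App s i Y ->
    forall i', i' ∊ m' -> forall e, App s' i' e -> forall q Y', e = pr q Y' -> q = p ->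
    forall a, a ∊ A -> forall a', a' ∊ A' ->
      (forall j, j ∊ n -> j ∊ n' -> forall u, App a j u -> App a' j u) -> (a ∊ Y <-> a' ∊ Y'))).
  { repeat constructor. }
  { unfold consts; cbn [map]. d0. }
  clear i. intros i _ IH Hi p Hp Y HY i' Hi' e He q Y' -> -> a Ha a' Ha' C.
  assert (IH' : forall k, k ∊ i -> forall p, App g k p -> forall Z, App s k Z ->
     forall j', j' ∊ i' -> forall Z', App s' j' (pr p Z') ->
     forall a, a ∊ A -> forall a', a' ∊ A' -> compatible a a' -> (a ∊ Z <-> a' ∊ Z')).
  { intros k Hk r Hr Z HZ j' Hj' Z' HZ' b Hb b' Hb' Cb.
    apply (IH k Hk (Nat_Trans _ Nm i Hi k Hk) r Hr Z HZ j' (Nat_Trans _ Nm' i' Hi' j' Hj')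
      _ HZ' r Z' eq_refl eq_refl b Hb b' Hb' Cb). }
  clear IH.
  pose proof (Hs i Hi p Hp Y HY) as St. pose proof (Hs' i' Hi' _ He) as St'.
  assert (Fa : Fun a n) by now apply HV. assert (Fa' : Fun a' n') by now apply HV'.
  assert (Tr : forall x u, x ∊ n -> x ∊ n' -> App a x u <-> App a' x u).
  { intros x u Hx Hx'. split; [now apply C|]. intros Hu.
    destruct (proj1 (proj2 Fa) x Hx) as [v Hv].
    now rewrite (Fun_functional _ _ _ _ _ Fa' Hu (C x Hx Hx' v Hv)). }
  destruct St as [H|[H|[H|[H|H]]]].
  - destruct H as (x & Hx & y & Hy & -> & H1 & H2).
    apply EvStep_mem in St' as (Hx' & Hy' & H3). rewrite H3. split.
    + intros L. split; auto. destruct (H1 a L) as (_ & u & Hu & v & Hv & R).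
      exists u. split; [now apply Tr|]. exists v. split; [now apply Tr|auto].
    + intros (_ & u & Hu & v & Hv & R). apply H2; auto.
      exists u. split; [now apply Tr|]. exists v. split; [now apply Tr|auto].
  - destruct H as (x & Hx & y & Hy & -> & H1 & H2).
    apply EvStep_eql in St' as (Hx' & Hy' & H3). rewrite H3. split.
    + intros L. split; auto. destruct (H1 a L) as (_ & u & Hu & v & Hv & R).
      exists u. split; [now apply Tr|]. exists v. split; [now apply Tr|auto].
    + intros (_ & u & Hu & v & Hv & R). apply H2; auto.
      exists u. split; [now apply Tr|]. exists v. split; [now apply Tr|auto].
  - destruct H as (k & Hk & q & Hq & -> & Z & HZ & H1 & H2).
    apply EvStep_neg in St' as (Z' & (j' & Hj' & HZ') & H3). rewrite H3.
    rewrite <- (IH' k Hk q Hq Z HZ j' Hj' Z' HZ' a Ha a' Ha' C). split.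
    + intros L. split; auto. now apply H1.
    + intros [_ L]. now apply H2.
  - destruct H as (k & Hk & q & Hq & k1 & Hk1 & r & Hr & -> & Z & HZ & W & HW & H1 & H2).
    apply EvStep_imp in St' as (Z' & W' & (j' & Hj' & HZ') & (j1 & Hj1 & HW') & H3). rewrite H3.
    rewrite <- (IH' k Hk q Hq Z HZ j' Hj' Z' HZ' a Ha a' Ha' C).
    rewrite <- (IH' k1 Hk1 r Hr W HW j1 Hj1 W' HW' a Ha a' Ha' C). split.
    + intros L. split; auto. apply H1 in L. tauto.
    + intros [_ L]. apply H2; auto. tauto.
  - destruct H as (x & Hx & y & Hy & N & k & Hk & q & Hq & -> & Z & HZ & H1 & H2).
    unfold allIn in St'.
    (* A bounded quantifier is coded by [all], [imp] and [mem], so the sequence [s'] is followed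
       back from i' to j1 for the implication, then to j2 for its guard and to j3 for its matrix. *)
    apply EvStep_all in St' as (Hx' & Z1 & (j1 & Hj1 & HZ1) & H3). rewrite H3.
    assert (Hj1m : j1 ∊ m') by exact (Nat_Trans _ Nm' i' Hi' j1 Hj1).
    pose proof (Hs' j1 Hj1m _ HZ1) as St1.
    apply EvStep_imp in St1 as (Z2 & W & (j2 & Hj2 & HZ2) & (j3 & Hj3 & HW) & H4).
    assert (Hj2m : j2 ∊ m') by exact (Nat_Trans _ Nm' j1 Hj1m j2 Hj2).
    apply Hs' in HZ2; auto. apply EvStep_mem in HZ2 as (_ & Hy' & H5).
    assert (Hj3i : j3 ∊ i').
    { exact (Nat_Trans _ (Nat_elem _ _ Nm' Hi') j1 Hj1 j3 Hj3). }
    split.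
    + intros L. split; auto. apply H1 in L as [_ L]. intros b' Hb' Hag.
      apply H4. split; auto. intros Hb2. apply H5 in Hb2 as (_ & u & Hu & v & Hv & Huv).
      destruct (Hag y Hy') as (v1 & V1 & V2); [auto|].
      assert (Fb' : Fun b' n') by now apply HV'.
      rewrite (Fun_functional _ _ _ _ _ Fb' Hv V2) in *. clear Hv v.
      assert (V0 : App a y v1) by now apply Tr.
      assert (Huz : u ∊ z).
      { apply (Tz v1); auto. apply (proj2 (HV a Ha) y Hy); auto. }
      destruct (HU a Ha x Hx u Huz) as (b & Hb & B1 & B2).
      assert (Fb : Fun b n) by now apply HV.
      assert (Cb : compatible b b').
      { intros j Hj Hj' w Hw. destruct (classic (j = x)) as [->|Nj].
        - now rewrite (Fun_functional _ _ _ _ _ Fb Hw B1).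
        - destruct (B2 j Hj Nj) as (w1 & W1 & W2).
          rewrite (Fun_functional _ _ _ _ _ Fb Hw W2).
          destruct (Hag j Hj' Nj) as (w2 & W3 & W4).
          apply Tr in W1; auto. now rewrite (Fun_functional _ _ _ _ _ Fa' W1 W3). }
      apply (IH' k Hk q Hq Z HZ j3 Hj3i W HW b Hb b' Hb' Cb).
      destruct (L b Hb) as [NA|L']; [now destruct NA|].
      destruct (B2 y Hy) as (w & W1 & W2); [auto|].
      rewrite (Fun_functional _ _ _ _ _ Fa V0 W1) in *.
      destruct (L' u B1 w W2); easy.
    + intros [_ L]. apply H2; auto. intros b Hb.
      destruct (classic (Agree n x a b)) as [Hag|]; [right|now left].
      intros u Hu v Hv. destruct (classic (u ∊ v)) as [Huv|]; [right|now left].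
      assert (Fb : Fun b n) by now apply HV.
      assert (Huz : u ∊ z) by (apply (proj2 (HV b Hb) x Hx); auto).
      destruct (HU' a' Ha' x Hx' u (Hzl u Huz)) as (b' & Hb' & B1 & B2).
      assert (Fb' : Fun b' n') by now apply HV'.
      assert (Cb : compatible b b').
      { intros j Hj Hj' w Hw. destruct (classic (j = x)) as [->|Nj].
        - now rewrite (Fun_functional _ _ _ _ _ Fb Hw Hu).
        - destruct (B2 j Hj' Nj) as (w1 & W1 & W2).
          destruct (Hag j Hj Nj) as (w2 & W3 & W4).
          rewrite (Fun_functional _ _ _ _ _ Fb Hw W4).
          apply Tr in W3; auto. now rewrite (Fun_functional _ _ _ _ _ Fa' W3 W1). }
      apply (IH' k Hk q Hq Z HZ j3 Hj3i W HW b Hb b' Hb' Cb).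
      specialize (L b' Hb' B2). apply H4 in L as [_ L]. apply L. apply H5. split; auto.
      exists u. split; auto. exists v. split; auto.
Qed.
End Comparison.

(** * The bounding formula *)

Definition fSep (A Y : nat) (Q : nat -> pre) : pre :=
  (∀' a ∈ Y, a ∈ A ⩓ Q a) ⩓ (∀' a ∈ A, Q a ⇒ a ∈ Y).
Definition fAgree (n x a b : nat) : pre :=
  ∀' i ∈ n, ∼ (i ≐ x) ⇒ ∃' v, app a i v ⩓ app b i v.
(** [D0] asserts a defining formula for one structure at a time. The bounding formula has to be the
    same in V and in all models of a theory, so its ingredients are written out explicitly. *)
Definition fEStep (n A g s j p Y : nat) : pre :=
  (∃' x ∈ n, ∃' y ∈ n, p ≗ (tvar x ∈ tvar y) ⩓
     fSep A Y (fun a => ∃' u, app a x u ⩓ ∃' v, app a y v ⩓ u ∈ v)) ⩔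
  (∃' x ∈ n, ∃' y ∈ n, p ≗ (tvar x ≐ tvar y) ⩓
     fSep A Y (fun a => ∃' u, app a x u ⩓ ∃' v, app a y v ⩓ u ≐ v)) ⩔
  (∃' k ∈ j, ∃' q, app g k q ⩓ p ≗ (∼ tvar q) ⩓ ∃' Z, app s k Z ⩓
     fSep A Y (fun a => ∼ (a ∈ Z))) ⩔
  (∃' k ∈ j, ∃' q, app g k q ⩓ ∃' l ∈ j, ∃' r, app g l r ⩓ p ≗ (tvar q ⇒ tvar r) ⩓
     ∃' Z, app s k Z ⩓ ∃' W, app s l W ⩓ fSep A Y (fun a => ∼ (a ∈ Z) ⩔ a ∈ W)) ⩔
  (∃' x ∈ n, ∃' y ∈ n, ∼ (x ≐ y) ⩓ ∃' k ∈ j, ∃' q, app g k q ⩓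
     p ≗ allIn (tvar x) (tvar y) (tvar q) ⩓ ∃' Z, app s k Z ⩓
     fSep A Y (fun a => ∀' b ∈ A, ∼ fAgree n x a b ⩔
       ∀' u, app b x u ⇒ ∀' v, app b y v ⇒ ∼ (u ∈ v) ⩔ b ∈ Z)).
(** The set [w] of [Evidence] does not occur: it is the range of the unbounded quantifiers when the
    formula is evaluated in [w]. *)
Definition fEvidence (p n : nat) : pre :=
  ∃' z, ∃' A, ∃' m, ∃' g, ∃' s, isTrans z ⩓
    (∀' a ∈ A, isFun a n ⩓ ∀' i ∈ n, ∀' u, app a i u ⇒ u ∈ z) ⩓
    (∀' a ∈ A, ∀' i ∈ n, ∀' u ∈ z, ∃' b ∈ A, app b i u ⩓
       ∀' j ∈ n, ∼ (j ≐ i) ⇒ ∃' v, app a j v ⩓ app b j v) ⩓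
    (isNat m ⩓ isFun g m ⩓ isFun s m ⩓
       ∀' j ∈ m, ∀' q, app g j q ⇒ ∀' Y, app s j Y ⇒ fEStep n A g s j q Y) ⩓
    ∃' i ∈ m, app g i p ⩓ ∃' Y, app s i Y ⩓
      ∃' a ∈ A, a ∈ Y ⩓ ∃' o, isEmpty o ⩓ ∃' u, app a o u.

Section DenEvidence.
Context {M : structure} {SM : SetModel M} (D : M -> Prop) (DT : transitive_class D).

Lemma den_exApp rho d (f x : nat) a b (F : nat -> pre) (P : M -> Prop) :
  env D d rho -> f < d -> x < d -> rho f = a -> rho x = b ->
  (forall c, D c -> env D (S d) (upd rho d c) ->
     (holds D (upd rho d c) (F d (S d)) <-> P c)) ->
  (holds D rho (neg (bind (fun y : nat => neg (conj_ (Defs.app f x y) (F y)))) d) <->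
     exists c, App a b c /\ P c).
Proof.
  intros He Hf Hx <- <- H. pose proof (He f Hf) as Df.
  transitivity (exists c, D c /\ (App (rho f) (rho x) c /\ P c)).
  - eapply den_ex; [assumption|]. intros c Dc Hc. apply den_and; auto.
    leaf den_app.
  - split; [intros (c & _ & R); eauto|]. intros (c & H1 & H2). exists c.
    split; auto. exact (proj2 (App_class D _ _ _ DT Df H1)).
Qed.

Lemma den_allApp rho d (f x : nat) a b (F : nat -> pre) (P : M -> Prop) :
  env D d rho -> f < d -> x < d -> rho f = a -> rho x = b ->
  (forall c, D c -> env D (S d) (upd rho d c) ->
     (holds D (upd rho d c) (F d (S d)) <-> P c)) ->
  (holds D rho (bind (fun y : nat => imp (Defs.app f x y) (F y)) d) <->
     forall c, App a b c -> P c).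
Proof.
  intros He Hf Hx <- <- H. pose proof (He f Hf) as Df.
  transitivity (forall c, D c -> (App (rho f) (rho x) c -> P c)).
  - eapply den_all; [assumption|]. intros c Dc Hc. apply den_imp; auto.
    leaf den_app.
  - split; [|now auto]. intros R c H1. apply R; auto.
    exact (proj2 (App_class D _ _ _ DT Df H1)).
Qed.
End DenEvidence.

Ltac denx := repeat (cbv beta; lazymatch goal with
  | |- holds _ _ (@neg _ _ _ (bind (fun x => @neg _ _ _ (@conj_ _ _ _ (Defs.app _ _ x) _))) _) <-> _ =>
      eapply den_exApp; [assumption|assumption|lia|lia|den_side|den_side|intros ? ? ?]
  | |- holds _ _ (bind (fun x => @imp _ _ _ (Defs.app _ _ x) _) _) <-> _ =>
      eapply den_allApp; [assumption|assumption|lia|lia|den_side|den_side|intros ? ? ?]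
  | |- _ => den1
  end).

Section DenEvidence2.
Context {M : structure} {SM : SetModel M} (w : M) (Tw : Trans w).

Lemma Trans_class : transitive_class (fun x => x ∊ w).
Proof. intros x y Hx Hy. exact (Tw x Hx y Hy). Qed.

Lemma den_fEvidence rho d (p n : nat) : env (fun x => x ∊ w) d rho -> p < d -> n < d ->
  (holds (fun x => x ∊ w) rho (fEvidence p n d) <-> Evidence w (rho p) (rho n)).
Proof.
  intros He Hp Hn. pose proof Trans_class as DT.
  unfold fEvidence, Evidence, values_in, updatable, Ev0, fEStep, EStep, fSep, Sep,
    fAgree, Agree.
  denx.
Qed.
End DenEvidence2.

(** ** Sentences and formulas inside a set *)

(** Quantifying over all variables from [k] on controls the free variables of a large formula
    without computing them. By [holds_close_from] the truth value is unaffected if it depends only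
    on the variables below [k]. *)
Fixpoint close_from (k n : nat) (p : form) : form :=
  match n with 0 => p | S n => All (k + n) (close_from k n p) end.

Lemma free_close_from k n p v :
  free v (close_from k n p) = true -> free v p = true /\ (v < k \/ k + n <= v).
Proof.
  induction n as [|n IH]; simpl.
  - intros H. split; auto. lia.
  - rewrite andb_true_iff, negb_true_iff, Nat.eqb_neq. intros [H1 H2].
    apply IH in H2. split; [tauto|]. lia.
Qed.

Lemma holds_close_from {M : structure} (D : M -> Prop) k n p rho :
  (forall v, D (rho v)) ->
  (forall sigma, (forall v, D (sigma v)) -> (forall v, v < k -> sigma v = rho v) ->
     (holds D sigma p <-> holds D rho p)) ->
  (holds D rho (close_from k n p) <-> holds D rho p).
Proof.
  intros Hr Hp.
  assert (A : forall sigma, (forall v, D (sigma v)) -> (forall v, v < k -> sigma v = rho v) ->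
    (holds D sigma (close_from k n p) <-> holds D rho p)).
  { induction n as [|n IH]; simpl; auto. intros sigma Hs Hk. split.
    - intros H. apply (IH (upd sigma (k + n) (sigma 0))); auto.
      + intros v. unfold upd. destruct (v =? k + n); auto.
      + intros v Hv. rewrite upd_other by lia. auto.
    - intros H a Da. apply IH; auto.
      + intros v. unfold upd. destruct (v =? k + n); auto.
      + intros v Hv. rewrite upd_other by lia. auto. }
  apply A; auto.
Qed.

Lemma free_rel z p v : free v (rel z p) = true -> v = z \/ free v p = true.
Proof.
  induction p; simpl; auto.
  - rewrite !orb_true_iff. tauto.
  - intros H.
    assert (G : free v (All x (Imp (Mem x z) (rel z p))) = true ->
      v = z \/ negb (x =? v) && free v p = true).
    { simpl. rewrite !andb_true_iff, !orb_true_iff, !negb_true_iff, !Nat.eqb_eq, Nat.eqb_neq.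
      intros [H1 [[H2|H2]|H2]]; [easy|now left|]. apply IHp in H2. tauto. }
    destruct p; auto. destruct p1; auto.
    destruct (_ && _) eqn:E; auto.
    apply andb_true_iff in E as [E1 E2]. apply Nat.eqb_eq in E1. subst x0.
    simpl in H, IHp |- *. rewrite !andb_true_iff, !orb_true_iff, !negb_true_iff in *.
    rewrite ?Nat.eqb_eq, ?Nat.eqb_neq in *. tauto.
Qed.

(** [p] holds in (x,∈), where [x] is the value of variable 0, a nonempty transitive set. *)
Definition in_set (p : form) : form :=
  let p := close_from 0 (fresh p) p in
  let z := S (fresh p) in
  rename (swap 0 z) (conj_ (exIn (S z) z (Eql (S z) (S z))) (conj_ (isTrans z (S z)) (rel z p))).

Lemma in_set_unary p : unary (in_set p).
Proof.
  intros v H. unfold in_set in H.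
  set (q := close_from 0 (fresh p) p) in *. set (z := S (fresh q)) in *.
  apply free_rename in H as (x & -> & Hx); [|apply inj_on_inj; apply swap_inj].
  enough (x = z) as ->. { unfold swap. now rewrite Nat.eqb_refl. }
  cbn [free conj_ form_syntax neg imp] in Hx. rewrite !orb_true_iff in Hx.
  destruct Hx as [Hx|[Hx|Hx]].
  - cbn -[Nat.eqb] in Hx.
    rewrite ?andb_true_iff, ?orb_true_iff, ?negb_true_iff, ?Nat.eqb_eq, ?Nat.eqb_neq in Hx. lia.
  - cbn -[Nat.eqb] in Hx.
    rewrite ?andb_true_iff, ?orb_true_iff, ?andb_true_iff, ?orb_true_iff, ?negb_true_iff,
      ?Nat.eqb_eq, ?Nat.eqb_neq in Hx. lia.
  - apply free_rel in Hx as [Hx|Hx]; auto. apply free_close_from in Hx as [Hx Hl].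
    apply free_fresh in Hx. lia.
Qed.

Lemma in_set_Delta0 p : Delta0 (in_set p).
Proof.
  unfold in_set. set (q := close_from 0 (fresh p) p) in *. set (z := S (fresh q)) in *.
  apply Delta0_rename; [apply swap_inj|].
  repeat constructor; try lia. apply rel_Delta0, occurs_fresh. lia.
Qed.

(** Nonemptiness matters because the closing quantifiers of [close_from] would be vacuously true
    over the empty set. The meaning of [p] need only be known for transitive [x], since [in_set]
    asserts transitivity. *)
Lemma holds_in_set {M : structure} {SM : SetModel M} p (x : M) (P : Prop) :
  (Trans x -> forall rho, (forall v, rho v ∊ x) -> (holds (fun y => y ∊ x) rho p <-> P)) ->
  (holds Univ (fun _ => x) (in_set p) <-> (exists y, y ∊ x) /\ Trans x /\ P).
Proof.
  intros HP. unfold in_set.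
  set (q := close_from 0 (fresh p) p). set (z := S (fresh q)).
  rewrite holds_rename by (apply inj_on_inj; apply swap_inj).
  assert (HT : holds Univ (fun _ => x) (isTrans z (S z)) <-> Trans x).
  { apply (den_isTrans Univ (fun a b _ _ => I) (fun _ => x)); [easy|lia]. }
  assert (HE : holds Univ (fun _ => x) (exIn (S z) z (Eql (S z) (S z))) <-> exists y, y ∊ x).
  { cbn [exIn allIn all imp neg mem form_syntax holds]. split.
    - intros H. apply NNPP. intros N. apply H. intros y _ Hy _. apply N. exists y.
      now rewrite upd_same, upd_other in Hy by lia.
    - intros (y & Hy) N. apply (N y I); auto. now rewrite upd_same, upd_other by lia. }
  assert (HR : (exists y, y ∊ x) -> Trans x -> (holds Univ (fun _ => x) (rel z q) <-> P)).
  { intros (o & Ho) T.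
    assert (F : forall v, free v q = true -> False).
    { intros v Hv. apply free_close_from in Hv as [Hv Hl]. apply free_fresh in Hv. lia. }
    assert (Hz : occurs z q = false) by (apply occurs_fresh; unfold z; lia).
    rewrite (holds_ext Univ (rel z q) _ (upd (fun _ => o) z x)).
    2: { intros v Hv. apply free_rel in Hv as [->|Hv]; [|now apply F in Hv].
         now rewrite upd_same. }
    rewrite holds_rel; auto; rewrite ?upd_same.
    - rewrite (holds_ext _ q _ (fun _ => o)) by (intros v Hv; now apply F in Hv).
      unfold q. rewrite holds_close_from; auto.
      intros sigma Hs _. rewrite (HP T sigma), (HP T); tauto.
    - now apply Trans_class.
    - intros v Hv. now apply F in Hv. }
  cbn [conj_ form_syntax neg imp holds]. cbn [exIn allIn all imp neg mem form_syntax holds] in HE.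
  rewrite HT. tauto.
Qed.

(** The formula with code 0 is Δ₀ with its variables in 2, it is unary, and "it
    has a witness in L_α" is provable from the axioms with codes in 1. *)
Definition premise (R : form) : form :=
  let p := (isDelta0In (fun x => x ∈ 2) 0 ⩓ isUnary 0 ⩓
     ∃' c, c ≗ at_L R 1 2 (exIn (nm 0) (nm 2) (tvar 0)) ⩓ Pr (fun e => e ∈ 1) c) 3 in
  close_from 3 (fresh p) p.

Section Premise.
Context {M : structure} {SM : SetModel M}.
Implicit Types (D : M -> Prop).

Definition trio {X : Type} (p a n : X) (v : nat) : X :=
  match v with 0 => p | 1 => a | _ => n end.

Definition Premise D (R : form) (p a n : M) : Prop :=
  IsDelta0 D (fun x => x ∊ n) p /\ IsUnary D p /\
  exists c, D c /\ c = at_L R 1 2 (exIn (nm 0) (nm 2) p) /\ Provable D (fun e => e ∊ a) c.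

Lemma den_premise D R p a n : transitive_class D -> D p -> D a -> D n ->
  (holds D (trio p a n) (premise R) <-> Premise D R p a n).
Proof.
  intros DT Dp Da Dn. unfold premise.
  set (q := ((isDelta0In _ _ ⩓ _) 3)).
  assert (A : forall rho, (forall v, D (rho v)) -> (forall v, v < 3 -> rho v = trio p a n v) ->
    (holds D rho q <-> Premise D R p a n)).
  { intros rho Hr E. assert (He : env D 3 rho) by (intros v _; auto).
    rewrite <- (E 0 : _ -> _ = p), <- (E 1 : _ -> _ = a), <- (E 2 : _ -> _ = n) by lia.
    unfold Premise, q. den.
    - eapply iff_trans; [apply den_isDelta0In with (Asem := fun x => x ∊ rho 2);
        [assumption|assumption|lia|]|reflexivity].
      intros rho1 d1 x E1 Hx. den_start E1. pose proof (proj1 E1). den.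
    - leaf den_isUnary.
    - eapply iff_trans; [apply den_Pr with (Asem := fun e => e ∊ rho 1);
        [assumption|assumption|lia|]|lookup].
      intros rho1 d1 x E1 Hx. den_start E1. pose proof (proj1 E1). den. }
  assert (Ht : forall v, D (trio p a n v)) by (intros [|[|v]]; auto).
  rewrite holds_close_from; auto.
  intros sigma Hs E. rewrite (A sigma Hs E), (A (trio p a n)); tauto.
Qed.

Lemma free_premise R v : free v (premise R) = true -> v < 3.
Proof.
  unfold premise. set (q := ((isDelta0In _ _ ⩓ _) 3)).
  intros H. apply free_close_from in H as [H1 H2]. apply free_fresh in H1. lia.
Qed.
End Premise.

(** [premise R] has fixed variable numbers. It is relativized to a variable [z] not occurring in it;
    then 0, 1, 2 and [z] receive the given names, and the shift by [d] keeps all other variables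
    clear of those in use. *)
Definition premise_in (R : form) (h p a n : nat) : pre := fun d =>
  let z := 3 + fresh (premise R) in
  rename (fun v => if v =? 0 then p else if v =? 1 then a else if v =? 2 then n
    else if v =? z then h else v + d) (rel z (premise R)).

(** The formula [q], with variables 0 and [y], at [e] and [u]. *)
Definition matrix_at (y : nat) (q : form) (e u : nat) : pre := fun d =>
  rename (fun v => if v =? y then u else if v =? 0 then e else v + d) q.

Definition isAdj (a b c : nat) : pre := ∀' v, v ∈ c ⇔ v ∈ a ⩔ v ≐ b.

(** The sentence "the Σ₁^α-theorems of the theory axiomatized by (∀y q)^{L_α}
    have their witnesses here", meant to hold in sets; [h] plays the role of the
    set of hereditarily finite sets. *)
Definition bounding (R : form) (y : nat) (q : form) : pre :=
  ∃' h, isTrans h ⩓ (∃' o ∈ h, isEmpty o) ⩓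
    (∀' a ∈ h, ∀' b ∈ h, ∃' c ∈ h, isAdj a b c) ⩓
    ∀' p ∈ h, ∀' a ∈ h, ∀' n ∈ h, isNat n ⇒ (∃' o ∈ n, isEmpty o) ⇒
      premise_in R h p a n ⇒ (∀' e ∈ a, ∀' u, matrix_at y q e u) ⇒ fEvidence p n.

Definition bounding_formula (R : form) (y : nat) (q : form) : form :=
  in_set (bounding R y q 0).

Section Bounding.
Context {M : structure} {SM : SetModel M}.
Context (R : form) (y : nat) (q : form) (Hq : Delta0 q)
  (Fq : forall v, free v q = true -> v = y \/ v = 0).

Definition Matrix (e u : M) : Prop := holds Univ (upd (fun _ => e) y u) q.

Definition Bounding (x : M) : Prop :=
  exists h, h ∊ x /\ Trans h /\ (exists o, o ∊ h /\ o = emp) /\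
    (forall a, a ∊ h -> forall b, b ∊ h -> exists c, c ∊ h /\ c = adj a b) /\
    forall p, p ∊ h -> forall a, a ∊ h -> forall n, n ∊ h -> Nat n -> (exists o, o ∊ n /\ o = emp) ->
      Premise (fun z => z ∊ h) R p a n ->
      (forall e, e ∊ a -> forall u, u ∊ x -> Matrix e u) -> Evidence x p n.

Section Den.
Context (D : M -> Prop) (DT : transitive_class D).

(** In [bounding] the later conjuncts have their intended meaning only for transitive [h], so they
    are evaluated under the first conjunct. *)
Lemma den_and_dep rho d (p r : pre) P Q : (holds D rho (p d) <-> P) ->
  (P -> (holds D rho (r d) <-> Q)) -> (holds D rho (conj_ p r d) <-> P /\ Q).
Proof. simpl. tauto. Qed.

Lemma den_isAdj rho d (a b c : nat) : env D d rho -> a < d -> b < d -> c < d ->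
  (holds D rho (isAdj a b c d) <-> rho c = adj (rho a) (rho b)).
Proof.
  intros He Ha Hb Hc. pose proof (He a Ha) as Da. pose proof (He b Hb) as Db.
  pose proof (He c Hc) as Dc.
  transitivity (forall z, D z -> (z ∊ rho c <-> z ∊ rho a \/ z = rho b)).
  { unfold isAdj. den. }
  split.
  - intros H. apply ext. intros z. rewrite adj_spec. split; intros K.
    + apply H; auto. eapply DT; [|exact K]; auto.
    + apply H; auto. destruct K as [K| ->]; auto. eapply DT; [|exact K]; auto.
  - intros -> z _. apply adj_spec.
Qed.

Lemma den_premise_in rho d (h p a n : nat) : env D d rho ->
  h < d -> p < d -> a < d -> n < d -> NoDup [h; p; a; n] -> Trans (rho h) ->
  rho p ∊ rho h -> rho a ∊ rho h -> rho n ∊ rho h ->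
  (holds D rho (premise_in R h p a n d) <->
   Premise (fun z => z ∊ rho h) R (rho p) (rho a) (rho n)).
Proof.
  intros He Lh Lp La Ln ND Th Hp Ha Hn. unfold premise_in.
  set (z := 3 + fresh (premise R)).
  set (f := fun v => if v =? 0 then p else if v =? 1 then a else if v =? 2 then n
    else if v =? z then h else v + d).
  assert (Hf : forall v w, f v = f w -> v = w).
  { inversion ND as [|? ? N1 ND1]; inversion ND1 as [|? ? N2 ND2];
      inversion ND2 as [|? ? N3 ND3]; subst. simpl in *.
    intros v w. unfold f.
    repeat match goal with |- context [?x =? ?k] => destruct (Nat.eqb_spec x k) end; lia. }
  assert (Hz : occurs z (premise R) = false) by (apply occurs_fresh; unfold z; lia).
  assert (F0 : f 0 = p /\ f 1 = a /\ f 2 = n /\ f z = h).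
  { repeat split; unfold f. assert (z =? 0 = false /\ z =? 1 = false /\ z =? 2 = false) as (-> & -> & ->).
    { rewrite !Nat.eqb_neq. unfold z. lia. }
    now rewrite Nat.eqb_refl. }
  destruct F0 as (F0 & F1 & F2 & Fz).
  assert (Fr : forall v, v < 3 -> rho (f v) = trio (rho p) (rho a) (rho n) v).
  { intros [|[|[|v]]] L; simpl; try lia; congruence. }
  rewrite holds_rename by now apply inj_on_inj.
  rewrite Delta0_absolute; auto.
  2: now apply rel_Delta0.
  2: { intros v [->|Hv]%free_rel; [rewrite Fz; auto|].
       apply free_premise in Hv. rewrite Fr by auto.
       destruct v as [|[|v]]; simpl; auto. }
  rewrite holds_rel; auto.
  - rewrite Fz. rewrite (holds_ext _ _ _ (trio (rho p) (rho a) (rho n))).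
    + apply den_premise; auto. now apply Trans_class.
    + intros v Hv. apply Fr. now apply free_premise in Hv.
  - rewrite Fz. now apply Trans_class.
  - intros v Hv. apply free_premise in Hv. rewrite Fz, Fr by auto.
    destruct v as [|[|v]]; simpl; auto.
Qed.

Lemma den_matrix_at rho d (e u : nat) : env D d rho -> e < d -> u < d -> e <> u ->
  (holds D rho (matrix_at y q e u d) <-> Matrix (rho e) (rho u)).
Proof.
  intros He Le Lu N. unfold matrix_at, Matrix.
  set (f := fun v => if v =? y then u else if v =? 0 then e else v + d).
  assert (Hf : forall v w, f v = f w -> v = w).
  { intros v w. unfold f.
    repeat match goal with |- context [?x =? ?k] => destruct (Nat.eqb_spec x k) end; lia. }
  assert (Fr : forall v, free v q = true -> rho (f v) = upd (fun _ => rho e) y (rho u) v).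
  { intros v Hv. unfold f, upd. destruct (Nat.eqb_spec v y) as [|Nv]; auto.
    destruct (Fq v Hv) as [| ->]; [easy|]. reflexivity. }
  rewrite holds_rename by now apply inj_on_inj.
  rewrite Delta0_absolute; auto.
  - now apply holds_ext.
  - intros v Hv. rewrite Fr by auto. unfold upd. destruct (v =? y); auto.
Qed.
End Den.

Lemma den_bounding x rho : Trans x -> (forall v, rho v ∊ x) ->
  (holds (fun z => z ∊ x) rho (bounding R y q 0) <-> Bounding x).
Proof.
  intros Tx Hr. pose proof (Trans_class x Tx) as DT.
  assert (He : env (fun z => z ∊ x) 0 rho) by (intros v _; auto).
  unfold bounding, Bounding.
  eapply den_ex; [assumption|]. intros h Hh He1. cbv beta.
  apply den_and_dep. { den. }
  intros Th. apply den_and. { den. }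
  apply den_and. { den. leaf den_isAdj. }
  eapply den_ball; [assumption|assumption|lia|den_side|intros p Hp Dp He2; cbv beta].
  eapply den_ball; [assumption|assumption|lia|den_side|intros a Ha Da He3; cbv beta].
  eapply den_ball; [assumption|assumption|lia|den_side|intros n Hn Dn He4; cbv beta].
  den.
  - eapply iff_trans; [|lookup].
    apply den_premise_in; auto; try lia; try (now lookup).
    repeat constructor; simpl; lia.
  - eapply iff_trans; [apply den_matrix_at; auto; lia|lookup].
  - eapply iff_trans; [apply den_fEvidence; auto; lia|lookup].
Qed.

Lemma holds_bounding_formula x :
  holds Univ (fun _ => x) (bounding_formula R y q) <->
    (exists o, o ∊ x) /\ Trans x /\ Bounding x.
Proof.
  apply holds_in_set. intros T rho Hr. now apply den_bounding.
Qed.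
End Bounding.

(** * The bounding formula in L_α *)

Section InModel.
Context {M : structure} {SM : SetModel M} (K : KPclass (@Univ M)).
Context (R : form) (HR : unary R).

Definition Represented (x : M) : Prop := holds Univ (fun _ => x) R.

Context (UR : forall x x', Represented x -> Represented x' -> x = x').

Lemma holds_at_L (p : form) xi z rho : xi <> z ->
  (holds Univ rho (at_L R xi z p) <-> forall a b, Represented a -> IsL Univ a b ->
     holds Univ (upd (upd rho xi a) z b) p).
Proof.
  intros N.
  assert (A : forall a b, holds Univ (upd (upd rho xi a) z b)
      (conj_ (R @ xi) (isL xi z (1 + Nat.max xi z))) <-> Represented a /\ IsL Univ a b).
  { intros a b. set (sigma := upd (upd rho xi a) z b).
    assert (E : sigma xi = a /\ sigma z = b).
    { unfold sigma. now rewrite upd_same, upd_other, upd_same by auto. }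
    destruct E as [E1 E2]. unfold Represented. rewrite <- E1, <- E2.
    rewrite <- (holds_at Univ R xi sigma HR).
    rewrite <- (den_isL Univ (fun _ _ _ _ => I) sigma (1 + Nat.max xi z)); try lia; [|easy].
    cbn [conj_ neg imp form_syntax holds]. tauto. }
  unfold at_L. cbn [all imp emb nm form_syntax holds].
  split.
  - intros H a b Ha Hb. apply (H a I b I). apply A. auto.
  - intros H a _ b _ L. apply A in L as [L1 L2]. auto.
Qed.

Section Theory.
Context (y : nat) (q : form) (Hq : Delta0 q) (Hu : unary (All y q)).

Lemma free_matrix v : free v q = true -> v = y \/ v = 0.
Proof.
  intros H. destruct (Nat.eq_dec v y); auto. right. apply Hu. simpl.
  rewrite H, andb_true_r. apply negb_true_iff, Nat.eqb_neq. auto.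
Qed.

Definition AxiomCode (e : M) : Prop := forall a b, Represented a -> IsL Univ a b ->
  holds Univ (fun v => if v =? fresh (All y q) then b else e) (rel (fresh (All y q)) (All y q)).

Lemma holds_rel_L rho : holds Univ rho (rel_L R (All y q)) <-> AxiomCode (rho 0).
Proof.
  unfold rel_L. set (z := fresh (All y q)). rewrite holds_at_L by lia.
  assert (A : forall a b, holds Univ (upd (upd rho (1 + z) a) z b) (rel z (All y q)) <->
    holds Univ (fun v => if v =? z then b else rho 0) (rel z (All y q))).
  { intros a b. apply holds_ext. intros v [->|Hv]%free_rel.
    - now rewrite upd_same, Nat.eqb_refl.
    - apply Hu in Hv. subst v. unfold upd, z. cbn -[Nat.max].
      now destruct (Nat.max (S y) (fresh q)) eqn:E; [lia|]. }
  unfold AxiomCode. fold z. split; intros H a b Ha Hb; [exact (proj1 (A a b) (H a b Ha Hb))|exact (proj2 (A a b) (H a b Ha Hb))].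
Qed.

(** [AxiomCode] runs over every represented ordinal and every level belonging to it; uniqueness of
    both leaves [l] alone. The matrix is Δ₀ and so means the same in [l] as in the universe. *)
Lemma AxiomCode_iff xi l e : Represented xi -> IsL Univ xi l -> Trans l -> e ∊ l ->
  (AxiomCode e <-> forall u, u ∊ l -> Matrix y q e u).
Proof.
  intros Hxi HL Tl He. set (z := fresh (All y q)).
  assert (Hz : z <> 0) by (unfold z; cbn -[Nat.max]; lia).
  assert (A : holds Univ (fun v => if v =? z then l else e) (rel z (All y q)) <->
    forall u, u ∊ l -> Matrix y q e u).
  { rewrite holds_rel; rewrite ?Nat.eqb_refl.
    - cbn [holds].
      assert (B : forall u, u ∊ l -> (holds (fun x => x ∊ l)
        (upd (fun v => if v =? z then l else e) y u) q <-> Matrix y q e u)).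
      { intros u Hul. unfold Matrix.
        assert (C : forall v, free v q = true ->
          upd (fun v => if v =? z then l else e) y u v = upd (fun _ => e) y u v).
        { intros v Hv. unfold upd. destruct (Nat.eqb_spec v y); auto.
          destruct (free_matrix v Hv) as [|E0]; [easy|]. subst v.
          destruct (Nat.eqb_spec 0 z); auto. now destruct Hz. }
        rewrite Delta0_absolute; auto.
        - now apply holds_ext.
        - now apply Trans_class.
        - intros v Hv. rewrite C by auto. unfold upd. now destruct (v =? y). }
      split; intros H u Hul; apply B; auto.
    - apply occurs_fresh. unfold z. lia.
    - now apply Trans_class.
    - intros v Hv. apply Hu in Hv. subst v. destruct (Nat.eqb_spec 0 z); auto. now destruct Hz. }
  rewrite <- A. split.
  - intros H. apply (H xi l Hxi HL).
  - intros H a b Ha Hb. fold z. rewrite (UR a xi Ha Hxi) in Hb.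
    now rewrite (IsL_unique K xi b l Hb HL).
Qed.

(** Here [p] is any element of the model, so the principle is also available for nonstandard
    formulas. *)
Lemma RFN_elim (rho : nat -> M) : holds Univ rho (RFN R (All y q)) ->
  forall p, IsDelta0 Univ Nat p -> IsUnary Univ p ->
  Provable Univ AxiomCode (at_L R 1 2 (exIn (nm 0) (nm 2) p)) ->
  forall xi l, Represented xi -> IsL Univ xi l -> Models Univ l (Defs.ex (nm 0) p).
Proof.
  intros H.
  assert (DT : transitive_class (@Univ M)) by easy.
  assert (He : env (@Univ M) 0 rho) by easy.
  assert (A : forall p, Univ p -> IsDelta0 Univ Nat p /\ IsUnary Univ p ->
    (exists c, Univ c /\ c = at_L R 1 2 (exIn (nm 0) (nm 2) p) /\ Provable Univ AxiomCode c) ->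
    forall xi, Univ xi -> forall l, Univ l -> Represented xi /\ IsL Univ xi l ->
    exists c, Univ c /\ c = Defs.ex (nm 0) p /\ Models Univ l c).
  { refine (proj1 (den_all (@Univ M) rho 0 _ _ He _) H). intros p _ He1. den.
    - leaf den_isDelta0.
    - leaf den_isUnary.
    - eapply iff_trans; [eapply den_Pr with (Asem := AxiomCode); [easy|easy|lia|]|lookup].
      intros rho1 d1 x _ Hx. cbn [emb pre_syntax].
      rewrite holds_rename by (apply inj_on_inj; apply swap_inj).
      rewrite holds_rel_L. reflexivity.
    - cbn [emb pre_syntax]. rewrite holds_at by auto. unfold Represented. now lookup.
    - leaf den_isL.
    - leaf den_models. }
  intros p Hp Hpu Hpr xi l Hxi HL.
  destruct (A p I (conj Hp Hpu) (ex_intro _ _ (conj I (conj eq_refl Hpr))) xi I l I (conj Hxi HL))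
    as (c & _ & -> & Hc).
  exact Hc.
Qed.
End Theory.
End InModel.

(** * Existence of evidence and of bounds in L_α *)

Section Existence.
Context {M : structure} {SM : SetModel M} (K : KPclass (@Univ M)).
Context (l : M) (Tl : Trans l) (KN : KPclass (fun x => x ∊ l)).
Implicit Types x z a b c e p n m g s t u w : M.

Let Nt : transitive_class (fun x => x ∊ l) := kp_trans _ KN.
Let Nc : closed (fun x => x ∊ l) := kp_closed _ KN.

(** Truth of "∃x p(x)" in (l,∈), for a possibly nonstandard Δ₀-formula [p],
    is witnessed by evidence in [l]. *)
Lemma Evidence_exists h p n : h ∊ l -> Trans h -> p ∊ h -> n ∊ h -> Nat n -> emp ∊ n ->
  IsDelta0 (fun x => x ∊ h) (fun x => x ∊ n) p -> Models Univ l (Defs.ex (num 0) p) ->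
  exists w, w ∊ l /\ Evidence w p n.
Proof.
  intros Hh Th Hp Hn Nn Hn0 (m & Hm & g & Hg & Nm & Fg & Hsteps & i & Hi & Hgi)
    (_ & n' & _ & A' & _ & X & _ & Ev & HX).
  assert (Sub : forall x, x ∊ h -> x ∊ l) by (intros x Hx; exact (Tl h Hh x Hx)).
  assert (De : emp ∊ l) by now apply (closed_emp _ Nc).
  pose proof Ev as (_ & HA' & _).
  apply Evaluates_seq in Ev as (HV' & HU' & m' & s' & i' & Hseq & Hi' & Happ); auto.
  pose proof Hseq as (Nm' & Fs' & Hs').
  (* The constant assignment is chosen on both sides, here and in [a0] below, so that two
     assignments obtained by changing variable 0 can be compatible. *)
  destruct (const_fun Univ K n' emp) as (a' & _ & Fa' & Ha'); try easy.
  assert (Ha'A : a' ∊ A').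
  { apply (HA' a' I). split; auto. intros j Hj u _ Hu. apply Ha' in Hu as [_ ->]. auto. }
  pose proof (HX a' Ha'A) as Ha'X.
  (* The formula evaluated is coded as ¬∀x¬p; three steps back along [s'] lead to the satisfaction
     set [Z3] of [p] itself. *)
  apply Hs' in Happ; auto. apply EvStep_neg in Happ as (Z1 & (j1 & Hj1 & H1) & E1).
  apply E1 in Ha'X as [_ Ha'X].
  assert (Hj1m : j1 ∊ m') by exact (Nat_Trans _ Nm' i' Hi' j1 Hj1).
  apply Hs' in H1; auto. apply EvStep_all in H1 as (Hn'0 & Z2 & (j2 & Hj2 & H2) & E2).
  assert (Hj2m : j2 ∊ m') by exact (Nat_Trans _ Nm' j1 Hj1m j2 Hj2).
  apply Hs' in H2; auto. apply EvStep_neg in H2 as (Z3 & (j3 & Hj3 & H3) & E3).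
  assert (Hj3m : j3 ∊ m') by exact (Nat_Trans _ Nm' j2 Hj2m j3 Hj3).
  assert (Hb : exists b, b ∊ A' /\ Agree n' emp a' b /\ b ∊ Z3).
  { apply NNPP. intros N. apply Ha'X, E2. split; auto. intros b Hb Hag. apply E3.
    split; auto. intros Hb3. apply N. eauto. }
  destruct Hb as (b & HbA & Hag & Hb3).
  destruct (HV' b HbA) as [Fb Vb]. destruct (proj1 (proj2 Fb) emp Hn'0) as [x0 Hx0].
  assert (Hx0l : x0 ∊ l) by (apply (Vb emp Hn'0); auto).
  (* The domain of the evidence needs the witness [x0], the default value [emp] and, for the bounded
     quantifiers, transitivity. *)
  destruct (trans_closure _ KN (upair emp x0)) as (z & Hz & Tz & Hez).
  { now apply (closed_upair _ _ _ Nc). }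
  assert (Hz0 : emp ∊ z) by (apply (Tz _ Hez), upair_spec; auto).
  assert (Hzx : x0 ∊ z) by (apply (Tz _ Hez), upair_spec; auto).
  destruct (assignments_exist _ KN z Hz Hz0 n (Sub n Hn) Nn)
    as (A & HA & HV & HU & a0 & Ha0 & Hc0).
  destruct (HU a0 Ha0 emp Hn0 x0 Hzx) as (a & Ha & Hax & Hao).
  destruct (Ev0_exists _ KN n A m g) as (s & Hs & HEv); auto.
  { intros j Hj r Hr. assert (Hrh : r ∊ h).
    { exact (proj2 (App_class _ _ _ _ (Trans_class h Th) Hg Hr)). }
    specialize (Hsteps j Hj r Hrh Hr). unfold Delta0Step in *.
    destruct Hsteps as [(x & Dx & y & Dy & L)|[(q & Dq & L)|[(q & Dq & r' & Dr & L)|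
      (x & Dx & y & Dy & q & Dq & L)]]].
    - left. exists x. split; auto. exists y. split; auto.
    - right; left. exists q. split; auto.
    - right; right; left. exists q. split; auto. exists r'. split; auto.
    - right; right; right. exists x. split; auto. exists y. split; auto. exists q. split; auto. }
  pose proof HEv as (_ & _ & Fs & _).
  destruct (proj1 (proj2 Fs) i Hi) as [Y HY].
  (* Both [a] and [b] take the value [x0] at variable 0 and [emp] elsewhere, so they are
     compatible. *)
  assert (HaY : a ∊ Y).
  { apply (ev0_compare K z l n n' A A' m m' g s s' Tz (fun x Hx => Tl z Hz x Hx) HV HU HV' HU'
      HEv Hseq i Hi p Hgi Y HY j3 Hj3m Z3 H3 a Ha b HbA); auto.
    intros j Hj Hj' u Hu. destruct (classic (j = emp)) as [->|N].
    - now rewrite (Fun_functional _ _ _ _ _ (proj1 (HV a Ha)) Hu Hax).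
    - destruct (Hao j Hj N) as (v & V1 & V2).
      rewrite (Fun_functional _ _ _ _ _ (proj1 (HV a Ha)) Hu V2).
      destruct (Hc0 j Hj) as (v' & V3 & ->).
      rewrite (Fun_functional _ _ _ _ _ (proj1 (HV a0 Ha0)) V1 V3).
      destruct (Hag j Hj' N) as (v' & V4 & V5). apply Ha' in V4 as [_ ->]. exact V5. }
  exists (adj (adj (adj (adj (adj (adj (adj emp z) A) m) g) s) emp) x0). split.
  { repeat apply (closed_adj (fun x => x ∊ l)); auto. }
  exists z. split; [rewrite !adj_spec; tauto|].
  exists A. split; [rewrite !adj_spec; tauto|].
  exists m. split; [rewrite !adj_spec; tauto|].
  exists g. split; [rewrite !adj_spec; tauto|].
  exists s. split; [rewrite !adj_spec; tauto|].
  do 4 (split; auto). exists i. split; auto. split; auto. exists Y. split; auto.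
  exists a. split; auto. split; auto. exists emp. split; [rewrite !adj_spec; tauto|].
  split; auto. exists x0. split; [rewrite !adj_spec; tauto|auto].
Qed.

Context (R : form) (HR : unary R) (y : nat) (q : form) (Hq : Delta0 q) (Hu : unary (All y q)).
Context (UR : forall x x' : M, Represented R x -> Represented R x' -> x = x').
Context (xi : M) (Hxi : Represented R xi) (HL : IsL Univ xi l).
Context (HRFN : forall p : M, IsDelta0 Univ Nat p -> IsUnary Univ p ->
  Provable Univ (AxiomCode R y q) (at_L R 1 2 (exIn (nm 0) (nm 2) p)) ->
  Models Univ l (Defs.ex (nm 0) p)).

Let z0 : nat := 3 + fresh (premise R).
(** The formula rather than its meaning: collection needs a property that is Δ₀ for all arguments,
    while the formula agrees with [Premise] only for arguments in a transitive [h]. *)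
Definition RawPremise h p a n : Prop :=
  holds Univ (fun v => if v =? z0 then h else trio p a n v) (rel z0 (premise R)).

Lemma RawPremise_iff h p a n : Trans h -> p ∊ h -> a ∊ h -> n ∊ h ->
  (RawPremise h p a n <-> Premise (fun x => x ∊ h) R p a n).
Proof.
  intros Th Hp Ha Hn. unfold RawPremise.
  rewrite holds_rel; rewrite ?Nat.eqb_refl.
  - rewrite (holds_ext _ _ _ (trio p a n)).
    + apply den_premise; auto. now apply Trans_class.
    + intros v Hv%free_premise. destruct (Nat.eqb_spec v z0); auto. unfold z0 in *. lia.
  - apply occurs_fresh. unfold z0. lia.
  - now apply Trans_class.
  - intros v Hv%free_premise. destruct (Nat.eqb_spec v z0); [unfold z0 in *; lia|].
    destruct v as [|[|v]]; simpl; auto.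
Qed.

(** Collection runs over a single set, hence the triple is coded by one element [t]. The condition
    persists when [w] grows, since its hypothesis becomes stronger and evidence is kept; so one set
    can serve for all triples. *)
Definition Reflects h t w : Prop :=
  forall p an, t = pr p an -> forall a n, an = pr a n ->
    (Nat n /\ emp ∊ n /\ RawPremise h p a n) ->
    (forall e, e ∊ a -> forall u, u ∊ w -> Matrix y q e u) -> Evidence w p n.

Lemma D0_Reflects h : D0 (fst :: snd :: consts [h]) (fun tw => Reflects h (fst tw) (snd tw)).
Proof.
  unfold Reflects, consts; cbn [map]. d0.
  - apply (D0_emp_in _ (fun x : _ * _ => snd x)); crd.
  - unfold RawPremise, lift; cbn [map app].
    (* The coordinates 0, 1, 2 are t, w, h. Opening a pair adds three, so p has number 4, and a and
       n have 7 and 8; the shift by 20 moves the other variables past all of these. *)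
    apply (D0_formula _ (rel z0 (premise R))
      (fun v => if v =? 0 then 4 else if v =? 1 then 7 else if v =? 2 then 8
         else if v =? z0 then 2 else v + 20)
      (fun v (x : _ * _) => if v =? z0 then h else
         trio (snd (fst (fst (fst (fst x))))) (snd (fst x)) (snd x) v)).
    + apply rel_Delta0, occurs_fresh. unfold z0; lia.
    + intros v w. assert (3 <= z0) by (unfold z0; lia).
      repeat match goal with |- context [?x =? ?k] => destruct (Nat.eqb_spec x k) end; lia.
    + assert (3 <= z0) by (unfold z0; lia).
      intros v [->|Hv%free_premise]%free_rel.
      * rewrite Nat.eqb_refl.
        destruct (Nat.eqb_spec z0 0), (Nat.eqb_spec z0 1), (Nat.eqb_spec z0 2); try lia.
        reflexivity.
      * destruct (Nat.eqb_spec v z0); [lia|].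
        destruct v as [|[|[|v]]]; [reflexivity|reflexivity|reflexivity|lia].
  - unfold Matrix, lift; cbn [map app].
    (* After a and n, the bounded variables e and u have numbers 9 and 10. *)
    apply (D0_formula _ q
      (fun v => if v =? y then 10 else if v =? 0 then 9 else v + 20)
      (fun v (x : _ * _) => if v =? y then snd x else snd (fst x))); auto.
    + intros v w.
      repeat match goal with |- context [?x =? ?k] => destruct (Nat.eqb_spec x k) end; lia.
    + intros v Hv. destruct (Nat.eqb_spec v y); [reflexivity|].
      destruct (free_matrix y q Hu v Hv) as [|E0]; [easy|]. now subst v.
  - apply (D0_Evidence _ (fun x : _ * _ => snd (fst (fst (fst (fst (fst (fst x)))))))
      (fun x : _ * _ => snd (fst (fst (fst (fst x))))) (fun x : _ * _ => snd x)); crd.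
Qed.

Lemma bounding_exists : exists x, x ∊ l /\ (exists o, o ∊ x) /\ Trans x /\ Bounding R y q x.
Proof.
  destruct (HF_exists _ KN) as (h & Hh & Th & Ch).
  assert (Sub : forall x, x ∊ h -> x ∊ l) by (intros x Hx; exact (Tl h Hh x Hx)).
  assert (De : emp ∊ l) by now apply (closed_emp _ Nc).
  destruct (kp_coll _ KN [h] (Reflects h) h) as (B & HB & HBw); auto.
  { apply D0_Reflects. }
  { intros t Ht.
    destruct (classic (exists p a n, t = pr p (pr a n))) as [(p & a & n & ->)|N].
    2: { exists emp. split; auto. intros p an -> a n ->. exfalso. apply N. eauto. }
    apply (trans_pr (fun x => x ∊ h)) in Ht as [Hp Ht]; [|now apply Trans_class].
    apply (trans_pr (fun x => x ∊ h)) in Ht as [Ha Hn]; [|now apply Trans_class].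
    assert (Red : forall w, (Nat n -> emp ∊ n -> Premise (fun x => x ∊ h) R p a n ->
      (forall e, e ∊ a -> forall u, u ∊ w -> Matrix y q e u) -> Evidence w p n) ->
      Reflects h (pr p (pr a n)) w).
    { intros w Hw p' an' [<- <-]%pr_inj a' n' [<- <-]%pr_inj (N1 & N2 & N3) N4.
      exact (Hw N1 N2 (proj1 (RawPremise_iff h p a n Th Hp Ha Hn) N3) N4). }
    (* If some [e] in [a] is not an axiom, then w = {u} with a counterexample [u] makes the
       hypothesis of [Reflects] false; otherwise the reflection principle applies. *)
    destruct (classic (forall e, e ∊ a -> forall u, u ∊ l -> Matrix y q e u)) as [Ax|Ax].
    2: { apply not_all_ex_not in Ax as [e Ax]. apply imply_to_and in Ax as [He Ax].
         apply not_all_ex_not in Ax as [u Ax]. apply imply_to_and in Ax as [Hul Ax].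
         exists (adj emp u). split; [now apply (closed_adj _ _ _ Nc)|]. apply Red.
         intros _ _ _ L. exfalso. apply Ax, L; auto. apply adj_spec; auto. }
    destruct (classic (Nat n /\ emp ∊ n /\ Premise (fun x => x ∊ h) R p a n))
      as [(Nn & Hn0 & HP)|N].
    2: { exists emp. split; auto. apply Red. tauto. }
    destruct HP as (P1 & P2 & c & Hc & -> & P3).
    destruct (Evidence_exists h p n) as (w & Hw & HE); auto.
    (* The premise was tested in [h]; it is upward absolute, and every element of [a] is an axiom
       code, so it holds in the universe as reflection demands. *)
    - apply HRFN.
      + apply (IsDelta0_up (fun x => x ∊ h) Univ (fun _ _ => I) (Trans_class h Th)
          (fun x => x ∊ n) Nat); auto. intros x Hx. now apply (Nat_elem n).
      + now apply (IsUnary_up (fun x => x ∊ h) Univ (fun _ _ => I) (Trans_class h Th)).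
      + apply (Provable_up (fun x => x ∊ h) Univ (fun _ _ => I) (Trans_class h Th)
          (fun e => e ∊ a)); auto. intros e He.
        apply (AxiomCode_iff K R UR y q Hq Hu xi l e Hxi HL Tl); auto.
        apply Sub. exact (Th a Ha e He).
    - exists w. split; auto. }
  (* A transitive set with [B] as an element includes every member [w] of [B] as a subset, so all
     collected witnesses become available in [x]. *)
  destruct (trans_closure _ KN (upair B h)) as (x & Hx & Tx & HBx).
  { now apply (closed_upair _ _ _ Nc). }
  assert (HBx' : B ∊ x) by (apply (Tx _ HBx), upair_spec; auto).
  assert (Hhx : h ∊ x) by (apply (Tx _ HBx), upair_spec; auto).
  exists x. split; auto. split; [eauto|]. split; auto.
  exists h. split; auto. split; auto. split; [exists emp; split; auto; apply Ch|].
  split. { intros a Ha b Hb. exists (adj a b). split; auto. now apply Ch. }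
  intros p Hp a Ha n Hn Nn (o & Ho & ->) HP Ax.
  assert (Ht : pr p (pr a n) ∊ h).
  { repeat apply (closed_pr (fun x => x ∊ h)); auto. }
  destruct (HBw _ Ht) as (w & Hw & Hr).
  assert (Hwx : forall u, u ∊ w -> u ∊ x).
  { intros u Huw. apply (Tx w); auto. apply (Tx B); auto. }
  apply (Evidence_mono w); auto. apply (Hr p (pr a n) eq_refl a n eq_refl).
  - exact (conj Nn (conj Ho (proj2 (RawPremise_iff h p a n Th Hp Ha Hn) HP))).
  - intros e He u Huw. auto.
Qed.
End Existence.

(** ** Bounding sets are correct for actual theorems *)

(** Compactness: a set of axiom codes in [h] can be built by adjunction only if it is finite. *)
Lemma Proves_finite (T : theory) p : Proves T p ->
  exists L, (forall r, In r L -> T r) /\ Proves (fun r => In r L) p.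
Proof.
  assert (Mono : forall (T1 T2 : theory) r, (forall s, T1 s -> T2 s) -> Proves T1 r -> Proves T2 r).
  { intros T1 T2 r H D. induction D; try (constructor; auto; fail).
    eapply Pv_mp; eauto. }
  intros H. induction H;
    try (exists []; split; [now intros ? []|constructor; auto]; fail).
  - exists [p]. split; [intros r [<-|[]]; auto|]. apply Pv_ax. simpl; auto.
  - destruct IHProves1 as (L1 & H1 & D1), IHProves2 as (L2 & H2 & D2).
    exists (L1 ++ L2). split.
    + intros r [Hr|Hr]%in_app_or; auto.
    + eapply Pv_mp; eapply Mono; eauto; intros s Hs; apply in_or_app; auto.
  - destruct IHProves as (L & HL & D). exists L. split; auto. now apply Pv_gen.
Qed.

Section Correctness.
Context {M : structure} {SM : SetModel M}.

Fixpoint finset (L : list M) : M :=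
  match L with [] => emp | c :: L => adj (finset L) c end.

Lemma finset_spec L x : x ∊ finset L <-> In x L.
Proof.
  induction L as [|c L IH]; cbn [finset In].
  - split; [apply emp_spec|easy].
  - rewrite adj_spec, IH. intuition congruence.
Qed.

Lemma closed_finset (D : M -> Prop) L : closed D -> (forall c, In c L -> D c) -> D (finset L).
Proof.
  intros C. induction L as [|c L IH]; cbn [finset]; intros H.
  - now apply (closed_emp D).
  - apply (closed_adj D); auto; [apply IH; intros|]; apply H; simpl; auto.
Qed.

(** The derivation, the finitely many axiom codes used and [n] lie in [h], which is closed under
    adjunction. The matrix holds on [x] for these axioms, so [x] contains evidence, and evidence for
    a standard formula tells the truth. *)
Lemma bounding_correct R y q (T : theory) x p :
  Bounding (M := M) R y q x ->
  (forall r, T r -> forall u, u ∊ x -> Matrix (M := M) y q (cd r) u) ->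
  Delta0 p -> unary p -> Proves T (at_L R 1 2 (exIn 0 2 p)) ->
  exists u, u ∊ x /\ holds (M := M) Univ (fun _ => u) p.
Proof.
  intros (h & Hh & Th & (o & Ho & ->) & Hadj & H) HT Dp Up HP.
  assert (Ch : closed (fun z => z ∊ h)).
  { split; auto. intros a b Ha Hb. destruct (Hadj a Ha b Hb) as (c & Hc & ->). auto. }
  apply Proves_finite in HP as (L & HL & HP).
  (* All variables of [p] are below [fresh p]; the successor makes 0 an element of [n] at once. *)
  set (n := num (S (fresh p)) : M). set (a := finset (map cd L) : M).
  assert (Ha : a ∊ h).
  { apply (closed_finset (fun z => z ∊ h)); auto. intros c Hc.
    apply in_map_iff in Hc as (r & <- & _). now apply (closed_cd (fun z => z ∊ h)). }
  destruct (H (cd p)) with (a := a) (n := n) as (z & Hz & A & HA & m & Hm & g & Hg & s & Hs &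
    Tz & HV & HU & HE & i & Hi & Hgi & Y & HY & b & Hb & HbY & o & Hox & -> & u & Hux & Hbu); auto.
  - now apply (closed_cd (fun z => z ∊ h)).
  - now apply (closed_num (fun z => z ∊ h)).
  - apply Nat_num.
  - exists emp. split; auto. apply num_spec. exists 0. split; auto. lia.
  - split; [|split].
    + apply IsDelta0_cd; auto. intros v Hv. apply num_spec. exists v. split; auto.
      destruct (le_lt_dec (fresh p) v); [|lia]. rewrite occurs_fresh in Hv; easy.
    + now apply IsUnary_cd.
    + exists (cd (at_L R 1 2 (exIn 0 2 p))). split; [now apply (closed_cd (fun z => z ∊ h))|].
      split; [reflexivity|]. apply (Provable_cd _ Ch (fun r => In r L)); auto.
      intros r Hr. apply finset_spec, in_map_iff. eauto.
  - intros e He u Hux. apply finset_spec, in_map_iff in He as (r & <- & Hr). auto.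
  - exists u. split; auto.
    apply (ev0_truth z n A m g s Tz HV HU HE p Dp i Y Hi Hgi HY b Hb (fun _ => u)); auto.
    intros v Hv. apply Up in Hv. subst v. split; auto.
    apply num_spec. exists 0. split; auto. lia.
Qed.
End Correctness.

(** * Descent *)

Lemma KP1_ZF p : KP1 p -> ZF p.
Proof. destruct 1; constructor; auto. Qed.

Section Admissible.
Context (R : form) (hR : representation R) (hadm : provably_admissible R).
Context {M : structure} {SM : SetModel M} (HM : satisfies (@Univ M) KP1).

Lemma KP1_valid p : Proves KP1 p -> valid M p.
Proof. apply Proves_sound. intros r Hr rho. apply sat_holds, HM; easy. Qed.

Lemma represented_unique (x x' : M) : Represented R x -> Represented R x' -> x = x'.
Proof.
  destruct hR as (_ & HU & HP). apply KP1_valid in HP.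
  intros Hx Hx'. specialize (HP (fun _ => x)). apply sat_holds in HP.
  specialize (HP x I x' I). cbn [conj_ imp neg eql form_syntax holds] in HP.
  rewrite !(holds_at Univ R _ _ HU) in HP. apply HP. intros L. now apply L.
Qed.

Lemma represented_admissible (x : M) : Represented R x -> IsAdmissible Univ x.
Proof.
  destruct hR as (_ & HU & _). pose proof (KP1_valid _ hadm) as HP.
  intros Hx. specialize (HP (fun _ => x)). apply sat_holds in HP.
  specialize (HP x I). cbn [imp form_syntax holds] in HP.
  rewrite (holds_at Univ R _ _ HU) in HP. specialize (HP Hx).
  apply (den_isAdmissible Univ (fun _ _ _ _ => I)) in HP; auto; easy.
Qed.

Lemma KPclass_Univ (o : M) : KPclass (@Univ M).
Proof. apply (KPclass_intro Univ (fun _ _ _ _ => I) o I HM). Qed.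
End Admissible.

(** * The bounding sentence as a theorem *)

Section Reflection.
Context (R : form) (hR : representation R) (hadm : provably_admissible R).
Context (T : theory) (HT : extends T (KP1_Exists R)).
Context (y : nat) (q : form) (Hq : Delta0 q) (Hu : unary (All y q)).
Context (HRFN : Proves T (RFN R (All y q))).

Lemma extends_KP1 (M : structure) : (forall r, Proves T r -> valid M r) ->
  satisfies (@Univ M) KP1.
Proof.
  intros HM p Hp rho _. apply sat_holds, HM, HT, Pv_ax. now constructor.
Qed.

(** Admissibility and uniqueness of the represented ordinal are theorems of [KP1], so they hold in
    an arbitrary model of [T]. There L_α is a [KPclass], and reflection applies to it as the model
    understands it. *)
Lemma model_bounding {M : structure} {SM : SetModel M} (HM : forall r, Proves T r -> valid M r)
  (a b : M) : Represented R a -> IsL Univ a b ->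
  exists x : M, x ∊ b /\ Trans b /\ holds Univ (fun _ => x) (bounding_formula R y q).
Proof.
  intros Ha Hb. pose proof (extends_KP1 M HM) as HK.
  pose proof (KPclass_Univ HK a) as K.
  pose proof (represented_unique R hR HK) as UR.
  destruct (admissible_KPclass K a b (represented_admissible R hR hadm HK a Ha) Hb) as [Tb KN].
  destruct hR as (_ & HU & _).
  destruct (bounding_exists K b Tb KN R y q Hq Hu UR a Ha Hb) as (x & Hx & Hne & Tx & Bx).
  - intros p Hp Hpu Hpr. eapply (RFN_elim R HU y q Hu (fun _ => a)); eauto.
    apply sat_holds, HM, HRFN.
  - exists x. split; auto. split; auto. apply holds_bounding_formula; auto.
    intros v. now apply free_matrix.
Qed.

Lemma model_set_exists (M : structure) (HM : forall r, Proves T r -> valid M r) (o : M) :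
  exists _ : SetModel M, True.
Proof. apply SetModel_exists; auto. now apply extends_KP1. Qed.

Lemma bounding_provable :
  Proves T (at_L R 1 2 (exIn 0 2 (bounding_formula R y q))).
Proof.
  apply completeness. intros M HM rho.
  destruct (model_set_exists M HM (rho 0)) as [SM _].
  destruct hR as (_ & HU & _). apply sat_holds, holds_at_L; auto.
  intros a b Ha Hb. destruct (model_bounding HM a b Ha Hb) as (x & Hx & _ & Hc).
  cbn [exIn allIn all imp neg mem form_syntax holds]. intros L. apply (L x I).
  - rewrite upd_same, upd_other, upd_same by lia. exact Hx.
  - apply (holds_unary _ _ _ x); auto using upd_same. apply in_set_unary.
Qed.

(** Soundness is stated for [rel_L], which relativizes and picks fresh names, whereas the code in
    [RFN] uses the names 1 and 2. The two sentences differ as formulas, so each is proved through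
    the same bound in every model. *)
Lemma bounding_provable_rel : Proves T (rel_L R (ex 0 (bounding_formula R y q))).
Proof.
  apply completeness. intros M HM rho.
  destruct (model_set_exists M HM (rho 0)) as [SM _].
  destruct hR as (_ & HU & _). unfold rel_L.
  set (p := ex 0 (bounding_formula R y q)). set (z := fresh p).
  apply sat_holds, holds_at_L; auto.
  intros a b Ha Hb. destruct (model_bounding HM a b Ha Hb) as (x & Hx & Tb & Hc).
  assert (F : forall v, free v p = false).
  { intros v. destruct (free v p) eqn:E; auto. unfold p in E.
    cbn [ex all neg form_syntax free] in E. apply andb_true_iff in E as [E1 E2].
    apply in_set_unary in E2 as ->. easy. }
  rewrite holds_rel; rewrite ?upd_same.
  - cbn [p ex all neg form_syntax holds]. unfold p. cbn [ex all neg form_syntax holds].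
    intros L. apply (L x Hx). apply Delta0_absolute.
    + now apply Trans_class.
    + apply in_set_Delta0.
    + intros v Hv. apply in_set_unary in Hv as ->. now rewrite upd_same.
    + apply (holds_unary _ _ _ x); auto using upd_same. apply in_set_unary.
  - apply occurs_fresh. unfold z. lia.
  - now apply Trans_class.
  - intros v Hv. rewrite F in Hv. easy.
Qed.
End Reflection.

Theorem theorem7p1
    (V : structure) (hV : constructible_universe V)
    (R : form) (hR : representation R) (hadm : provably_admissible R)
    (alpha L_alpha : V) (halpha : represents V R alpha)
    (hL : is_L_level V alpha L_alpha) :
  ~ exists (T : nat -> theory) (tau : nat -> form),
      forall n : nat,
        Sigma1_sound V R L_alpha (T n) /\
        Pi1_defines V R (tau n) (T n) /\
        extends (T n) (KP1_Exists R) /\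
        Proves (T n) (RFN R (tau (S n))).
Proof.
  intros (T & tau & H). destruct hV as (wf & hZF & _).
  assert (HK : satisfies (@Univ V) KP1).
  { intros p Hp rho _. now apply sat_holds, hZF, KP1_ZF. }
  destruct (SetModel_exists V alpha HK) as [SM _].
  pose proof (KPclass_Univ HK alpha) as K.
  pose proof (represented_unique R hR HK) as UR.
  assert (Ha : Represented R alpha) by (apply sat_holds, halpha; reflexivity).
  assert (HL : IsL Univ alpha L_alpha).
  { apply sat_holds in hL. apply (den_isL Univ (fun _ _ _ _ => I)) in hL; try lia; [|easy].
    exact hL. }
  assert (TL : Trans L_alpha) by now apply (IsL_Trans K alpha).
  assert (HU : unary R) by apply hR.
  pose (bounds := fun n (w : V) => w ∊ L_alpha /\ forall p, Delta0 p -> unary p ->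
    Proves (T n) (at_L R 1 2 (exIn 0 2 p)) -> exists u, u ∊ w /\ holds Univ (fun _ => u) p).
  (* The [at_L] form of the theorem matches [bounds] and drives the descent; the [rel_L] form
     matches soundness and starts it. *)
  assert (Step : forall n, exists c, Delta0 c /\ unary c /\
    Proves (T n) (at_L R 1 2 (exIn 0 2 c)) /\ Proves (T n) (rel_L R (ex 0 c)) /\
    forall u, u ∊ L_alpha -> holds Univ (fun _ => u) c -> bounds (S n) u).
  { intros n. destruct (H n) as (_ & _ & HT & HR).
    destruct (H (S n)) as (_ & ((y & q & Hq & E) & Hu & Hdef) & _). rewrite E in HR, Hu, Hdef.
    change (all y q) with (All y q) in HR, Hu, Hdef.
    exists (bounding_formula R y q). split; [apply in_set_Delta0|].
    split; [apply in_set_unary|]. split; [exact (bounding_provable R hR hadm (T n) HT y q Hq Hu HR)|].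
    split; [exact (bounding_provable_rel R hR hadm (T n) HT y q Hq Hu HR)|].
    intros u Hul Hc. split; auto. intros p Dp Up HP.
    assert (Fq : forall v, free v q = true -> v = y \/ v = 0) by (intros v; exact (free_matrix y q Hu v)).
    assert (DC : closed (fun x => x ∊ L_alpha)).
    { apply kp_closed. apply (admissible_KPclass K alpha L_alpha); auto.
      now apply (represented_admissible R). }
    assert (B : Bounding R y q u).
    { apply holds_bounding_formula in Hc; [apply Hc|exact Hq|exact Fq]. }
    apply (bounding_correct R y q (T (S n)) u p B); auto.
    (* An actual axiom satisfies its Π₁-definition over L_α, hence the matrix at every element of
       L_α, in particular at those of the transitive level that lie in [u]. *)
    intros r Hr v Hv.
    assert (Hc' : AxiomCode R y q (cd r)).
    { apply (holds_rel_L R HU y q Hu (fun _ => cd r)). apply sat_holds, Hdef.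
      exists r. split; auto. apply sat_holds.
      apply (den_quote Univ (fun _ _ _ _ => I) (fun _ => cd r) 1 r); try lia; [|easy].
      apply extn_refl. intros ? _. exact I. }
    apply (AxiomCode_iff K R UR y q Hq Hu alpha L_alpha); auto.
    - now apply (closed_cd (fun x => x ∊ L_alpha)).
    - exact (TL u Hul v Hv). }
  assert (Descend : forall w n, ~ bounds n w).
  (* The index [n] is generalized, since the element [u] of [w] is a bound of the next theory. *)
  { intros w. induction (wf w) as [w _ IH]. intros n [Hw Hb].
    destruct (Step n) as (c & Dc & Uc & P1 & _ & Hc).
    destruct (Hb c Dc Uc P1) as (u & Hu & Hcu).
    apply (IH u Hu (S n)). apply Hc; auto. exact (TL w Hw u Hu). }
  (* Soundness of [T 0] makes its theorem [ex 0 c] true in L_α, and the witness is a bound of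
     [T 1]. *)
  destruct (Step 0) as (c & Dc & Uc & _ & P2 & Hc). destruct (H 0) as (Hs & _).
  assert (Hv : valid (set_structure V L_alpha) (ex 0 c)).
  { apply Hs; auto.
    - exists 0, c. auto.
    - intros v. destruct (free v (ex 0 c)) eqn:E; auto. cbn [ex all neg form_syntax free] in E.
      apply andb_true_iff in E as [E1 E2]. apply Uc in E2 as ->. easy. }
  (* Instantiating validity in the set structure takes an assignment, hence an element of L_α. *)
  assert (Hne : exists o, o ∊ L_alpha).
  { exists emp. apply (closed_emp (fun x => x ∊ L_alpha)), kp_closed.
    apply (admissible_KPclass K alpha L_alpha); auto.
    now apply (represented_admissible R). }
  destruct Hne as [o Ho].
  specialize (Hv (fun _ => exist _ o Ho)). apply holds_set_structure in Hv.
  cbn [ex all neg form_syntax holds] in Hv. apply Hv. intros u Hul Hcu.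
  apply (Descend u 1), Hc; auto.
  apply (Delta0_absolute (fun x => x ∊ L_alpha)) in Hcu; auto.
  - apply (holds_unary _ _ _ u) in Hcu; auto.
  - now apply Trans_class.
  - intros v E. apply Uc in E as ->. now rewrite upd_same.
Qed.
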